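(* Under the Impartial Anonymous Culture (IAC), the limiting probability $p_{\mathrm{CW}}$, as the number of voters tends to infinity, that an election with five candidates has a Condorcet winner is exactly $$p_{\mathrm{CW}}=\frac{a}{b},$$ where $$a=760794547958864241496408591531018198021484884229346111658236615929935$$ and $$b=1010827262551214358630401511004028249102084136257935356483840264634368.$$
   Context: For five candidates there are $N=5!=120$ preference rankings (linear orders of the candidates), numbered $1,\dots,120$. A voting profile is a tuple $(x_1,\dots,x_{120})$ of nonnegative integers, where $x_i$ is the number of voters with preference ranking $i$; the number of voters is $k=x_1+\dots+x_{120}$. The Impartial Anonymous Culture (IAC) assumes that, for each fixed $k$, all voting profiles with $k$ voters are equally likely. For a given profile, candidate $A$ beats candidate $B$ in majority, written $A>_M B$, if the number of voters who rank $A$ above $B$ is strictly larger than the number of voters who rank $B$ above $A$. A Condorcet winner is a candidate who beats all other candidates in majority; it is unique if it exists. The probability in question is $$p_{\mathrm{CW}}=\lim_{k\to\infty}\frac{\#\{\text{voting profiles with } k \text{ voters that have a Condorcet winner}\}}{\#\{\text{all voting profiles with } k \text{ voters}\}}.$$ *)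

(* Defs.v *)
From mathcomp Require Import all_boot all_order all_algebra all_fingroup.
From mathcomp Require Import all_classical all_reals all_analysis.

Set Implicit Arguments.
Unset Strict Implicit.
Unset Printing Implicit Defensive.

Import Order.TTheory GRing.Theory Num.Theory.
Import numFieldNormedType.Exports.

Local Open Scope ring_scope.
Local Open Scope classical_set_scope.

(* A ranking [s] maps each of the [n] candidates to its position, position 0  *)
(* being the most preferred one. Since [s] is a bijection onto the positions, *)
(* the [n`!] rankings are in bijection with the linear orders on ['I_n].      *)
Definition ranking (n : nat) := {perm 'I_n}.

Definition ranks_above (n : nat) (s : ranking n) (a b : 'I_n) : bool :=
  (s a < s b)%N.

Definition voters (n : nat) (x : ranking n -> nat) : nat := (\sum_s x s)%N.

Definition supporters (n : nat) (x : ranking n -> nat) (a b : 'I_n) : nat :=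
  (\sum_(s | ranks_above s a b) x s)%N.

Definition majority_beats (n : nat) (x : ranking n -> nat) (a b : 'I_n) : bool :=
  (supporters x b a < supporters x a b)%N.

Definition is_condorcet_winner (n : nat) (x : ranking n -> nat) (a : 'I_n) :
    bool :=
  [forall b, (b != a) ==> majority_beats x a b].

Definition has_condorcet_winner (n : nat) (x : ranking n -> nat) : bool :=
  [exists a, is_condorcet_winner x a].

(* Taking the entries in ['I_k.+1] loses no profile with [k] voters, as such  *)
(* a profile has all its entries at most [k]; it makes their set finite.      *)
Definition profiles (n k : nat) : {set {ffun ranking n -> 'I_k.+1}} :=
  [set x : {ffun ranking n -> 'I_k.+1} | voters (fun s => val (x s)) == k].

Definition condorcet_profiles (n k : nat) :
    {set {ffun ranking n -> 'I_k.+1}} :=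
  [set x in profiles n k | has_condorcet_winner (fun s => val (x s))].

Definition iac_condorcet_probability (R : realType) (n k : nat) : R :=
  #|condorcet_profiles n k|%:R / #|profiles n k|%:R.

(* Main.v *)
Require Import Defs.
From mathcomp Require Import all_boot all_order all_algebra all_fingroup.
From mathcomp Require Import all_classical all_reals all_analysis.
From mathcomp Require Import ring lra zify.
From Stdlib Require Import BinInt.
From mathcomp Require Import ssrZ.
Import Order.TTheory GRing.Theory Num.Theory.
Import numFieldNormedType.Exports.
Local Open Scope ring_scope.
Local Open Scope classical_set_scope.
Set Implicit Arguments.
Unset Strict Implicit.
Unset Printing Implicit Defensive.
Delimit Scope nat_scope with N.
Delimit Scope Z_scope with BZ.

(** A Condorcet winner is unique and the candidates are interchangeable, so the limit is 5 times the
    limiting probability that candidate 0 wins ([card_condorcet_profiles], [condorcet_limit]). A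
    profile is a walk in Z^4 with one step of coordinates 1 or -1 per voter; its end point lists the
    margins of candidate 0, who wins when all four are positive. The limit is therefore a normalised
    polytope volume.

    The volume is computed by residues. For N steps (c, v), count the combinations of total time at
    most k whose first n coordinates are positive. This count times N!/k^N tends to (-1)^n times a
    sum of iterated residues of the product of all 1/(c - <v,t>) and all 1/t_i
    ([flag_formula_value]). The proof uses no contour integral: counts and residue sums obey the
    same rules. The main rule is the race 1/(uv) = 1/((u+v)u) + 1/((u+v)v), which, after scaling,
    cancels a coordinate against steps of opposite sign. Once a coordinate has only one sign left,
    it can be eliminated: by the residue theorem if the sign is positive ([sum_residue_roots],
    [sum_residue_positive]), and with value 0 if it is negative. The induction is [flag_formulaP].
    The passage from at most k voters to exactly k voters is [tauber].

    The 120 rankings give 16 sign vectors. The two constant ones occur 24 times each and their forms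
    add up to 2, so partial fractions replace the product of their powers by powers of one of them
    ([flag_sum_extremes]). Inclusion-exclusion and sign symmetry then leave only the systems
    [with_below], with 0 to 4 positivity constraints ([has_value_condorcet]). Only the flags listed
    by [poles] contribute ([has_value_poles]). For each of them a certificate gives coordinates in
    which the iterated residues fill an integer table, updated by a linear recursion for each
    division by a form ([tabulates_pass], [run_value]). The tables are evaluated exactly
    ([have_results0] to [have_results4]), and the weighted sum of the results, times 5, is the
    stated fraction. *)

Lemma mulr_div_cancel (L : fieldType) (p u v : L) :
  u != 0 -> p / v = p * u / (u * v).
Proof. by move=> u0; rewrite [p * u]mulrC -mulf_div divff ?mul1r. Qed.

Lemma subr_div_cross (L : fieldType) (a b c d x : L) : b != 0 -> d != 0 ->
  x * (c / d - a / b) * (b * d) = x * (c * b - a * d).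
Proof. by move=> b0 d0; field; rewrite b0 d0. Qed.

Lemma bezout_div (L : fieldType) (p x u v c y : L) : x != 0 -> y != 0 -> c != 0 ->
  p * (u * (x * y) + v * c) / (y * c) = p * v * x / (x * y) + p * u * x / c.
Proof. by move=> x0 y0 c0; field; rewrite x0 y0 c0. Qed.

Lemma partial_fraction2 (L : fieldType) (u v : L) :
  u != 0 -> v != 0 -> v - u != 0 -> u^-1 * v^-1 = (v - u)^-1 * (u^-1 - v^-1).
Proof. by move=> u0 v0 d0; field; rewrite u0 v0 d0. Qed.

(** * Residues at 0 of rational functions in one variable *)

Section Residue.
Variable K : fieldType.
Implicit Types (f g : {fraction {poly K}}) (P a b : {poly K}) (c r : K).

Definition fracX : {fraction {poly K}} := tofrac 'X.
Definition fracC c : {fraction {poly K}} := tofrac c%:P.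

(** The coefficient of X^-1: the polar part contributes the coefficient of X^N in [P], the regular
    part nothing. The degree of [P] is not bounded, so [N] may be raised freely. *)
Definition is_res f r := exists N P a b, [/\ b.[0] != 0,
  f = tofrac P / fracX ^+ N.+1 + tofrac a / tofrac b & r = P`_N].

Lemma tofrac_neq0 P : P != 0 -> tofrac P != 0.
Proof. by rewrite tofrac_eq0. Qed.

Lemma fracX_neq0 : fracX != 0.
Proof. by rewrite tofrac_neq0 ?polyX_eq0. Qed.

Lemma fracXn N : fracX ^+ N = tofrac 'X^N.
Proof. by rewrite /fracX -tofracXn. Qed.

Lemma horner0_neq0 P : P.[0] != 0 -> P != 0.
Proof. by apply: contraNneq => ->; rewrite horner0. Qed.

Lemma is_res_widen f r : is_res f r -> exists M, forall N, (M <= N)%N ->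
  exists P a b, [/\ b.[0] != 0,
  f = tofrac P / fracX ^+ N.+1 + tofrac a / tofrac b & r = P`_N].
Proof.
move=> [M [P [a [b [b0 -> ->]]]]]; exists M => N leMN.
exists (P * 'X^(N - M)), a, b; split=> //; last first.
  by rewrite coefMXn ltnNge leq_subr /= subKn.
congr (_ + _); rewrite tofracM -fracXn.
have -> : fracX ^+ N.+1 = fracX ^+ (N - M) * fracX ^+ M.+1.
  by rewrite -exprD addnS subnK.
by apply: mulr_div_cancel; rewrite expf_neq0 ?fracX_neq0.
Qed.

(** At a common pole order, the difference of the two numerators is divisible by X^(N+1), because
    the denominators of the regular parts are prime to X. Hence the coefficients of X^N agree. *)
Lemma is_res_uniq f r r' : is_res f r -> is_res f r' -> r = r'.
Proof.
move=> /is_res_widen [M hM] /is_res_widen [M' hM'].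
have [P [a [b [b0 Ef ->]]]] := hM (maxn M M') (leq_maxl _ _).
have [P' [a' [b' [b'0 + ->]]]] := hM' (maxn M M') (leq_maxr _ _).
rewrite Ef; set N := maxn _ _ => E.
have bn := tofrac_neq0 (horner0_neq0 b0).
have b'n := tofrac_neq0 (horner0_neq0 b'0).
have Xn : fracX ^+ N.+1 != 0 by rewrite expf_neq0 ?fracX_neq0.
have E1 : (P - P') * (b * b') = 'X^(N.+1) * (a' * b - a * b').
  apply/eqP; rewrite -tofrac_eq !(tofracM, tofracB) -fracXn; apply/eqP.
  set X := fracX ^+ _ in E Xn *.
  have {}E : tofrac P / X - tofrac P' / X = tofrac a' / tofrac b' - tofrac a / tofrac b.
    by apply/eqP; rewrite subr_eq addrAC eq_sym subr_eq E addrC.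
  have -> : tofrac P - tofrac P' = X * (tofrac P / X - tofrac P' / X).
    by rewrite -mulrBl mulrC divfK.
  by rewrite E subr_div_cross; [ | exact: bn | exact: b'n].
have cop : coprimep 'X^(N.+1) (b * b').
  by rewrite coprimep_expl // coprimep_sym -[X in coprimep _ X]subr0 coprimep_XsubC rootE hornerM mulf_neq0.
have : 'X^(N.+1) %| (P - P').
  by rewrite -(Gauss_dvdpl _ cop) E1 dvdp_mulr.
case/dvdpP => q E2; apply/eqP; rewrite -subr_eq0 -coefB E2 coefMXn ltnSn //.
Qed.

Lemma fracE f : exists P b, b != 0 /\ f = tofrac P / tofrac b.
Proof.
elim/quotW: f => x.
exists (frac x).1, (frac x).2; split; first exact: denom_ratioP.
apply: (canRL (mulfK _)); first by rewrite tofrac_eq0 denom_ratioP.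
rewrite !piE; apply/eqmodP; rewrite /= FracField.equivfE /FracField.mulf.
by rewrite !numden_Ratio ?mulf_neq0 ?oner_neq0 ?denom_ratioP //=; apply/eqP; ring.
Qed.

Lemma is_res_ex f : exists r, is_res f r.
Proof.
have [P [b [b0 ->]]] := fracE f.
have [N [c c0 Eb]] := multiplicity_XsubC b 0.
rewrite b0 /= in c0; rewrite subr0 in Eb.
have cop : coprimep 'X^(N.+1) c.
  by rewrite coprimep_expl // coprimep_sym -[X in coprimep _ X]subr0 coprimep_XsubC.
have /Bezout_eq1_coprimepP [[u v] /= uv] := cop.
(* The denominator is c X^N, while [is_res] wants X^(N+1) even for N = 0; this accounts for the
   extra factor X. *)
exists (P * v * 'X)`_N, N, (P * v * 'X), (P * u * 'X), c; split=> //.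
have cn : tofrac c != 0 :> {fraction {poly K}}.
  by apply/tofrac_neq0/horner0_neq0.
rewrite -[P in LHS]mulr1 -uv Eb !(tofracM, tofracD) -!fracXn exprS.
rewrite [tofrac c * _]mulrC bezout_div -?/fracX; first by [].
- exact: fracX_neq0.
- exact: (expf_neq0 _ fracX_neq0).
- exact: cn.
Qed.

Definition residue f : K := projT1 (cid (is_res_ex f)).

Lemma residueE f r : is_res f r -> residue f = r.
Proof. by apply/is_res_uniq; rewrite /residue; case: cid. Qed.

Lemma residueP f : is_res f (residue f).
Proof. by rewrite /residue; case: cid. Qed.

Lemma fracCM : {morph fracC : a b / a * b}.
Proof. by move=> a b; rewrite /fracC polyCM tofracM. Qed.

Lemma fracCD : {morph fracC : a b / a + b}.
Proof. by move=> a b; rewrite /fracC polyCD tofracD. Qed.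

Lemma fracC0 : fracC 0 = 0. Proof. by rewrite /fracC tofrac0. Qed.

Lemma fracC1 : fracC 1 = 1. Proof. by rewrite /fracC tofrac1. Qed.

Lemma fracCN : {morph fracC : a / - a}.
Proof. by move=> a; rewrite /fracC polyCN tofracN. Qed.

Lemma fracCV : {morph fracC : a / a^-1}.
Proof.
move=> a; have [->|a0] := eqVneq a 0; first by rewrite invr0 fracC0 invr0.
have c0 : fracC a != 0 by rewrite tofrac_neq0 ?polyC_eq0.
by apply: (mulfI c0); rewrite -fracCM !divff ?fracC1.
Qed.

Lemma residueD : {morph residue : f g / f + g}.
Proof.
move=> f g; have [M hM] := is_res_widen (residueP f).
have [M' hM'] := is_res_widen (residueP g).
have [P [a [b [b0 Ef ->]]]] := hM (maxn M M') (leq_maxl _ _).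
have [P' [a' [b' [b'0 Eg ->]]]] := hM' (maxn M M') (leq_maxr _ _).
apply: residueE; exists (maxn M M'), (P + P'), (a * b' + a' * b), (b * b').
split; [by rewrite hornerM mulf_neq0 | | by rewrite coefD].
rewrite {1}Ef Eg !(tofracD, tofracM) mulrDl addrACA; congr (_ + _).
by rewrite -addf_div ?tofrac_neq0 ?horner0_neq0.
Qed.

Lemma residueZ c f : residue (fracC c * f) = c * residue f.
Proof.
have [N [P [a [b [b0 Ef ->]]]]] := residueP f.
apply: residueE; exists N, (c%:P * P), (c%:P * a), b; split=> //.
  by rewrite {1}Ef mulrDr !mulrA -!tofracM.
by rewrite coefCM.
Qed.

Lemma residue0 : residue 0 = 0.
Proof. by rewrite -(mul0r 0) -fracC0 residueZ mul0r. Qed.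

Lemma residueN : {morph residue : f / - f}.
Proof. by move=> f; rewrite -[- f]mulN1r -fracC1 -fracCN residueZ mulN1r. Qed.

Lemma residueB : {morph residue : f g / f - g}.
Proof. by move=> f g; rewrite residueD residueN. Qed.

Lemma residue_sum I (s : seq I) (F : I -> {fraction {poly K}}) :
  residue (\sum_(i <- s) F i) = \sum_(i <- s) residue (F i).
Proof. by apply: (big_morph residue residueD residue0). Qed.

Lemma residue_regular (a b : {poly K}) :
  b.[0] != 0 -> residue (tofrac a / tofrac b) = 0.
Proof.
move=> b0; apply: residueE; exists 0%N, 0, a, b.
by rewrite tofrac0 mul0r add0r coef0.
Qed.

Lemma residueXV N : residue (fracX ^- N) = (N == 1%N)%:R.
Proof.
case: N => [|N].
  have -> : fracX ^- 0 = tofrac 1 / tofrac 1 by rewrite tofrac1 divr1 expr0 invr1.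
  by rewrite residue_regular // hornerC oner_neq0.
apply: residueE; exists N, 1, 0, 1; rewrite tofrac0 tofrac1 mul0r mul1r addr0.
by split; rewrite ?hornerC ?oner_neq0 // coef1 eqSS.
Qed.

Definition fracL (a c : K) : {fraction {poly K}} := fracC a + fracC c * fracX.

Lemma fracLE (a c : K) : fracL a c = tofrac (a%:P + c%:P * 'X).
Proof. by rewrite tofracD tofracM. Qed.

Lemma fracL_eq0 (a c : K) : (fracL a c == 0) = (a == 0) && (c == 0).
Proof.
rewrite fracLE tofrac_eq0; apply/eqP/andP => [E|[/eqP-> /eqP->]].
  move: (congr1 (fun p : {poly K} => p`_0) E) (congr1 (fun p : {poly K} => p`_1) E).
  rewrite !coefD !coefC !coefMX !coefC /= addr0 add0r => -> ->.
  by rewrite eqxx.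
by rewrite mul0r addr0.
Qed.

Lemma residue_prodL I (s : seq I) (a c : I -> K) :
  all (fun i => a i != 0) s -> residue (\prod_(i <- s) (fracL (a i) (c i))^-1) = 0.
Proof.
move=> s0; rewrite prodfV -[_^-1]mul1r.
under eq_bigr do rewrite fracLE.
rewrite -tofrac1 -rmorph_prod residue_regular //= horner_prod.
elim: s s0 => [|i s IHs]; first by rewrite big_nil oner_neq0.
by rewrite big_cons => /= /andP[i0 /IHs]; apply: mulf_neq0; rewrite !hornerE.
Qed.

(* The global residue theorem for the inverse of a product of linear         *)
(* polynomials.                                                              *)
Lemma sum_residue_roots (s R : seq K) : uniq R -> {subset s <= R} ->
  \sum_(r <- R) residue (\prod_(a <- s) (fracL (r - a) 1)^-1) = (size s == 1%N)%:R.
Proof.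
move=> uR; have [m] := ubnP (size s); elim: m s => // m IHm [|a s] /=.
  move=> _ _; rewrite big1 // => r _.
  by rewrite big_nil -[1]invr1 -(expr0 (fracX)) residueXV.
move=> sm sR; have [/all_pred1P Es | /allPn [b bs /= ba]] := boolP (all (pred1 a) s).
  rewrite (bigD1_seq a) ?sR ?mem_head //= [X in _ + X]big1 ?addr0 => [|r ra]; last first.
    apply: (@residue_prodL _ _ (fun x => r - x) (fun=> 1)).
    by rewrite /= subr_eq0 ra Es all_nseq /= subr_eq0 ra orbT.
  have -> : a :: s = nseq (size s).+1 a by rewrite /= -Es.
  rewrite big_nseq iter_mulr mulr1 subrr /fracL fracC0 fracC1 mul1r add0r exprVn.
  by rewrite residueXV.
have Ps : perm_eq s (b :: rem b s) by exact: perm_to_rem.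
set t := rem b s in Ps; have sz : size s = (size t).+1 by rewrite (perm_size Ps).
have ab : a - b != 0 by rewrite subr_eq0 eq_sym.
have tR c : c \in a :: s -> {subset c :: t <= R}.
  move=> cs x; rewrite inE => /orP[/eqP->|xt]; first exact: sR.
  by apply: sR; rewrite inE (perm_mem Ps) inE xt !orbT.
(* Partial fractions in the distinct roots [a] and [b] give two products with one factor less. By
   induction their residue sums are equal, so the difference is 0. *)
have -> : \sum_(r <- R) residue (\prod_(x <- a :: s) (fracL (r - x) 1)^-1) =
  (a - b)^-1 * (\sum_(r <- R) residue (\prod_(x <- a :: t) (fracL (r - x) 1)^-1)
  - \sum_(r <- R) residue (\prod_(x <- b :: t) (fracL (r - x) 1)^-1)).
  rewrite -sumrB mulr_sumr; apply: eq_bigr => r _.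
  rewrite -residueB -residueZ; congr residue.
  rewrite !big_cons (perm_big _ Ps) big_cons /= -mulrBl !mulrA; congr (_ * _).
  have n0 c : fracL (r - c) 1 != 0 by rewrite fracL_eq0 oner_eq0 andbF.
  have Ed : fracC (a - b) = fracL (r - b) 1 - fracL (r - a) 1.
    rewrite /fracL opprD addrACA subrr addr0 -fracCN -fracCD; congr fracC; ring.
  have d0 : fracC (a - b) != 0 by rewrite tofrac_neq0 ?polyC_eq0.
  rewrite fracCV Ed in d0 *.
  by rewrite (partial_fraction2 (n0 a) (n0 b) d0).
have at_ : {subset a :: t <= R} by apply: tR; rewrite inE eqxx.
have bt : {subset b :: t <= R} by apply: tR; rewrite inE bs orbT.
by rewrite !IHm ?subrr ?mulr0 ?sz //= -sz.
Qed.

End Residue.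

(** * Towers of rational function fields and iterated residues *)

Fixpoint tower n : fieldType :=
  if n is m.+1 then {fraction {poly tower m}} : fieldType else rat : fieldType.

Fixpoint tconst n : rat -> tower n :=
  if n is m.+1 return rat -> tower n then fun c => fracC (tconst m c) else id.

(** The generator adjoined last is treated first, the lower ones being constants for it. *)
Fixpoint iterres n : tower n -> rat :=
  if n is m.+1 return tower n -> rat
  then fun f : {fraction {poly tower m}} => iterres (residue f) else id.

Lemma tconstD n : {morph @tconst n : a b / a + b}.
Proof. by elim: n => //= n IHn a b; rewrite IHn fracCD. Qed.

Lemma tconstM n : {morph @tconst n : a b / a * b}.
Proof. by elim: n => //= n IHn a b; rewrite IHn fracCM. Qed.

Lemma tconst0 n : tconst n 0 = 0.
Proof. by elim: n => //= n ->; rewrite fracC0. Qed.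

Lemma tconst1 n : tconst n 1 = 1.
Proof. by elim: n => //= n ->; rewrite fracC1. Qed.

Lemma tconstN n : {morph @tconst n : a / - a}.
Proof. by elim: n => //= n IHn a; rewrite IHn fracCN. Qed.

Lemma tconstV n : {morph @tconst n : a / a^-1}.
Proof. by elim: n => //= n IHn a; rewrite IHn fracCV. Qed.

Lemma tconst_eq0 n a : (tconst n a == 0) = (a == 0).
Proof.
have [->|a0] := eqVneq a 0; first by rewrite tconst0 eqxx.
apply/negP => /eqP t0; have := oner_neq0 (tower n).
by rewrite -tconst1 -(divff a0) tconstM t0 mul0r eqxx.
Qed.

Lemma iterresD n : {morph @iterres n : f g / f + g}.
Proof. by elim: n => //= n IHn f g; rewrite residueD IHn. Qed.

Lemma iterresZ n c f : iterres (tconst n c * f) = c * iterres f.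
Proof. by elim: n f => //= n IHn f; rewrite residueZ IHn. Qed.

Lemma iterres0 n : iterres (0 : tower n) = 0.
Proof. by rewrite -(mul0r 0) -(tconst0 n) iterresZ mul0r. Qed.

Lemma iterresN n : {morph @iterres n : f / - f}.
Proof. by move=> f; rewrite -[- f]mulN1r -(tconst1 n) -tconstN iterresZ mulN1r. Qed.

Lemma iterres_sum n I (s : seq I) (F : I -> tower n) :
  iterres (\sum_(i <- s) F i) = \sum_(i <- s) iterres (F i).
Proof. by apply: (big_morph (@iterres n) (@iterresD n) (iterres0 n)). Qed.

(* The value at the generators e_0, ..., e_(n-1) of the tower of the affine  *)
(* function [s_0 + s_1 e_0 + ... + s_n e_(n-1)].                             *)
Fixpoint teval n (s : seq rat) : tower n :=
  if n is m.+1 return tower n then fracL (teval m s) (tconst m s`_m.+1) else s`_0.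

Lemma eq_teval n s t : (forall i, (i <= n)%N -> s`_i = t`_i) -> teval n s = teval n t.
Proof.
elim: n => [|n IHn] E /=; first exact: E.
by rewrite E // IHn // => i ltin; rewrite E // leqW.
Qed.

Lemma tevalD n s t u : (forall i, (i <= n)%N -> u`_i = s`_i + t`_i) ->
  teval n u = teval n s + teval n t.
Proof.
elim: n => [|n IHn] E /=; first exact: E.
rewrite E // IHn => [|i ltin]; last by rewrite E // leqW.
by rewrite /fracL tconstD !fracCD mulrDl addrACA.
Qed.

Lemma tevalZ n c s u : (forall i, (i <= n)%N -> u`_i = c * s`_i) ->
  teval n u = tconst n c * teval n s.
Proof.
elim: n => [|n IHn] E /=; first exact: E.
rewrite E // IHn => [|i ltin]; last by rewrite E // leqW.
by rewrite /fracL tconstM !fracCM mulrDr mulrA.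
Qed.

Lemma teval_eq0 n s : (teval n s == 0) = [forall i : 'I_n.+1, s`_i == 0].
Proof.
elim: n => [|n IHn] /=.
  by apply/eqP/forallP => [s0 i|/(_ ord0)/eqP //]; rewrite ord1 /= s0.
rewrite fracL_eq0 IHn tconst_eq0; apply/andP/forallP => [[/forallP s0 sn i]|s0].
  have := ltn_ord i; rewrite ltnS leq_eqVlt => /orP[/eqP-> // | ltin].
  exact: (s0 (Ordinal ltin)).
split; last exact: (s0 ord_max).
by apply/forallP => i; apply: (s0 (widen_ord (leqnSn _) i)).
Qed.

Lemma teval_neq0 n s i : (i <= n)%N -> s`_i != 0 -> teval n s != 0.
Proof.
by move=> lein; apply: contraNN; rewrite teval_eq0 => /forallP /(_ (Ordinal (lein : i < n.+1)%N)).
Qed.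

(** * Affine changes of variables given by flags *)

Definition form_axpy n (a : rat) (s t : seq rat) :=
  mkseq (fun i => s`_i + a * t`_i) n.+1.

(* A flag lists, highest coordinate first, affine functions expressing the   *)
(* coordinate [t_i], up to a new variable [e_i], through the lower ones;     *)
(* [subst] rewrites an affine function of the [t_i] in terms of the [e_i].   *)
Fixpoint subst (phi : seq (seq rat)) (s : seq rat) : seq rat :=
  if phi is r :: phi' then
    rcons (subst phi' (form_axpy (size phi') s`_(size phi').+1 s r))
          s`_(size phi').+1
  else [:: s`_0].

Lemma size_subst phi s : size (subst phi s) = (size phi).+1.
Proof. by elim: phi s => //= r phi IH s; rewrite size_rcons IH. Qed.

Lemma nth_form_axpy n a s t i : (i <= n)%N -> (form_axpy n a s t)`_i = s`_i + a * t`_i.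
Proof. by move=> lein; rewrite nth_mkseq. Qed.

Lemma substD phi s t u : (forall i, (i <= size phi)%N -> u`_i = s`_i + t`_i) ->
  forall i, (subst phi u)`_i = (subst phi s)`_i + (subst phi t)`_i.
Proof.
elim: phi s t u => /= [|r phi IH] s t u E i.
  by case: i => [|i] /=; rewrite ?E // nth_nil addr0.
rewrite !nth_rcons !size_subst; case: ltnP => [ltin|_]; last first.
  by case: eqP => _; rewrite ?E ?addr0.
apply: IH => j lej; rewrite !nth_form_axpy // (E j (leqW lej)) (E _ (leqnn _)); ring.
Qed.

Lemma substZ phi c s u : (forall i, (i <= size phi)%N -> u`_i = c * s`_i) ->
  forall i, (subst phi u)`_i = c * (subst phi s)`_i.
Proof.
elim: phi s u => /= [|r phi IH] s u E i.
  by case: i => [|i] /=; rewrite ?E // nth_nil mulr0.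
rewrite !nth_rcons !size_subst; case: ltnP => [ltin|_]; last first.
  by case: eqP => _; rewrite ?E ?mulr0.
apply: IH => j lej; rewrite !nth_form_axpy // (E j (leqW lej)) (E _ (leqnn _)); ring.
Qed.

Definition feval phi s : tower (size phi) := teval (size phi) (subst phi s).

Lemma fevalD phi s t u : (forall i, (i <= size phi)%N -> u`_i = s`_i + t`_i) ->
  feval phi u = feval phi s + feval phi t.
Proof. by move=> E; apply: tevalD => i _; apply: substD. Qed.

Lemma fevalZ phi c s u : (forall i, (i <= size phi)%N -> u`_i = c * s`_i) ->
  feval phi u = tconst (size phi) c * feval phi s.
Proof. by move=> E; apply: tevalZ => i _; apply: substZ. Qed.

Lemma eq_feval phi s u : (forall i, (i <= size phi)%N -> u`_i = s`_i) ->
  feval phi u = feval phi s.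
Proof.
move=> E; rewrite (@fevalZ phi 1 s) ?tconst1 ?mul1r // => i lei.
by rewrite E ?mul1r.
Qed.

Lemma feval_nil s : feval [::] s = s`_0. Proof. by []. Qed.

(** The top entry of the flag means t_n = e_n + r(t_0, ..., t_(n-1)): the coefficient of e_n is that
    of t_n, and the rest absorbs this coefficient times [r]. *)
Lemma feval_cons r phi s : feval (r :: phi) s =
  fracL (feval phi s + tconst _ s`_(size phi).+1 * feval phi r)
        (tconst (size phi) s`_(size phi).+1).
Proof.
rewrite /feval /= nth_rcons size_subst ltnn eqxx; congr fracL.
set a := s`_ _.
rewrite (@eq_teval _ _ (subst phi (form_axpy (size phi) a s r))); last first.
  by move=> i lei; rewrite nth_rcons size_subst ltnS lei.
rewrite -!/(feval _ _) -(@fevalZ phi a r (map ( *%R a) r)); last first.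
  move=> i _; have [lti|lei] := ltnP i (size r); first by rewrite (nth_map 0).
  by rewrite !nth_default ?mulr0 ?size_map.
apply: fevalD => i lei; rewrite nth_form_axpy //; congr (_ + _).
have [lti|lei'] := ltnP i (size r); first by rewrite (nth_map 0).
by rewrite [RHS]nth_default ?size_map // nth_default ?mulr0.
Qed.

(** The change of variables is unitriangular, so a nonzero form stays nonzero. *)
Lemma feval_neq0 phi s i : (i <= size phi)%N -> s`_i != 0 -> feval phi s != 0.
Proof.
elim: phi s i => [|r phi IH] s i /=; first by rewrite leqn0 => /eqP->.
move=> lei si; rewrite feval_cons fracL_eq0 negb_and tconst_eq0.
have [a0|_] := eqVneq s`_(size phi).+1 0; last by rewrite orbT.
rewrite a0 tconst0 mul0r addr0 orbF.
move: lei; rewrite leq_eqVlt => /orP[/eqP Ei|]; last by rewrite ltnS => /IH; apply.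
by move: si; rewrite Ei a0 eqxx.
Qed.

Lemma feval_inj phi s t : size s = (size phi).+1 -> size t = (size phi).+1 ->
  feval phi s = feval phi t -> s = t.
Proof.
move=> ss st E; apply: (@eq_from_nth _ 0) => [|i]; rewrite ss ?st // => lti.
apply/eqP; rewrite -subr_eq0.
pose u := form_axpy (size phi) (-1) s t.
have : feval phi s = feval phi u + feval phi t.
  by apply: fevalD => j lej; rewrite nth_form_axpy //; ring.
rewrite E => /eqP; rewrite -subr_eq subrr eq_sym => /eqP u0.
apply/eqP; case: (eqVneq (s`_i - t`_i) 0) => // d.
have := @feval_neq0 phi u i lti; rewrite nth_form_axpy // mulN1r u0 eqxx.
by move=> /(_ d).
Qed.

(** * The system of affine forms of a walk and its sum of residues over flags *)

(* A step [(c, v)]: [c] units of time during which the walk moves by [v].    *)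
Definition step := (nat * seq int)%type.

(* The affine function [c - <v, t>] attached to a step.                      *)
Definition form_of (f : step) : seq rat := f.1%:R :: [seq - x%:~R | x <- f.2].

Definition coord_form i : seq rat := rcons (nseq i.+1 0) 1.

(** These are the denominators of the generating function to leading order: one form for each step,
    and one factor t_i for each constraint that a coordinate be positive. *)
Definition system n (m : seq step) : seq (seq rat) :=
  map form_of m ++ map coord_form (iota 0 n).

Lemma form_of0 f : (form_of f)`_0 = f.1%:R. Proof. by []. Qed.

Lemma form_ofS f i : (form_of f)`_i.+1 = - (f.2`_i)%:~R.
Proof.
rewrite /=; have [lti|lei] := ltnP i (size f.2); first by rewrite (nth_map 0).
by rewrite !nth_default ?size_map // oppr0.
Qed.

Lemma nth_coord_form i j : (coord_form i)`_j = (j == i.+1)%:R.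
Proof. by rewrite nth_rcons size_nseq nth_nseq; case: ltngtP. Qed.

Definition integrand phi (a : seq (seq rat)) : tower (size phi) :=
  \prod_(s <- a) (feval phi s)^-1.

Fixpoint flags n (R : nat -> seq (seq rat)) : seq (seq (seq rat)) :=
  if n is m.+1 then [seq r :: phi | r <- R m, phi <- flags m R] else [:: [::]].

Definition flag_sum n R (a : seq (seq rat)) : rat :=
  \sum_(phi <- flags n R) iterres (integrand phi a).

(** Positivity of the constant term selects poles: the root in t_n of c - <v,t> has it exactly when
    v_n > 0, and the pole t_n = 0 lacks it. *)
Definition admissible (R : nat -> seq (seq rat)) := forall i,
  uniq (R i) /\ {in R i, forall r, size r = i.+1 /\ 0 < r`_0}.

Lemma size_flags n R phi : phi \in flags n R -> size phi = n.
Proof.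
elim: n phi => [|n IHn] phi /=; first by rewrite inE => /eqP->.
by case/allpairsP => -[r psi] /= [_ /IHn <- ->].
Qed.

Lemma flag_sumS n R a : flag_sum n.+1 R a =
  \sum_(phi <- flags n R) iterres (\sum_(r <- R n) residue (integrand (r :: phi) a)).
Proof.
rewrite /flag_sum /= big_allpairs_dep exchange_big /=; apply: eq_bigr => phi _.
by rewrite iterres_sum.
Qed.

Lemma perm_flag_sum n R a b : perm_eq a b -> flag_sum n R a = flag_sum n R b.
Proof.
move=> Pab; apply: eq_bigr => phi _; congr iterres; exact: perm_big.
Qed.

Lemma simple_pole_split (L : fieldType) (x u v p : L) :
  x != 0 -> u != 0 -> u + v * x != 0 -> x^-1 * ((u + v * x)^-1 * p) =
  u^-1 * (x^-1 * p) - v / u * ((u + v * x)^-1 * p).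
Proof. by move=> x0 u0 d0; field; rewrite x0 u0 d0. Qed.

Lemma residue_simple_pole (K : fieldType) (s : seq (K * K)) :
  all (fun l => l.1 != 0) s ->
  residue ((fracL 0 1)^-1 * \prod_(l <- s) (fracL l.1 l.2)^-1) = \prod_(l <- s) l.1^-1.
Proof.
have -> : fracL 0 1 = fracX K by rewrite /fracL fracC0 fracC1 add0r mul1r.
elim: s => [|l s IHs] /=; first by rewrite !big_nil mulr1 -[fracX K]expr1 residueXV.
case/andP => l0 s0; rewrite !big_cons -IHs // -residueZ fracCV.
have n0 : fracL l.1 l.2 != 0 by rewrite fracL_eq0 negb_and l0.
set P := \prod_(_ <- s) _.
have c0 : fracC l.1 != 0 by rewrite tofrac_neq0 ?polyC_eq0.
have -> : (fracX K)^-1 * ((fracL l.1 l.2)^-1 * P) =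
  (fracC l.1)^-1 * ((fracX K)^-1 * P) -
  fracC (l.2 / l.1) * ((fracL l.1 l.2)^-1 * P).
  by rewrite fracCM fracCV (simple_pole_split P (fracX_neq0 K) c0 n0).
rewrite residueB residueZ.
have -> : (fracL l.1 l.2)^-1 * P = \prod_(l <- l :: s) (fracL l.1 l.2)^-1 by rewrite big_cons.
by rewrite residue_prodL /= ?l0 // mulr0 subr0.
Qed.

(** * Summing the residues in one variable *)

Section Levels.
Variables (phi : seq (seq rat)) (m : seq step).
Hypothesis (pos_m : all (fun f => 0 < f.1)%N m).
Local Notation n := (size phi).

Let lowered r s : tower (size phi) * tower (size phi) :=
  (feval phi s + tconst _ s`_(size phi).+1 * r, tconst _ s`_(size phi).+1).

Let integrandS r a : integrand (r :: phi) a =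
  \prod_(l <- map (lowered (feval phi r)) a) (fracL l.1 l.2)^-1.
Proof. by rewrite big_map; apply: eq_bigr => s _; rewrite feval_cons. Qed.

Let feval_top : feval phi (coord_form n) = 0.
Proof.
rewrite (@fevalZ phi 0 (coord_form n)) ?tconst0 ?mul0r // => j lej.
by rewrite nth_coord_form mul0r (ltn_eqF (lej : j < n.+1)%N).
Qed.

(** At t_n = r a form c - <v,t> with v_n <= 0 has constant term at least c > 0, and t_n itself
    becomes e_n plus a nonzero form. Hence no factor vanishes at e_n = 0. *)
Lemma residue_no_pole r : 0 < r`_0 -> {in m, forall f, f.2`_n <= 0} ->
  residue (integrand (r :: phi) (system n.+1 m)) = 0.
Proof.
move=> r0 neg; rewrite integrandS residue_prodL // all_map.
apply/allP => s /=; rewrite mem_cat => /orP[/mapP[f fm ->]|/mapP[i + ->]].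
  pose u := form_axpy (size phi) (form_of f)`_(size phi).+1 (form_of f) r.
  have -> : feval phi (form_of f) + tconst _ (form_of f)`_(size phi).+1 * feval phi r
    = feval phi u.
    rewrite -(@fevalZ phi _ r (mkseq (fun i => (form_of f)`_(size phi).+1 * r`_i) (size phi).+1)).
      by symmetry; apply: fevalD => i lei; rewrite nth_form_axpy // nth_mkseq.
    by move=> i lei; rewrite nth_mkseq.
  apply: (@feval_neq0 _ _ 0) => //; rewrite nth_form_axpy // form_of0 form_ofS gt_eqF //.
  rewrite ltr_pwDl // ?ltr0n ?(allP pos_m) // mulr_ge0 ?(ltW r0) //.
  by rewrite oppr_ge0 lerz0 neg.
rewrite mem_iota add0n ltnS nth_coord_form eqSS => /= lein.
have [->|ni] := altP (i =P n).
  by rewrite eqxx tconst1 mul1r feval_top add0r (@feval_neq0 _ _ 0) ?gt_eqF.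
rewrite (eq_sym n) (negbTE ni) tconst0 mul0r addr0.
have lti : (i < n)%N by rewrite ltn_neqAle ni.
by rewrite (@feval_neq0 _ _ i.+1) // nth_coord_form eqxx oner_neq0.
Qed.

Definition step_root k (f : step) : seq rat :=
  mkseq (fun i => (form_of f)`_i / (f.2`_k)%:~R) k.+1.

(** All poles in t_n are 0 and the step roots, which lie in [R n]. There are at least two linear
    factors in t_n, so the residues at all poles sum to 0; the one at 0 merely removes the factor
    t_n and sets t_n = 0 elsewhere. *)
Lemma sum_residue_positive R : admissible R ->
  {in m, forall f, 0 <= f.2`_n} -> has (fun f => 0 < f.2`_n) m ->
  {subset [seq step_root n f | f <- m & 0 < f.2`_n] <= R n} ->
  \sum_(r <- R n) residue (integrand (r :: phi) (system n.+1 m)) =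
  - integrand phi (system n m).
Proof.
move=> admR pos has_pos subR.
pose roots := 0 :: [seq feval phi (step_root n f) | f <- m & 0 < f.2`_n].
pose RR := 0 :: map (feval phi) (R n).
have [uR szR] := admR n.
pose cst := \prod_(f <- m) (if 0 < f.2`_n then tconst (size phi) (- (f.2`_n)%:~R)
     else feval phi (form_of f))^-1 *
  \prod_(i <- iota 0 n) (feval phi (coord_form i))^-1.
pose I x := \prod_(l <- map (lowered x) (system n.+1 m)) (fracL l.1 l.2)^-1.
(* Around any centre [x] the integrand is a constant, independent of [x], times the product of 1/(x
   - a + e_n) over the roots a. *)
have IE x : I x = fracC cst * \prod_(a <- roots) (fracL (x - a) 1)^-1.
  rewrite /I /system map_cat big_cat !big_map /roots /cst.
  rewrite big_cons big_map big_filter.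
  rewrite -{1}addn1 iotaD big_cat big_seq1 /= add0n.
  have -> : fracL (lowered x (coord_form n)).1 (lowered x (coord_form n)).2 = fracL (x - 0) 1.
    by rewrite /lowered !nth_coord_form /= eqxx tconst1 mul1r subr0 feval_top add0r.
  have -> : \prod_(i <- iota 0 n) (fracL (lowered x (coord_form i)).1 (lowered x (coord_form i)).2)^-1
    = fracC (\prod_(i <- iota 0 n) (feval phi (coord_form i))^-1).
    rewrite (big_morph _ (@fracCM _) (@fracC1 _)) big_seq [RHS]big_seq.
    apply: eq_bigr => i; rewrite mem_iota add0n => /andP[_ lti].
    rewrite /lowered !nth_coord_form eqSS (gtn_eqF lti) tconst0 mul0r addr0.
    by rewrite /fracL fracC0 mul0r addr0 fracCV.
  have -> : \prod_(f <- m) (fracL (lowered x (form_of f)).1 (lowered x (form_of f)).2)^-1 =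
    fracC (\prod_(f <- m) (if 0 < f.2`_n then tconst (size phi) (- (f.2`_n)%:~R)
     else feval phi (form_of f))^-1) *
    \prod_(f <- m | 0 < f.2`_n) (fracL (x - feval phi (step_root n f)) 1)^-1.
    rewrite (big_morph _ (@fracCM _) (@fracC1 _)) [X in _ * X]big_mkcond -big_split.
    apply: eq_big_seq => f fm; rewrite -[RHS]/(_ * _) /lowered -form_ofS.
    case: ifP => vpos; last first.
      have v0 : f.2`_n = 0 by apply/eqP; rewrite eq_le pos // leNgt vpos.
      rewrite form_ofS v0 oppr0 tconst0 mul0r addr0 mulr1 fracCV.
      by rewrite /fracL fracC0 mul0r addr0.
    rewrite fracCV -invfM; congr _^-1.
    rewrite /fracL fracC1 mul1r mulrDr -fracCM; congr (fracC _ + _).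
    rewrite mulrBr addrC; congr (_ + _).
    rewrite -mulNr -tconstN form_ofS opprK; apply: fevalZ => i lei.
    by rewrite nth_mkseq // mulrC divfK // intr_eq0 gt_eqF.
  rewrite fracCM; set A := fracC _; set B := \prod_(f <- m | _) _; set C := fracC _.
  by rewrite -!mulrA; congr (_ * _); rewrite mulrC -!mulrA; congr (_ * _); rewrite mulrC.
(* The root 0 and at least one step root make two factors, so the global residue theorem gives 0. *)
have tot : \sum_(x <- RR) residue (I x) = 0.
  under eq_bigr do rewrite IE residueZ.
  rewrite -mulr_sumr sum_residue_roots ?mulr0 //.
  - rewrite /roots /= size_map size_filter eqSS.
    by move: has_pos; rewrite has_count; case: count => //= k _; rewrite mulr0.
  - rewrite /RR /= map_inj_in_uniq ?uR ?andbT; last first.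
      move=> r r' /szR[sr _] /szR[sr' _]; exact: feval_inj.
    apply/mapP => -[r /szR[_ r0] /esym/eqP]; apply/negP.
    by rewrite (@feval_neq0 _ _ 0) ?gt_eqF.
  - move=> x; rewrite /roots /RR !inE; case: eqP => //= _ /mapP[f fm ->].
    by apply: map_f; apply: subR; apply: map_f.
move: tot; rewrite /RR big_cons big_map => /eqP; rewrite addrC addr_eq0 => /eqP.
under eq_bigr do rewrite -/(I _) /I -integrandS.
move=> ->; congr (- _); rewrite /I.
have -> : system n.+1 m = system n m ++ [:: coord_form n].
  by rewrite /system -addn1 iotaD map_cat catA.
rewrite map_cat big_cat big_seq1 -[X in residue X]/(_ * _) mulrC.
have -> : lowered 0 (coord_form n) = (0, 1).
  by rewrite /lowered mulr0 addr0 nth_coord_form eqxx tconst1 feval_top.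
rewrite residue_simple_pole ?big_map; last first.
  rewrite all_map; apply/allP => s /=; rewrite mulr0 addr0 mem_cat => /orP[/mapP[f fm ->]|/mapP[i + ->]].
    by rewrite (@feval_neq0 _ _ 0) // form_of0 pnatr_eq0 -lt0n (allP pos_m).
  rewrite mem_iota add0n => /andP[_ lti].
  by rewrite (@feval_neq0 _ _ i.+1) // nth_coord_form eqxx oner_neq0.
by rewrite /integrand; apply: eq_bigr => s _; rewrite /= mulr0 addr0.
Qed.

End Levels.

(** * Scaling and racing of steps in flag sums *)

Definition scale_step b (f : step) : step := ((b * f.1)%N, [seq b%:Z * x | x <- f.2]).

Definition add_step (f g : step) : step :=
  ((f.1 + g.1)%N, mkseq (fun i => f.2`_i + g.2`_i) (maxn (size f.2) (size g.2))).

Lemma nth_scale_step b f i : (scale_step b f).2`_i = b%:Z * f.2`_i.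
Proof.
have [lti|lei] := ltnP i (size f.2); first by rewrite (nth_map 0).
by rewrite !nth_default ?size_map // mulr0.
Qed.

Lemma nth_add_step f g i : (add_step f g).2`_i = f.2`_i + g.2`_i.
Proof.
have [lti|] := ltnP i (maxn (size f.2) (size g.2)); first by rewrite nth_mkseq.
move=> lei; move: (lei); rewrite geq_max => /andP[lef leg].
by rewrite !nth_default ?size_mkseq // addr0.
Qed.

Lemma integrand_cons phi s a :
  integrand phi (s :: a) = (feval phi s)^-1 * integrand phi a.
Proof. by rewrite /integrand big_cons. Qed.

Lemma race_identity (L : fieldType) (u v w : L) : u != 0 -> v != 0 -> u + v != 0 ->
  (u + v)^-1 * (u^-1 * w) + (u + v)^-1 * (v^-1 * w) = u^-1 * (v^-1 * w).
Proof. by move=> u0 v0 d0; field; rewrite d0 u0 v0. Qed.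

(** The form of [add_step f g] is the sum u + v of the two forms, so 1/(uv) = 1/((u+v)u) +
    1/((u+v)v) holds in every integrand. *)
Lemma flag_sum_race n R f g a : (0 < f.1)%N -> (0 < g.1)%N ->
  flag_sum n R (form_of (add_step f g) :: form_of f :: a) +
  flag_sum n R (form_of (add_step f g) :: form_of g :: a) =
  flag_sum n R (form_of f :: form_of g :: a).
Proof.
move=> f0 g0; rewrite /flag_sum -big_split; apply: eq_bigr => phi _.
rewrite -[LHS]/(_ + _) -iterresD !integrand_cons; congr iterres.
have E : feval phi (form_of (add_step f g)) = feval phi (form_of f) + feval phi (form_of g).
  apply: fevalD => -[|i] _; rewrite ?form_of0 ?natrD // !form_ofS nth_add_step.
  by rewrite rmorphD opprD.
have E0 : feval phi (form_of (add_step f g)) != 0.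
  by rewrite (@feval_neq0 _ _ 0) // pnatr_eq0 addn_eq0 negb_and -lt0n f0.
rewrite E in E0 *; apply: race_identity => //.
  by rewrite (@feval_neq0 _ _ 0) // pnatr_eq0 -lt0n.
by rewrite (@feval_neq0 _ _ 0) // pnatr_eq0 -lt0n.
Qed.

Lemma flag_sum_scale n R b f a : (0 < b)%N ->
  flag_sum n R (form_of f :: a) = b%:R * flag_sum n R (form_of (scale_step b f) :: a).
Proof.
move=> b0; rewrite /flag_sum mulr_sumr; apply: eq_bigr => phi _.
rewrite -iterresZ !integrand_cons; congr iterres.
have bn : tconst (size phi) b%:R != 0 by rewrite tconst_eq0 pnatr_eq0 -lt0n.
rewrite (@fevalZ phi b%:R (form_of f) (form_of (scale_step b f))) => [|[|i] _]; last 2 first.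
- by rewrite !form_of0 natrM.
- by rewrite !form_ofS nth_scale_step rmorphM mulrN.
by rewrite invfM !mulrA divff // mul1r.
Qed.

Definition positive_steps (m : seq step) := all (fun f => 0 < f.1)%N m.

Definition nonzero_coords n (m : seq step) :=
  forall i, (i < n)%N -> has (fun f : step => f.2`_i != 0) m.

Definition signed_flag_sum n R (m : seq step) : rat :=
  (-1) ^+ n * flag_sum n R (system n m).

(** * The residue formula for any quantity obeying the rules of a volume *)

Section FlagFormula.
Variable value : nat -> seq step -> rat -> Prop.
Hypothesis value_perm : forall n m m' x, positive_steps m -> perm_eq m m' -> value n m x -> value n m' x.
Hypothesis value_race : forall n f g m x y, positive_steps (f :: g :: m) ->
  value n (add_step f g :: f :: m) x -> value n (add_step f g :: g :: m) y ->
  value n (f :: g :: m) (x + y).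
Hypothesis value_scale : forall n b f m x, (0 < b)%N -> positive_steps (f :: m) ->
  value n (scale_step b f :: m) x -> value n (f :: m) (b%:R * x).
Hypothesis value_drop : forall n m x, positive_steps m ->
  all (fun f : step => 0 <= f.2`_n) m -> has (fun f : step => 0 < f.2`_n) m ->
  value n m x -> value n.+1 m x.
Hypothesis value_zero : forall n m, positive_steps m ->
  all (fun f : step => f.2`_n <= 0) m -> has (fun f : step => f.2`_n < 0) m ->
  value n.+1 m 0.
Hypothesis value0 : forall m, positive_steps m ->
  value 0 m (\prod_(f <- m) f.1%:R^-1).

(** The formula is asked for every family containing some [B], since the systems combined in the
    induction have different roots and must share one family. *)
Definition flag_formula n m := exists2 B, admissible B & forall R, admissible R ->
  (forall i, (i < n)%N -> {subset B i <= R i}) -> value n m (signed_flag_sum n R m).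

Lemma flag_formula_perm n m m' : positive_steps m -> perm_eq m m' -> flag_formula n m -> flag_formula n m'.
Proof.
move=> pos Pm [B aB HB]; exists B => // R aR sR.
have -> : signed_flag_sum n R m' = signed_flag_sum n R m.
  congr (_ * _); apply: perm_flag_sum.
  by rewrite perm_cat2r perm_map // perm_sym.
exact: value_perm pos Pm (HB R aR sR).
Qed.

Lemma flag_formula_scale n b f m : (0 < b)%N -> positive_steps (f :: m) ->
  flag_formula n (scale_step b f :: m) -> flag_formula n (f :: m).
Proof.
move=> b0 pos [B aB HB]; exists B => // R aR sR.
rewrite /signed_flag_sum /= (flag_sum_scale _ _ _ _ b0) mulrCA.
by apply: value_scale => //; apply: HB.
Qed.

Lemma flag_formula_race n f g m : positive_steps (f :: g :: m) ->
  flag_formula n (add_step f g :: f :: m) -> flag_formula n (add_step f g :: g :: m) ->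
  flag_formula n (f :: g :: m).
Proof.
move=> pos [B aB HB] [C aC HC]; exists (fun i => undup (B i ++ C i)) => [i|R aR sR].
  split; first exact: undup_uniq.
  by move=> r; rewrite mem_undup mem_cat => /orP[/(proj2 (aB i))|/(proj2 (aC i))].
have -> : signed_flag_sum n R (f :: g :: m) =
    signed_flag_sum n R (add_step f g :: f :: m) +
    signed_flag_sum n R (add_step f g :: g :: m).
  case/and3P: (pos) => f0 g0 _.
  by rewrite /signed_flag_sum /= -mulrDr flag_sum_race.
apply: value_race => //; [apply: HB => // i ltin r rB|apply: HC => // i ltin r rB];
  by apply: sR; rewrite // mem_undup mem_cat rB ?orbT.
Qed.

(** Induction on the number of coordinates, then on the number of steps with nonzero last
    coordinate. If both signs occur, a race between a positive and a negative step, scaled so that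
    their sum has last coordinate 0, lowers this number in both resulting systems. If one sign is
    left, the coordinate is dropped or the value is 0. *)
Theorem flag_formulaP n m : positive_steps m -> nonzero_coords n m -> flag_formula n m.
Proof.
elim: n m => [|n IHn] m pos nd.
  exists (fun=> [::]) => // R _ _; rewrite /signed_flag_sum mul1r.
  by rewrite /flag_sum big_seq1 /system cats0 /integrand /= big_map; apply: value0.
have [k] := ubnP (count (fun f : step => f.2`_n != 0) m).
elim: k m pos nd => // k IHk m pos nd cm.
have [/hasP[f fm fn]|] := boolP (has (fun f : step => 0 < f.2`_n) m); last first.
  rewrite -all_predC => np.
  have npos : all (fun f : step => f.2`_n <= 0) m by apply: sub_all np => f /=; rewrite leNgt.
  exists (fun=> [::]) => // R aR _; rewrite /signed_flag_sum flag_sumS big_seq big1 ?mulr0.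
    apply: value_zero => //; have /hasP[f fm fn] := nd n (ltnSn n).
    by apply/hasP; exists f; rewrite // lt_neqAle fn (allP npos).
  move=> phi /size_flags sphi; rewrite big_seq big1 ?iterres0 // => r rR.
  rewrite -sphi in rR *; apply: residue_no_pole => //; first by have [_ /(_ r rR) []] := aR (size phi).
  by rewrite sphi; apply/allP.
have [/hasP[g gm gn]|] := boolP (has (fun f : step => f.2`_n < 0) m); last first.
  rewrite -all_predC => nn.
  have nneg : all (fun f : step => 0 <= f.2`_n) m by apply: sub_all nn => g /=; rewrite leNgt.
  have hp : has (fun f : step => 0 < f.2`_n) m by apply/hasP; exists f.
  have [B aB HB] : flag_formula n m by apply: IHn => // i ltin; apply: nd; rewrite ltnS ltnW.
  pose roots := [seq step_root n f | f <- m & 0 < f.2`_n].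
  exists (fun i => if i == n then undup roots else B i) => [i|R aR sR].
    case: eqP => [->|_]; last exact: aB.
    split; first exact: undup_uniq.
    move=> r; rewrite mem_undup => /mapP[h]; rewrite mem_filter => /andP[hn hm] ->.
    by rewrite size_mkseq /= divr_gt0 ?ltr0n ?ltr0z // (allP pos).
  (* The sign gained with the new coordinate cancels the minus sign of [sum_residue_positive]. *)
  have -> : signed_flag_sum n.+1 R m = signed_flag_sum n R m.
    rewrite /signed_flag_sum exprS mulN1r mulNr -mulrN; congr (_ * _).
    rewrite flag_sumS /flag_sum -sumrN big_seq [RHS]big_seq; apply: eq_bigr => phi /size_flags sphi.
    have sub : {subset roots <= R n}.
      by move=> r rr; apply: (sR n) => //; rewrite eqxx mem_undup.
    rewrite /roots in sub; rewrite -sphi in sub hp nneg *; rewrite -iterresN; congr iterres.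
    by rewrite sum_residue_positive ?opprK //; apply/allP.
  apply: value_drop => //; apply: HB => // i ltin r rB; apply: sR; first by rewrite ltnS ltnW.
  by rewrite (ltn_eqF ltin).
have gf : g \in rem f m.
  have := perm_mem (perm_to_rem fm) g; rewrite gm inE => /esym/orP[/eqP E|//].
  by move: gn; rewrite E ltNge ltW.
have Pm : perm_eq m (f :: g :: rem g (rem f m)).
  by rewrite (perm_trans (perm_to_rem fm)) // perm_cons perm_to_rem.
set m' := rem g _ in Pm.
move: pos nd cm; rewrite /positive_steps (perm_all _ Pm) (seq.permP Pm) => pos nd cm.
apply: (@flag_formula_perm _ (f :: g :: m')); [by [] | by rewrite perm_sym | ].
(* Each step is scaled by the absolute last coordinate of the other one, so that these coordinates
   become opposite. *)
pose b := absz g.2`_n; pose c := absz f.2`_n.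
have b0 : (0 < b)%N by rewrite absz_gt0 lt_eqF.
have c0 : (0 < c)%N by rewrite absz_gt0 gt_eqF.
case/and3P: (pos) => f0 g0 pm'.
have pos1 : positive_steps (scale_step b f :: scale_step c g :: m').
  by rewrite /positive_steps /= !muln_gt0 b0 c0 f0 g0.
apply: (flag_formula_scale b0) => //.
apply: (@flag_formula_perm _ (g :: scale_step b f :: m')).
- by rewrite /positive_steps /= g0 muln_gt0 b0 f0.
-   by rewrite -[_ :: _ :: _]/([:: g; _] ++ m') -[X in perm_eq _ X]/([:: _; g] ++ m') perm_cat2r perm_sym (perm_catC [:: _]).
apply: (flag_formula_scale c0); first by rewrite /positive_steps /= g0 muln_gt0 b0 f0.
apply: (@flag_formula_perm _ (scale_step b f :: scale_step c g :: m')).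
- by [].
-   by rewrite -[_ :: _ :: _]/([:: scale_step b f; _] ++ m') -[X in perm_eq _ X]/([:: _; scale_step b f] ++ m') perm_cat2r perm_sym (perm_catC [:: _]).
have sn : (add_step (scale_step b f) (scale_step c g)).2`_n = 0.
  rewrite nth_add_step !nth_scale_step /b /c !abszE (gtr0_norm fn) (ltr0_norm gn); ring.
have nd1 : nonzero_coords n.+1 (scale_step b f :: scale_step c g :: m').
  move=> i ltin; have := nd i ltin; rewrite (perm_has _ Pm) /= !nth_scale_step.
  by rewrite !mulf_eq0 !eqz_nat (gtn_eqF b0) (gtn_eqF c0).
move: cm; rewrite /= (gt_eqF fn) (lt_eqF gn) /= !add1n ltnS => cm.
apply: flag_formula_race => //; apply: IHk.
- by move: pos1; rewrite /positive_steps /= => /and3P[-> _ ->]; rewrite addn_gt0 muln_gt0 b0 f0.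
- move=> i ltin.
  move: (nth_add_step (scale_step b f) (scale_step c g) i) (nd1 i ltin).
  move: (add_step _ _) => h; move: (scale_step b f) (scale_step c g) => u v /= ->.
  by case: (eqVneq u.2`_i 0) => [->|]; rewrite ?add0r ?orbT.
- by rewrite /= sn eqxx add0n; apply: leq_ltn_trans cm; rewrite -add1n leq_add2r; case: eqP.
- by move: pos1; rewrite /positive_steps /= => /and3P[_ -> ->]; rewrite addn_gt0 muln_gt0 b0 f0.
- move=> i ltin.
  move: (nth_add_step (scale_step b f) (scale_step c g) i) (nd1 i ltin).
  move: (add_step _ _) => h; move: (scale_step b f) (scale_step c g) => u v /= ->.
  by case: (eqVneq v.2`_i 0) => [->|]; rewrite ?addr0 ?orbT.
- by rewrite /= sn eqxx add0n; apply: leq_ltn_trans cm; rewrite -add1n leq_add2r; case: eqP.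
Qed.
End FlagFormula.

(** * Counting walks by shift operators *)

Section Counting.
Variable R : realType.
Local Notation profile_fun := (nat -> (nat -> int) -> R).
Implicit Types (u v h : profile_fun) (f g : step) (m : seq step).

Definition displace (w : nat -> int) (v : seq int) : nat -> int := fun i => w i + v`_i.

(** A function of [k] and [w] counts walks with time [k] left at the point [w]. [delay f] prepends
    one step [f] and [repeated f] any number of them, so [repeated f] is the inverse of 1 -
    [delay f]. *)
Definition delay f u : profile_fun := fun k w =>
  if (f.1 <= k)%N then u (k - f.1)%N (displace w f.2) else 0.

Definition repeated f u : profile_fun := fun k w =>
  \sum_(x < k.+1) iter x (delay f) u k w.

Lemma delayD f u v : delay f (u + v) = delay f u + delay f v.
Proof.
apply/funext => k; apply/funext => w; rewrite /delay !fctE.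
by case: ifP; rewrite ?addr0.
Qed.

Lemma delay0 f : delay f 0 = 0.
Proof. by apply/funext => k; apply/funext => w; rewrite /delay if_same. Qed.

Lemma delayC f g u : delay f (delay g u) = delay g (delay f u).
Proof.
apply/funext => k; apply/funext => w; rewrite /delay.
have -> : displace (displace w f.2) g.2 = displace (displace w g.2) f.2.
  by apply/funext => i; rewrite /displace addrAC.
rewrite -!subnDA addnC; case: (leqP f.1 k) => fk; case: (leqP g.1 k) => gk //.
- by rewrite !leq_subRL // addnC.
- by rewrite leqNgt (leq_ltn_trans (leq_subr _ _) gk).
- by rewrite leqNgt (leq_ltn_trans (leq_subr _ _) fk).
Qed.

Lemma delay_add f g u : delay (add_step f g) u = delay f (delay g u).
Proof.
apply/funext => k; apply/funext => w; rewrite /delay.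
have -> : displace w (add_step f g).2 = displace (displace w f.2) g.2.
  by apply/funext => i; rewrite /displace nth_add_step addrA.
rewrite /= subnDA; case: (leqP f.1 k) => fk; first by rewrite leq_subRL.
by rewrite leqNgt (leq_trans fk (leq_addr _ _)).
Qed.

Lemma delay_scale b f u : delay (scale_step b f) u = iter b (delay f) u.
Proof.
elim: b => [|b IHb] /=.
  apply/funext => k; apply/funext => w; rewrite /delay /= mul0n /= subn0.
  by congr (u _ _); apply/funext => i; rewrite /displace nth_scale_step mul0r addr0.
rewrite -IHb -delay_add; apply/funext => k; apply/funext => w; rewrite /delay.
have -> : displace w (scale_step b.+1 f).2 = displace w (add_step f (scale_step b f)).2.
  apply/funext => i; rewrite /displace nth_add_step !nth_scale_step -addn1 PoszD; ring.
by rewrite /= mulSn.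
Qed.

Lemma iter_delay_late x f u k w : (k < x * f.1)%N -> iter x (delay f) u k w = 0.
Proof.
rewrite -delay_scale /delay /= => kx; by rewrite leqNgt kx.
Qed.

Lemma repeatedE f u : (0 < f.1)%N -> repeated f u = u + delay f (repeated f u).
Proof.
move=> f0; apply/funext => k; apply/funext => w; rewrite !fctE.
rewrite {1}/repeated -(big_mkord xpredT (fun x => iter x (delay f) u k w)).
rewrite big_nat_recl //; congr (_ + _); rewrite {2}/delay.
have [fk|kf] := leqP f.1 k; last first.
  by rewrite big1 // => x _; rewrite iter_delay_late // mulSn ltn_addr.
rewrite /repeated.
rewrite -(big_mkord xpredT (fun x => iter x (delay f) u (k - f.1)%N (displace w f.2))).
have le1 : ((k - f.1).+1 <= k)%N by rewrite -subSn // leq_subLR -add1n leq_add2r.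
rewrite (big_cat_nat _ le1) //= [X in _ + X]big_nat_cond [X in _ + X]big1 ?addr0.
  by apply: eq_bigr => x _; rewrite /= /delay fk.
move=> x; rewrite andbT => /andP[lx _].
rewrite -iterS iter_delay_late // mulSn.
rewrite -ltn_subLR ?fk // ; apply: leq_trans lx _; by rewrite leq_pmulr.
Qed.

(** A step takes positive time, so the equation determines [h] by recursion on time. The operator
    identities below reduce to this uniqueness. *)
Lemma repeated_uniq f u h : (0 < f.1)%N -> h = u + delay f h -> h = repeated f u.
Proof.
move=> f0 hE; apply/funext => k; apply/funext => w.
have [n] := ubnP k; elim: n k w => // n IHn k w kn.
rewrite hE (repeatedE u f0) !fctE; congr (_ + _); rewrite /delay.
case: ifP => // fk; apply: IHn; apply: (@leq_trans k); last by rewrite -ltnS.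
by rewrite ltn_subrL f0 (leq_trans f0 fk).
Qed.

Lemma repeatedD f u v : (0 < f.1)%N -> repeated f (u + v) = repeated f u + repeated f v.
Proof.
move=> f0; apply/esym/repeated_uniq => //.
by rewrite {1}(repeatedE u f0) {1}(repeatedE v f0) delayD addrACA.
Qed.

Lemma repeated_delay f g u : (0 < f.1)%N ->
  repeated f (delay g u) = delay g (repeated f u).
Proof.
move=> f0; apply/esym/repeated_uniq => //.
by rewrite {1}(repeatedE u f0) delayD delayC.
Qed.

Lemma repeatedC f g u : (0 < f.1)%N -> (0 < g.1)%N ->
  repeated f (repeated g u) = repeated g (repeated f u).
Proof.
move=> f0 g0; apply: repeated_uniq => //.
by rewrite -repeated_delay // -repeatedD // -repeatedE.
Qed.

(** This is 1/((1-f)(1-g)) = (1/(1-fg)) (1/(1-f) + g/(1-g)): the first term has at least as many [f]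
    as [g], the second more [g] than [f]. *)
Lemma repeated_race f g u : (0 < f.1)%N -> (0 < g.1)%N ->
  repeated f (repeated g u) = repeated (add_step f g) (repeated f u) +
    delay g (repeated (add_step f g) (repeated g u)).
Proof.
move=> f0 g0; set q := add_step f g.
have q0 : (0 < q.1)%N by rewrite addn_gt0 f0.
rewrite -repeated_delay // -repeatedD //; apply: repeated_uniq => //.
rewrite delay_add delayC {1}[repeated f (repeated g u)]repeatedC //.
rewrite {1}(repeatedE _ g0) -addrA -delayD [repeated g (repeated f u)]repeatedC //.
by rewrite -repeatedE.
Qed.

(** Division with remainder of the multiplicity by b: 1/(1-f) = (1 + f + ... + f^(b-1))/(1-f^b). *)
Lemma repeated_scale b f u : (0 < b)%N -> (0 < f.1)%N ->
  repeated f u = \sum_(r < b) iter r (delay f) (repeated (scale_step b f) u).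
Proof.
move=> b0 f0; apply/esym/repeated_uniq => //.
set v := repeated _ u.
have vE : v = u + iter b (delay f) v.
  by rewrite -delay_scale /v -repeatedE // muln_gt0 b0.
rewrite (big_morph (delay f) (delayD f) (delay0 f)).
case: b b0 @v vE => // b _ v vE; rewrite big_ord_recl big_ord_recr /= {1}vE.
rewrite -addrA; congr (_ + _); rewrite addrC; congr (_ + _).
Qed.

Definition positive_part n : profile_fun :=
  fun _ w => [forall i : 'I_n, 0 < w i]%:R.

(** The innermost function ignores the time left over, so total times up to [k] are counted. *)
Definition count_upto n m : profile_fun := foldr repeated (positive_part n) m.

Lemma foldr_repeated_perm u m m' : positive_steps m -> perm_eq m m' ->
  foldr repeated u m = foldr repeated u m'.
Proof.
move=> pos Pm.
suff H f m1 m2 : positive_steps (f :: m1 ++ m2) ->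
    foldr repeated u (f :: m1 ++ m2) = foldr repeated u (m1 ++ f :: m2).
  elim: m m' pos Pm => [|f m IHm] m' pos Pm.
    by move: Pm; rewrite perm_sym => /perm_nilP ->.
  have fm' : f \in m' by rewrite -(perm_mem Pm) mem_head.
  case/splitPr: fm' Pm => m1 m2; rewrite perm_sym perm_catC /= perm_cons => Pm.
  have Pm12 : perm_eq m (m1 ++ m2) by rewrite perm_sym perm_catC.
  have pos12 : positive_steps (f :: m1 ++ m2).
    by rewrite /positive_steps /= -(perm_all _ Pm12).
  rewrite -H //= -(IHm (m1 ++ m2)) //.
  by case/andP: pos.
elim: m1 => // g m1 IHm1 /and3P[f0 g0 pos'] /=.
by rewrite repeatedC // -IHm1 //= f0.
Qed.

Lemma count_upto_perm n m m' : positive_steps m -> perm_eq m m' ->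
  count_upto n m = count_upto n m'.
Proof. exact: foldr_repeated_perm. Qed.

Lemma repeated_sum f u k w : repeated f u k w =
  \sum_(x < k.+1) if (x * f.1 <= k)%N
    then u (k - x * f.1)%N (displace w (scale_step x f).2) else 0.
Proof. by apply: eq_bigr => x _; rewrite -delay_scale. Qed.

Lemma positive_part_ge0 n k w : 0 <= positive_part n k w.
Proof. by rewrite ler0n. Qed.

Lemma count_upto_ge0 n m k w : 0 <= count_upto n m k w.
Proof.
elim: m k w => [|f m IHm] k w /=; first exact: positive_part_ge0.
by rewrite repeated_sum sumr_ge0 // => x _; case: ifP.
Qed.

Lemma count_upto_positive n m k w :
  all (fun f : step => 0 <= f.2`_n) m -> 0 < w n ->
  count_upto n.+1 m k w = count_upto n m k w.
Proof.
elim: m k w => [|f m IHm] k w /=.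
  move=> _ wn; congr (_%:R); congr nat_of_bool; apply/forallP/forallP => [w0 i|w0 i].
    exact: (w0 (widen_ord (leqnSn _) i)).
  have := ltn_ord i; rewrite ltnS leq_eqVlt => /orP[/eqP-> // | ltin].
  exact: (w0 (Ordinal ltin)).
case/andP => fn mn wn; rewrite !repeated_sum; apply: eq_bigr => x _.
case: ifP => // _; apply: IHm => //.
by rewrite /displace nth_scale_step ltr_pwDl // mulr_ge0.
Qed.

Lemma count_upto_negative n m k w :
  all (fun f : step => f.2`_n <= 0) m -> w n <= 0 -> count_upto n.+1 m k w = 0.
Proof.
elim: m k w => [|f m IHm] k w /=.
  move=> _ wn; rewrite /positive_part; case: forallP => // /(_ ord_max) /=.
  by rewrite ltNge wn.
case/andP => fn mn wn; rewrite repeated_sum big1 // => x _.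
case: ifP => // _; apply: IHm => //.
by rewrite /displace nth_scale_step -oppr_ge0 opprD addr_ge0 ?oppr_ge0 // mulr_ge0_le0.
Qed.

(** With [powerD_le] this bounds the difference of two powers by the derivative at either end, which
    makes discrete integration telescope. *)
Lemma powerD_ge (y c : R) N : 0 <= y -> 0 <= c ->
  N.+1%:R * c * y ^+ N + y ^+ N.+1 <= (y + c) ^+ N.+1.
Proof.
move=> y0 c0; elim: N => [|N IHN]; first by rewrite !expr1 expr0; lra.
rewrite [X in _ <= X]exprS; apply: le_trans (ler_wpM2l (addr_ge0 y0 c0) IHN).
rewrite -natr1 !exprS -subr_ge0.
have -> : forall p, (y + c) * (N.+1%:R * c * p + y * p) -
  ((N.+1%:R + 1) * c * (y * p) + y * (y * p)) = N.+1%:R * (c * c * p) by move=> p; ring.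
by rewrite mulr_ge0 // mulr_ge0 ?mulr_ge0 ?exprn_ge0.
Qed.

Lemma powerD_le (y c : R) N : 0 <= y -> 0 <= c ->
  (y + c) ^+ N.+1 <= N.+1%:R * c * (y + c) ^+ N + y ^+ N.+1.
Proof.
move=> y0 c0; elim: N => [|N IHN]; first by rewrite !expr1 expr0; lra.
rewrite exprS; apply: le_trans (ler_wpM2l (addr_ge0 y0 c0) IHN) _.
have le1 : y ^+ N.+1 <= (y + c) ^+ N.+1 by rewrite lerXn2r ?nnegrE ?addr_ge0 // lerDl.
have := ler_wpM2l c0 le1; rewrite -[N.+2%:R]natr1 [y ^+ N.+2]exprS.
rewrite [(y + c) ^+ N.+1]exprS.
move: ((y + c) ^+ N) (y ^+ N.+1) => p q h; rewrite -subr_ge0.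
suff -> : (N.+1%:R + 1) * c * ((y + c) * p) + y * q -
  (y + c) * (N.+1%:R * c * p + q) = c * ((y + c) * p) - c * q by rewrite subr_ge0.
ring.
Qed.

Definition total_delay m := (\sum_(f <- m) f.1)%N.

(** The volume of the simplex of points x >= 0 with sum of c_f x_f at most 1. *)
Definition volume m : R := ((size m)`!%:R * \prod_(f <- m) f.1%:R)^-1.

Lemma volume_cons f m : volume (f :: m) = volume m / ((size m).+1%:R * f.1%:R).
Proof.
rewrite /volume big_cons /= factS natrM -invfM; congr _^-1; ring.
Qed.

Lemma volume_ge0 m : 0 <= volume m.
Proof. by rewrite invr_ge0 mulr_ge0 // prodr_ge0. Qed.

(** Discrete integration, one step at a time. Together with [count_upto_ge] it shows that
    unconstrained counts grow like k^N times the simplex volume, for N steps. *)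
Lemma count_upto_le n m k w : positive_steps m ->
  count_upto n m k w <= (k + total_delay m)%:R ^+ size m * volume m.
Proof.
elim: m k w => [|f m IHm] k w.
  rewrite /volume /= big_nil expr0 fact0 !mul1r invr1 => _.
  by rewrite /positive_part; case: forallP; rewrite ?lexx ?ler01.
case/andP => f0 pos /=; rewrite /total_delay big_cons -/(total_delay m) volume_cons.
have d0 : 0 < (size m).+1%:R * f.1%:R :> R by rewrite mulr_gt0 ?ltr0n.
have [N] := ubnP k; elim: N k w => // N IHN k w kN.
rewrite (repeatedE _ f0) fctE mulrA ler_pdivlMr //; set V := volume m.
have step : (size m).+1%:R * f.1%:R * (k + total_delay m)%:R ^+ size m +
   (k + total_delay m)%:R ^+ (size m).+1 <=
   (k + (f.1 + total_delay m))%:R ^+ (size m).+1 :> R.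
  by rewrite addnCA [(f.1 + _)%N]addnC [(_ + f.1)%:R]natrD; apply: powerD_ge.
have h1 := IHm k w pos.
suff h2 : delay f (repeated f (count_upto n m)) k w * ((size m).+1%:R * f.1%:R) <=
    (k + total_delay m)%:R ^+ (size m).+1 * V.
  rewrite mulrDl; have := ler_wpM2r (volume_ge0 m) step.
  have := ler_wpM2r (ltW d0) h1; rewrite -/V.
  move: h2; set A := _ ^+ size m; lra.
rewrite /delay; case: ifP => fk; last first.
  by rewrite mul0r mulr_ge0 ?exprn_ge0 ?volume_ge0.
rewrite -ler_pdivlMr // -mulrA; apply: le_trans (IHN _ _ _) _.
  by apply: (@leq_trans k); [rewrite ltn_subrL f0 (leq_trans f0 fk) | rewrite -ltnS].
by rewrite addnA subnK.
Qed.

Lemma count_upto_ge m k w : positive_steps m ->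
  k%:R ^+ size m * volume m <= count_upto 0 m k w.
Proof.
elim: m k w => [|f m IHm] k w.
  rewrite /volume /= big_nil expr0 fact0 !mul1r invr1 => _.
  by rewrite /positive_part; case: forallP => // -[] [].
case/andP => f0 pos /=; rewrite volume_cons.
have d0 : 0 < (size m).+1%:R * f.1%:R :> R by rewrite mulr_gt0 ?ltr0n.
have [N] := ubnP k; elim: N k w => // N IHN k w kN.
rewrite (repeatedE _ f0) fctE mulrA ler_pdivrMr // mulrDl.
have h1 := ler_wpM2r (ltW d0) (IHm k w pos).
set V := volume m in h1 *.
have [fk|kf] := leqP f.1 k.
  have h2 : (k - f.1)%:R ^+ (size m).+1 * V <=
      delay f (repeated f (count_upto 0 m)) k w * ((size m).+1%:R * f.1%:R).
    rewrite /delay fk -ler_pdivrMr // -mulrA; apply: IHN.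
    by apply: (@leq_trans k); [rewrite ltn_subrL f0 (leq_trans f0 fk) | rewrite -ltnS].
  have := powerD_le (size m) (ler0n R (k - f.1)) (ler0n R f.1).
  rewrite -natrD subnK // => /(ler_wpM2r (volume_ge0 m)); rewrite -/V.
  move: h1 h2; set A := k%:R ^+ size m; lra.
have h3 : 0 <= delay f (repeated f (count_upto 0 m)) k w by rewrite /delay leqNgt kf.
have := mulr_ge0 h3 (ltW d0); suff : k%:R ^+ (size m).+1 * V <= k%:R ^+ size m * V * ((size m).+1%:R * f.1%:R).
  by move: h1; lra.
rewrite exprS -mulrA mulrC ler_wpM2l ?mulr_ge0 ?exprn_ge0 ?volume_ge0 //.
by rewrite -natrM ler_nat (leq_trans (ltnW kf)) // leq_pmull.
Qed.

End Counting.

(** * Leading coefficients of the counts *)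

Section Limits.
Variable R : realType.
Implicit Types (a : nat -> R) (f g : step) (m : seq step).

Lemma cvg_invn : (fun k => k%:R^-1 : R) @ \oo --> (0 : R).
Proof. by rewrite -cvg_shiftS; exact: cvg_harmonic. Qed.

Lemma cvg_ratio_shift c N : (fun k => ((k + c)%:R / k%:R) ^+ N : R) @ \oo --> (1 : R).
Proof.
have H : (fun k => 1 + c%:R * k%:R^-1 : R) @ \oo --> (1 : R).
  rewrite -[X in _ --> X]addr0 -[X in 1 + X](mulr0 c%:R).
  apply: cvgD; first exact: cvg_cst.
  by apply: cvgM; [exact: cvg_cst | exact: cvg_invn].
have {}H : (fun k => (k + c)%:R / k%:R : R) @ \oo --> (1 : R).
  apply: cvg_trans H; apply: near_eq_cvg; near=> k.
  have k0 : k%:R != 0 :> R by rewrite pnatr_eq0 -lt0n; near: k; exact: nbhs_infty_gt.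
  by rewrite natrD mulrDl divff.
elim: N => [|N IHN]; first exact: cvg_cst.
rewrite -[X in _ --> X]mulr1; under eq_fun do rewrite exprS.
by apply: cvgM.
Unshelve. all: by end_near. Qed.

Lemma cvg_delay a c N (l : R) : (fun k => a k / k%:R ^+ N) @ \oo --> l ->
  (fun k => (if (c <= k)%N then a (k - c)%N else 0) / k%:R ^+ N) @ \oo --> l.
Proof.
move=> al; rewrite -(cvg_shiftn c) /=.
have H : (fun k => a k / k%:R ^+ N * (((k + c)%:R / k%:R) ^+ N)^-1) @ \oo --> l.
  rewrite -[X in _ --> X]mulr1 -[X in _ * X]invr1; apply: cvgM => //.
  by apply: cvgV; [exact: oner_neq0 | exact: cvg_ratio_shift].
apply: cvg_trans H; apply: near_eq_cvg; near=> k.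
have k0 : k%:R != 0 :> R by rewrite pnatr_eq0 -lt0n; near: k; exact: nbhs_infty_gt.
have kc0 : (k + c)%:R != 0 :> R.
  by rewrite pnatr_eq0 addn_eq0 negb_and -lt0n lt0n; move: k0; rewrite pnatr_eq0 => ->.
rewrite leq_addl addnK expr_div_n invf_div mulrA mulfVK ?expf_neq0 //.
Unshelve. all: by end_near. Qed.

Definition scaled_count n m (w : nat -> int) : nat -> R :=
  fun k => count_upto R n m k w * (size m)`!%:R / k%:R ^+ size m.

(** The limit must be the same from every starting point, since the recursions move the start. *)
Definition has_value n m (x : rat) :=
  forall w, scaled_count n m w @ \oo --> (ratr x : R).

Lemma has_value_perm n m m' x : positive_steps m ->
  perm_eq m m' -> has_value n m x -> has_value n m' x.
Proof.
move=> pos Pm H w; have := H w.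
by rewrite /scaled_count -(perm_size Pm) -(count_upto_perm _ _ pos Pm).
Qed.

Lemma cvg_delayed_count n m f x : has_value n m x ->
  forall w, (fun k => delay f (count_upto R n m) k w * (size m)`!%:R / k%:R ^+ size m)
    @ \oo --> (ratr x : R).
Proof.
move=> H w; have := cvg_delay f.1 (H (displace w f.2)).
set a := (fun k => _); set b := (fun k => _); suff -> : a = b by [].
by apply/funext => k; rewrite /a /b /delay; case: ifP; rewrite ?mul0r.
Qed.

Lemma has_value_race n f g m x y : positive_steps (f :: g :: m) ->
  has_value n (add_step f g :: f :: m) x -> has_value n (add_step f g :: g :: m) y ->
  has_value n (f :: g :: m) (x + y).
Proof.
move=> /and3P[f0 g0 _] Hx Hy w.
have -> : scaled_count n (f :: g :: m) w = (fun k =>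
    scaled_count n (add_step f g :: f :: m) w k +
    delay g (count_upto R n (add_step f g :: g :: m)) k w
      * (size m).+2`!%:R / k%:R ^+ (size m).+2).
  by apply/funext => k; rewrite /scaled_count /= repeated_race // !fctE !mulrDl.
have -> : ratr (x + y) = ratr x + ratr y :> R by rewrite rmorphD.
by apply: cvgD; [exact: (Hx w) | exact: (cvg_delayed_count g Hy w)].
Qed.

Lemma has_value_scale n b f m x : (0 < b)%N -> positive_steps (f :: m) ->
  has_value n (scale_step b f :: m) x -> has_value n (f :: m) (b%:R * x).
Proof.
move=> b0 /andP[f0 _] Hx w.
(* Delaying by [f] does not change the limit, so each of the [b] remainders contributes [x]. *)
have H r : (fun k => iter r (delay f) (count_upto R n (scale_step b f :: m)) k w
   * (size m).+1`!%:R / k%:R ^+ (size m).+1) @ \oo --> (ratr x : R).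
    have := cvg_delayed_count (scale_step r f) Hx w.
  set a := (fun k => _); set c := (fun k => _); suff -> : a = c by [].
  by apply/funext => k; rewrite /a /c delay_scale.
have {}H : forall j, (fun k => (\sum_(r < j) iter r (delay f) (count_upto R n (scale_step b f :: m)) k w)
   * (size m).+1`!%:R / k%:R ^+ (size m).+1) @ \oo --> (ratr (j%:R * x) : R).
  elim=> [|j IHj].
    under eq_fun do rewrite big_ord0 !mul0r.
    by rewrite mul0r rmorph0; exact: cvg_cst.
  under eq_fun do rewrite big_ord_recr /= !mulrDl.
  by rewrite -natr1 mulrDl mul1r rmorphD; apply: cvgD.
apply: cvg_trans (H b); apply: near_eq_cvg; near=> k.
rewrite /scaled_count /= (repeated_scale _ b0 f0); congr (_ * _ / _).
by elim/big_ind2: _ => // u y v z Eu Ez; rewrite !fctE Eu Ez.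
Unshelve. all: by end_near. Qed.

Lemma window_sum (F : nat -> R) K W B : 0 <= B -> (forall x, F x <= B) ->
  (forall x, (W <= x)%N -> F x = 0) -> \sum_(x < K) F x <= W%:R * B.
Proof.
move=> B0 FB F0; apply: (@le_trans _ _ ((minn K W)%:R * B)); last first.
  by rewrite ler_wpM2r // ler_nat geq_minr.
elim: K => [|K IHK]; first by rewrite big_ord0 min0n mul0r.
rewrite big_ord_recr /=; have [ltKW|leWK] := ltnP K W.
  rewrite (minn_idPl (ltnW ltKW)) in IHK; rewrite (minn_idPl ltKW) -natr1 mulrDl mul1r.
  exact: lerD.
by rewrite F0 // addr0 (minn_idPr (leqW leWK)); rewrite (minn_idPr leWK) in IHK.
Qed.

Lemma cvg_negligible (W V : R) C N M :
  (fun k => W * ((k + C)%:R ^+ N * V) * M / k%:R ^+ N.+1 : R) @ \oo --> (0 : R).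
Proof.
have -> : (fun k => W * ((k + C)%:R ^+ N * V) * M / k%:R ^+ N.+1 : R) =
  (fun k => W * V * M * ((k + C)%:R / k%:R) ^+ N * k%:R^-1).
  apply/funext => k; rewrite expr_div_n exprS invfM; ring.
rewrite -[X in _ --> X](mulr0 (W * V * M * 1)); apply: cvgM; last exact: cvg_invn.
by apply: cvgM; [exact: cvg_cst | exact: cvg_ratio_shift].
Qed.

Lemma count_upto_decr n m k w : count_upto R n.+1 m k w <= count_upto R n m k w.
Proof.
elim: m k w => [|f m IHm] k w /=.
  rewrite ler_nat; case: forallP => // w0; case: forallP => // -[] i.
  exact: (w0 (widen_ord (leqnSn _) i)).
by rewrite !repeated_sum ler_sum // => y _; case: ifP.
Qed.

Lemma count_upto_bound n m k k' w : positive_steps m -> (k' <= k)%N ->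
  count_upto R n m k' w <= (k + total_delay m)%:R ^+ size m * volume R m.
Proof.
move=> pos lek; apply: le_trans (count_upto_le R n _ _ pos) _.
by rewrite ler_wpM2r ?volume_ge0 // lerXn2r ?nnegrE // ler_nat leq_add2r.
Qed.

(** After more than |w_n| uses of a step with positive coordinate, that coordinate stays positive.
    The two counts thus differ only for boundedly many multiplicities of this step, each of which is
    one order smaller. *)
Lemma has_value_drop n m x : positive_steps m ->
  all (fun f : step => 0 <= f.2`_n) m -> has (fun f : step => 0 < f.2`_n) m ->
  has_value n m x -> has_value n.+1 m x.
Proof.
move=> pos mn /hasP[f fm fn] Hx.
have Pm := perm_to_rem fm; move: (rem f m) Pm => m' Pm.
have pos' : positive_steps (f :: m') by rewrite /positive_steps -(perm_all _ Pm).
apply: (@has_value_perm n.+1 (f :: m')) => //; first by rewrite perm_sym.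
have {}Hx := has_value_perm pos Pm Hx.
rewrite (perm_all _ Pm) in mn; case/andP: pos' mn => f0 pos' /andP[_ m'n] w.
pose err k := (count_upto R n (f :: m') k w - count_upto R n.+1 (f :: m') k w)
  * (size m').+1`!%:R / k%:R ^+ (size m').+1.
have -> : scaled_count n.+1 (f :: m') w = (fun k => scaled_count n (f :: m') w k - err k).
  by apply/funext => k; rewrite /err /scaled_count -!mulrBl opprB addrC subrK.
rewrite -[X in _ --> X]subr0; apply: cvgB; first exact: Hx.
(* From [W] uses of [f] on, the constraint on coordinate [n] holds automatically. *)
pose W := (absz (w n)).+1.
have dE k : count_upto R n (f :: m') k w - count_upto R n.+1 (f :: m') k w =
  \sum_(y < k.+1) if (y * f.1 <= k)%N then
   count_upto R n m' (k - y * f.1)%N (displace w (scale_step y f).2) -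
   count_upto R n.+1 m' (k - y * f.1)%N (displace w (scale_step y f).2) else 0.
  rewrite /= !repeated_sum -sumrB; apply: eq_bigr => y _.
  by case: ifP; rewrite ?subr0.
have err0 : (fun k => W%:R * ((k + total_delay m')%:R ^+ size m' * volume R m') *
    (size m').+1`!%:R / k%:R ^+ (size m').+1 : R) @ \oo --> (0 : R) by exact: cvg_negligible.
refine (@squeeze_cvgr nat \oo _ R (fun=> 0) _ _ _ 0 (cvg_cst _) err0); apply: nearW => k.
have B0 : 0 <= (k + total_delay m')%:R ^+ size m' * volume R m' by rewrite mulr_ge0 ?exprn_ge0 ?volume_ge0.
rewrite /err divr_ge0 ?exprn_ge0 ?mulr_ge0 ?subr_ge0 ?count_upto_decr //=.
rewrite ler_wpM2r ?invr_ge0 ?exprn_ge0 // ler_wpM2r // dE.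
apply: (@window_sum (fun y => if (y * f.1 <= k)%N then
   count_upto R n m' (k - y * f.1)%N (displace w (scale_step y f).2) -
   count_upto R n.+1 m' (k - y * f.1)%N (displace w (scale_step y f).2) else 0)) => // [y|y].
  case: ifP => // _; rewrite lerBlDr; apply: le_trans (count_upto_bound n _ pos' (leq_subr _ k)) _.
  by rewrite lerDl count_upto_ge0.
move=> ly; case: ifP => // _; rewrite count_upto_positive ?subrr //.
rewrite /displace nth_scale_step -ltrBlDl sub0r.
apply: (@lt_le_trans _ _ y%:Z); last by rewrite ler_peMr // -gtz0_ge1.
apply: (@le_lt_trans _ _ `|w n|); first by rewrite -normrN ler_norm.
by rewrite -abszE ltz_nat.
Qed.

(** As in [has_value_drop], with the opposite sign: after boundedly many uses of the negative step
    the constraint can no longer hold. *)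
Lemma has_value_zero n m : positive_steps m ->
  all (fun f : step => f.2`_n <= 0) m -> has (fun f : step => f.2`_n < 0) m ->
  has_value n.+1 m 0.
Proof.
move=> pos mn /hasP[f fm fn].
have Pm := perm_to_rem fm; move: (rem f m) Pm => m' Pm.
have pos' : positive_steps (f :: m') by rewrite /positive_steps -(perm_all _ Pm).
apply: (@has_value_perm n.+1 (f :: m')) => //; first by rewrite perm_sym.
rewrite (perm_all _ Pm) in mn; case/andP: pos' mn => f0 pos' /andP[_ m'n] w.
pose W := (absz (w n)).+1; rewrite rmorph0.
have err0 : (fun k => W%:R * ((k + total_delay m')%:R ^+ size m' * volume R m') *
    (size m').+1`!%:R / k%:R ^+ (size m').+1 : R) @ \oo --> (0 : R) by exact: cvg_negligible.
refine (@squeeze_cvgr nat \oo _ R (fun=> 0) _ _ _ 0 (cvg_cst _) err0); apply: nearW => k.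
have B0 : 0 <= (k + total_delay m')%:R ^+ size m' * volume R m' by rewrite mulr_ge0 ?exprn_ge0 ?volume_ge0.
rewrite /scaled_count divr_ge0 ?exprn_ge0 ?mulr_ge0 ?count_upto_ge0 //=.
rewrite ler_wpM2r ?invr_ge0 ?exprn_ge0 // ler_wpM2r // repeated_sum.
apply: (@window_sum (fun y => if (y * f.1 <= k)%N then
   count_upto R n.+1 m' (k - y * f.1)%N (displace w (scale_step y f).2) else 0)) => // [y|y].
  by case: ifP => // _; apply: count_upto_bound; rewrite ?leq_subr.
move=> ly; case: ifP => // _; apply: count_upto_negative => //.
rewrite /displace nth_scale_step -lerBrDl sub0r.
have le1 : y%:Z <= - (y%:Z * f.2`_n) by rewrite -mulrN ler_peMr // -gtz0_ge1 oppr_gt0.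
rewrite lerNr; apply: le_trans le1; apply: le_trans (ler_norm _) _.
by rewrite -abszE lez_nat ltnW.
Qed.

Lemma has_value0 m : positive_steps m -> has_value 0 m (\prod_(f <- m) f.1%:R^-1).
Proof.
move=> pos w.
have fct0 : (size m)`!%:R != 0 :> R by rewrite pnatr_eq0 -lt0n fact_gt0.
have EV : ratr (\prod_(f <- m) f.1%:R^-1) = volume R m * (size m)`!%:R :> R.
  rewrite rmorph_prod /= /volume invfM mulrAC mulVf // mul1r -prodfV.
  by apply: eq_bigr => f _; rewrite fmorphV /= ?ratr_nat.
set l : R := ratr _ in EV *.
have H : (fun k => ((k + total_delay m)%:R / k%:R) ^+ size m * l : R) @ \oo --> l.
  rewrite -[X in _ --> X]mul1r; apply: cvgM; last exact: cvg_cst.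
  exact: cvg_ratio_shift.
refine (@squeeze_cvgr nat \oo _ R _ _ _ _ _ (cvg_cst _) H); near=> k.
have k0 : 0 < k%:R ^+ size m :> R.
  by rewrite exprn_gt0 // ltr0n; near: k; exact: nbhs_infty_gt.
rewrite /scaled_count ler_pdivlMr // ler_pdivrMr // EV; apply/andP; split.
  by rewrite mulrAC ler_wpM2r // mulrC count_upto_ge.
rewrite expr_div_n [X in _ <= X]mulrAC divfK ?gt_eqF // mulrA.
by rewrite ler_wpM2r // count_upto_le.
Unshelve. all: by end_near. Qed.

Theorem flag_formula_value n m : positive_steps m -> nonzero_coords n m ->
  flag_formula has_value n m.
Proof.
move=> pos nd; apply: flag_formulaP nd => //.
- move=> {pos}n m1 m2 x pos; exact: has_value_perm.
- move=> {pos}n f g m1 x y; exact: has_value_race.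
- move=> {pos}n b f m1 x; exact: has_value_scale.
- move=> {pos}n m1 x; exact: has_value_drop.
- move=> {pos}n m1; exact: has_value_zero.
- exact: has_value0.
Qed.
End Limits.

(** * From cumulative to exact counts *)

Section Tauber.
Variables (R : realType) (a : nat -> R) (N : nat) (l : R).
Hypotheses (a_mono : {homo a : i j / (i <= j)%N >-> i <= j}).
Let S k := \sum_(j < k.+1) a j.
Hypothesis S_lim : (fun k => S k * N.+1`!%:R / k%:R ^+ N.+1) @ \oo --> l.

Let window k h : h%:R * a k <= S (k + h) - S k.
Proof.
elim: h => [|h IHh]; first by rewrite mul0r addn0 subrr.
rewrite /S addnS big_ord_recr /= -/(S (k + h)) -natr1 mulrDl mul1r addrAC.
by apply: lerD => //; apply: a_mono; rewrite -addnS leq_addr.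
Qed.

Let window_low k h : (h <= k)%N -> S k - S (k - h) <= h%:R * a k.
Proof.
elim: h => [|h IHh] hk; first by rewrite mul0r subn0 subrr.
have -> : S (k - h.+1) = S (k - h) - a (k - h)%N.
  by rewrite -(subnSK hk) /S [in RHS]big_ord_recr /= addrK.
rewrite opprB addrCA -natr1 mulrDl mul1r addrC.
by apply: lerD; [apply: IHh; exact: ltnW | apply: a_mono; exact: leq_subr].
Qed.

Let cvg_pow (c : R) : (fun q => l * (1 + c * q%:R^-1) ^+ N : R) @ \oo --> l.
Proof.
have H : (fun q => 1 + c * q%:R^-1 : R) @ \oo --> (1 : R).
  rewrite -[X in _ --> X]addr0 -[X in 1 + X](mulr0 c).
  apply: cvgD; first exact: cvg_cst.
  by apply: cvgM; [exact: cvg_cst | exact: cvg_invn].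
rewrite -[X in _ --> X]mulr1; apply: cvgM; first exact: cvg_cst.
elim: N => [|M IHM]; first exact: cvg_cst.
rewrite -[X in _ --> X]mulr1; under eq_fun do rewrite exprS.
by apply: cvgM.
Qed.

(** By monotonicity a_k lies between the averages of the sequence over windows of length h before
    and after k. With h about k/q these averages are differences of S, close to l k^N/N! once q is
    large. *)
Lemma tauber : 0 <= l -> (fun k => a k * N`!%:R / k%:R ^+ N) @ \oo --> l.
Proof.
move=> l0; apply/cvgrPdist_le => eps eps0.
have [q [q2 up dn]] : exists q, [/\ (2 <= q)%N,
    l * (1 + 1 * q%:R^-1) ^+ N <= l + eps / 2 &
    l - eps / 2 <= l * (1 + (-1) * q%:R^-1) ^+ N].
  have e2 : 0 < eps / 2 by rewrite divr_gt0.
  have /cvgrPdist_le/(_ _ e2) H1 := cvg_pow 1.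
  have /cvgrPdist_le/(_ _ e2) H2 := cvg_pow (-1).
  have [M _ HM] := filterI (filterI H1 H2) (nbhs_infty_ge 2).
  exists M; have [[h1 h2] h3] := HM M (leqnn M); split=> //.
    by move: h1; rewrite ler_norml => /andP[h1 _]; lra.
  by move: h2; rewrite ler_norml => /andP[_ h2]; lra.
(* The errors of S at k and at k + h or k - h together are at most delta (2^(N+1) + 1) k^(N+1).
   Since h >= k/(2q), this choice keeps them below (N+1) h (eps/2) k^N, as [dC] records. *)
pose C : R := (2 ^+ N.+1 + 1) * (2 * q%:R).
have q0 : 0 < q%:R :> R by rewrite ltr0n (leq_trans _ q2).
have C0 : 0 < C by rewrite mulr_gt0 ?mulr_gt0 // addr_gt0 // exprn_gt0.
pose delta := eps / 2 / C.
have d0 : 0 < delta by rewrite !divr_gt0.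
have /cvgrPdist_le/(_ _ d0) [K _ HK] := S_lim.
have close k : (0 < k)%N -> (K <= k)%N ->
    `|S k * N.+1`!%:R - l * k%:R ^+ N.+1| <= delta * k%:R ^+ N.+1.
  move=> k0 Kk.
  have : `|l - S k * N.+1`!%:R / k%:R ^+ N.+1| <= delta := HK k Kk.
  rewrite distrC.
  have kp : 0 < k%:R ^+ N.+1 :> R by rewrite exprn_gt0 ?ltr0n.
  move=> Hk; set u := S k * _ in Hk *.
  have -> : u - l * k%:R ^+ N.+1 = (u / k%:R ^+ N.+1 - l) * k%:R ^+ N.+1.
    by rewrite mulrBl divfK ?gt_eqF.
  by rewrite normrM (gtr0_norm kp) ler_wpM2r ?(ltW kp).
exists (maxn q (2 * K).+1) => // k; rewrite /= geq_max => /andP[qk Kk].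
have k0 : (0 < k)%N by apply: leq_trans Kk.
have kp : 0 < k%:R ^+ N :> R by rewrite exprn_gt0 ?ltr0n.
pose h := (k %/ q)%N.
have h0 : (0 < h)%N by rewrite divn_gt0 // (leq_trans _ q2).
have hq : (h * q <= k)%N by exact: leq_divM.
have kh : (k <= 2 * h * q)%N.
  apply: leq_trans (ltnW (ltn_ceil k (leq_trans (ltn0Sn 1) q2))) _.
  by rewrite leq_mul2r -/h mul2n -addnn -addn1 leq_add2l h0 orbT.
have h2 : (2 * h <= k)%N by apply: leq_trans hq; rewrite mulnC leq_mul2l q2 orbT.
have hk : (h <= k)%N by apply: leq_trans h2; rewrite leq_pmull.
have Kh : (K <= k - h)%N by lia.
have khp : (0 < k - h)%N by lia.
have hR : (h%:R : R) <= q%:R^-1 * k%:R by rewrite mulrC ler_pdivlMr // -natrM ler_nat.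
have F0 : 0 < N.+1%:R * h%:R :> R by rewrite mulr_gt0 ?ltr0n.
have dC : delta * ((2 ^+ N.+1 + 1) * k%:R ^+ N.+1) <= N.+1%:R * h%:R * (eps / 2 * k%:R ^+ N).
  have -> : delta * ((2 ^+ N.+1 + 1) * k%:R ^+ N.+1) = eps / 2 * k%:R ^+ N * (k%:R / (2 * q%:R)).
    have P0 : 2 ^+ N.+1 + 1 != 0 :> R by rewrite gt_eqF // addr_gt0 // exprn_gt0.
    rewrite /delta /C [k%:R ^+ N.+1]exprS; move: (_ + 1) P0 => P P0.
    by field; rewrite P0 gt_eqF.
  rewrite [X in _ <= X]mulrC ler_wpM2l //.
    by rewrite mulr_ge0 ?ltW // divr_gt0.
  rewrite ler_pdivrMr ?mulr_gt0 // -!natrM ler_nat.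
  apply: (leq_trans kh); rewrite mulnA [(_ * 2)%N]mulnC !mulnA leq_mul2r -!mulnA.
  by rewrite leq_mul2l leq_pmull // !orbT.
have fN : N.+1`!%:R = N.+1%:R * N`!%:R :> R by rewrite factS natrM.
have f0 : 0 < N`!%:R :> R by rewrite ltr0n fact_gt0.
have ck := close k k0 (leq_trans Kh (leq_subr _ _)).
have pow2 : (k + h)%:R ^+ N.+1 <= 2 ^+ N.+1 * k%:R ^+ N.+1 :> R.
  by rewrite -exprMn lerXn2r ?nnegrE ?mulr_ge0 // -natrM ler_nat mul2n -addnn leq_add2l.
have ub : a k * N`!%:R <= (l + eps) * k%:R ^+ N.
  have ckh := close (k + h)%N (ltn_addr _ k0) (leq_trans (leq_trans Kh (leq_subr _ _)) (leq_addr _ _)).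
  have w : h%:R * a k * N.+1`!%:R <= (S (k + h) - S k) * N.+1`!%:R.
    by rewrite ler_wpM2r.
  rewrite -(ler_pM2l F0).
  have pd : (k + h)%:R ^+ N.+1 - k%:R ^+ N.+1 <= N.+1%:R * h%:R * (k + h)%:R ^+ N :> R.
    by rewrite lerBlDr natrD powerD_le.
  have kN : l * (k + h)%:R ^+ N <= (l + eps / 2) * k%:R ^+ N.
    apply: le_trans (_ : l * ((1 + 1 * q%:R^-1) * k%:R) ^+ N <= _).
      rewrite ler_wpM2l // lerXn2r ?nnegrE ?mulr_ge0 ?addr_ge0 ?mulr_ge0 ?invr_ge0 //.
      by rewrite natrD mulrDl !mul1r lerD2l.
    by rewrite exprMn mulrA ler_wpM2r ?(ltW kp).
  have := ler_wpM2l l0 pd; have := ler_wpM2l (ltW F0) kN.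
  move: ck ckh; rewrite !ler_norml => /andP[c1 c2] /andP[c3 c4].
  have dp := ler_wpM2l (ltW d0) pow2.
  move: w dC c1 c2 c3 c4 dp; rewrite fN.
  move: (k%:R ^+ N.+1) ((k + h)%:R ^+ N.+1) ((k + h)%:R ^+ N) (k%:R ^+ N) (2 ^+ N.+1).
  move: (S (k + h)) (S k) (N.+1%:R) (N`!%:R) (h%:R : R) => S1 S0 n1 nf hh p1 p2 p3 p4 p5.
  lra.
have lb : (l - eps) * k%:R ^+ N <= a k * N`!%:R.
  have ckh := close (k - h)%N khp Kh.
  have w : (S k - S (k - h)) * N.+1`!%:R <= h%:R * a k * N.+1`!%:R.
    by rewrite ler_wpM2r // window_low.
  rewrite -(ler_pM2l F0).
  have pd : N.+1%:R * h%:R * (k - h)%:R ^+ N <= k%:R ^+ N.+1 - (k - h)%:R ^+ N.+1 :> R.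
    by rewrite lerBrDr; have := powerD_ge N (ler0n R (k - h)) (ler0n R h); rewrite -natrD subnK.
  have kN : (l - eps / 2) * k%:R ^+ N <= l * (k - h)%:R ^+ N.
    apply: le_trans (_ : l * ((1 + (-1) * q%:R^-1) * k%:R) ^+ N <= _).
      by rewrite exprMn mulrA ler_wpM2r ?(ltW kp).
    have e1 : 0 <= 1 + (-1) * q%:R^-1 :> R.
      by rewrite mulN1r subr_ge0 invf_le1 // ler1n (leq_trans _ q2).
    apply: (ler_wpM2l l0); apply: lerXn2r; rewrite ?nnegrE.
    - exact: mulr_ge0 e1 (ler0n _ _).
    - exact: ler0n.
    by rewrite natrB // mulrDl mulN1r mulNr mul1r lerD2l lerN2.
  have pow1 : (k - h)%:R ^+ N.+1 <= 2 ^+ N.+1 * k%:R ^+ N.+1 :> R.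
    rewrite -exprMn lerXn2r ?nnegrE ?mulr_ge0 // -natrM ler_nat.
    by rewrite (leq_trans (leq_subr _ _)) // leq_pmull.
  have := ler_wpM2l l0 pd; have := ler_wpM2l (ltW F0) kN.
  move: ck ckh; rewrite !ler_norml => /andP[c1 c2] /andP[c3 c4].
  have dp := ler_wpM2l (ltW d0) pow1.
  move: w dC c1 c2 c3 c4 dp; rewrite fN.
  move: (k%:R ^+ N.+1) ((k - h)%:R ^+ N.+1) ((k - h)%:R ^+ N) (k%:R ^+ N) (2 ^+ N.+1).
  move: (S (k - h)) (S k) (N.+1%:R) (N`!%:R) (h%:R : R) => S1 S0 n1 nf hh p1 p2 p3 p4 p5.
  lra.
rewrite -(ler_pdivrMr _ _ kp) in ub; rewrite -(ler_pdivlMr _ _ kp) in lb.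
rewrite /= ler_norml; move: ub lb; set b := _ / _ => ub lb.
by apply/andP; split; lra.
Qed.

End Tauber.

(** * Walks of exact duration, and profiles as walks *)

Section ExactCounts.
Variable R : realType.
Implicit Types (m : seq step).

Definition exact_count n m : nat -> (nat -> int) -> R :=
  foldr (@repeated R) (fun k w => if k == 0%N then positive_part R n k w else 0) m.

Lemma count_upto_exact n m k w : positive_steps m ->
  count_upto R n m k w = \sum_(j < k.+1) exact_count n m j w.
Proof.
(* The step [e] idles for one unit of time: a walk of time at most k is a walk of exact time k
   padded with idle steps. *)
move=> pos; pose e : step := (1%N, [::]).
have disp y : displace w (scale_step y e).2 = w.
  by apply/funext => i; rewrite /displace nth_scale_step nth_nil mulr0 addr0.
have sumE (u : nat -> (nat -> int) -> R) j v : repeated e u j v = \sum_(i < j.+1) u i v.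
  rewrite repeated_sum [RHS](reindex_inj rev_ord_inj) /=; apply: eq_bigr => y _.
  rewrite muln1 -ltnS ltn_ord subSS; congr (u _ _).
  by apply/funext => i; rewrite /displace nth_nil addr0.
suff -> : count_upto R n m = repeated e (exact_count n m) by rewrite sumE.
elim: m pos => [|f m IHm] /= => [_|/andP[f0 pos]].
  apply/funext => j; apply/funext => v; rewrite sumE /exact_count /= big_ord_recl /=.
  by rewrite big1 ?addr0.
by rewrite IHm // repeatedC.
Qed.

Lemma exact_count_mono n m k w w' : (forall i, w i <= w' i) ->
  exact_count n m k w <= exact_count n m k w'.
Proof.
elim: m k w w' => [|f m IHm] k w w' le_w.
  rewrite /exact_count /=; case: ifP => // _; rewrite ler_nat.
  case: forallP => // w0; case: forallP => // -[] i.
  exact: lt_le_trans (w0 i) (le_w i).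
rewrite /exact_count /= !repeated_sum; apply: ler_sum => x _; case: ifP => // _.
by apply: IHm => i; rewrite lerD2r.
Qed.

Lemma exact_count_ge0 n m k w : 0 <= exact_count n m k w.
Proof.
elim: m k w => [|f m IHm] k w; rewrite /exact_count /=.
  by case: ifP => //; rewrite positive_part_ge0.
rewrite repeated_sum sumr_ge0 // => x _; case: ifP => // _; exact: IHm.
Qed.

(** A step of duration 1 with no negative coordinate can be added to any walk: time grows by one and
    all positivity constraints survive. *)
Lemma exact_count_homo n m (f : step) w : positive_steps m -> f \in m -> f.1 = 1%N ->
  all (fun c => 0 <= c) f.2 ->
  {homo (fun k => exact_count n m k w) : i j / (i <= j)%N >-> i <= j}.
Proof.
move=> pos fm f1 fp; apply: homo_leq => // [x y z|k]; first exact: le_trans.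
rewrite /exact_count (foldr_repeated_perm _ pos (perm_to_rem fm)) /=.
rewrite -!/(exact_count _ _); move: (rem f m) => m'.
have f0 : (0 < f.1)%N by rewrite f1.
rewrite [X in _ <= X _ w](repeatedE _ f0) fctE /delay f1 /= subn1 /=.
apply: le_trans (_ : exact_count n (f :: m') k (displace w f.2) <= _).
  apply: (exact_count_mono n (f :: m')) => i; rewrite lerDl.
  have [lti|lei] := ltnP i (size f.2); last by rewrite nth_default.
  by apply: (allP fp); rewrite mem_nth.
by rewrite lerDr exact_count_ge0.
Qed.

Theorem exact_count_cvg n m (f : step) x : positive_steps m -> f \in m -> f.1 = 1%N ->
  all (fun c => 0 <= c) f.2 -> 0 <= x -> has_value R n m x ->
  (fun k => exact_count n m k (fun=> 0) * (size m).-1`!%:R / k%:R ^+ (size m).-1)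
    @ \oo --> (ratr x : R).
Proof.
move=> pos fm f1 fp x0 /(_ (fun=> 0)).
rewrite /scaled_count; case: m pos fm => // g m pos fm H.
apply: tauber; first exact: (exact_count_homo n _ pos fm).
  move: H; set a := (fun k => _); set b := (fun k => _); suff -> : a = b by [].
  by apply/funext => k; rewrite /a /b count_upto_exact.
by rewrite ler0q.
Qed.

Section Profiles.
Variables (I : finType) (K n : nat) (st : I -> step).
Hypothesis st1 : forall s, (st s).1 = 1%N.
Implicit Types (x : {ffun I -> 'I_K.+1}) (w : nat -> int).

Let fits (k : nat) w x := (\sum_s x s == k)%N &&
  [forall i : 'I_n, 0 < w i + \sum_s (x s)%:Z * (st s).2`_i].

Let update x f y : {ffun I -> 'I_K.+1} := [ffun t => if t == f then y else x t].

Let fits_update k w x f (y : 'I_K.+1) : x f = ord0 -> (y <= k)%N ->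
  fits k w (update x f y) = fits (k - y)%N (displace w (scale_step y (st f)).2) x.
Proof.
move=> xf yk; congr (_ && _).
  rewrite (bigD1 f) //= ffunE eqxx [in RHS](bigD1 f) //= xf add0n.
  under eq_bigr => s sf do rewrite ffunE (negbTE sf).
  by apply/eqP/eqP => E; lia.
apply: eq_forallb => i; congr (0 < _).
rewrite (bigD1 f) //= ffunE eqxx [in RHS](bigD1 f) //= xf mul0r add0r.
under eq_bigr => s sf do rewrite ffunE (negbTE sf).
by rewrite /displace nth_scale_step addrA.
Qed.

(** Induction on the rankings allowed to have voters. The number [y] of voters of the next ranking
    is split off, and [update] identifies the profiles with this value with those where it is 0. *)
Lemma exact_count_sum (s : seq I) k w : uniq s -> (k <= K)%N ->
  exact_count n (map st s) k w =
  \sum_(x : {ffun I -> 'I_K.+1} | [forall t, (t \notin s) ==> (x t == ord0)]) (fits k w x)%:R.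
Proof.
elim: s k w => [|f s IHs] k w.
  move=> _ _; rewrite (bigD1 [ffun=> ord0]) /=; last by apply/forallP => t; rewrite ffunE eqxx.
  rewrite big1 => [|x /andP[/forallP x0 /eqP[]]]; last first.
    by apply/ffunP => t; rewrite ffunE; exact/eqP/x0.
  rewrite addr0 /fits big1 => [|t _]; last by rewrite ffunE.
  rewrite /exact_count /= /positive_part eq_sym; case: eqP => //= _; congr (nat_of_bool _)%:R.
  apply: eq_forallb => i; rewrite big1 ?addr0 // => t _; by rewrite ffunE mul0r.
case/andP => fs us kK; rewrite /exact_count /= repeated_sum.
rewrite (partition_big (fun x => x f) xpredT) //=.
pose F (y : nat) := if (y <= k)%N then exact_count n (map st s) (k - y)%N (displace w (scale_step y (st f)).2) else 0.
rewrite (eq_bigr (fun y : 'I_k.+1 => F y)) => [|y _]; last by rewrite st1 muln1.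
transitivity (\sum_(y < K.+1) F y).
  rewrite -!(big_mkord xpredT F) [in RHS](big_cat_nat _ (_ : k.+1 <= K.+1)%N) //=.
  rewrite [X in _ + X]big_nat_cond [X in _ + X]big1 ?addr0 // => y /andP[/andP[ky _] _].
  by rewrite /F leqNgt ky.
apply: eq_bigr => y _.
rewrite (reindex_onto (fun x => update x f y) (fun x => update x f ord0)) /=; last first.
  move=> x /andP[_ /eqP xf]; apply/ffunP => t; rewrite !ffunE.
  by case: eqP => // ->.
have P x : [forall t, (t \notin f :: s) ==> (update x f y t == ord0)] && (update x f y f == y)
    && (update (update x f y) f ord0 == x) = [forall t, (t \notin s) ==> (x t == ord0)].
  apply/andP/forallP => [[/andP[/forallP x0 _] /eqP <-] t|x0].
    apply/implyP => ts; rewrite !ffunE; have [//|tf] := eqVneq t f.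
    by have := implyP (x0 t); rewrite inE negb_or tf ts ffunE (negbTE tf) => ->.
  have xf : x f = ord0 by apply/eqP/(implyP (x0 f)).
  split; last by apply/eqP/ffunP => t; rewrite !ffunE; have [->|//] := eqVneq t f; rewrite xf.
  rewrite ffunE !eqxx andbT; apply/forallP => t; apply/implyP; rewrite inE negb_or => /andP[tf ts].
  by rewrite ffunE (negbTE tf); apply: (implyP (x0 t)).
rewrite (eq_bigl _ _ P) /F; case: leqP => yk.
  rewrite IHs ?(leq_trans (leq_subr _ _)) //; apply: eq_bigr => x /forallP x0.
  by rewrite fits_update //; apply/eqP/(implyP (x0 f)).
rewrite big1 // => x /forallP x0; rewrite /fits (bigD1 f) //= ffunE eqxx.
by rewrite gtn_eqF // (leq_trans yk) ?leq_addr.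
Qed.

Lemma exact_count_card : exact_count n [seq st s | s <- enum I] K (fun=> 0) =
  #|[set x : {ffun I -> 'I_K.+1} | (\sum_s x s == K)%N &&
     [forall i : 'I_n, 0 < \sum_s (x s)%:Z * (st s).2`_i]]%SET|%:R.
Proof.
rewrite exact_count_sum ?enum_uniq // -sum1_card natr_sum big_mkcond [RHS]big_mkcond /=.
apply: eq_bigr => x _; rewrite inE.
have -> : [forall t, (t \notin enum I) ==> (x t == ord0)].
  by apply/forallP => t; rewrite mem_enum.
rewrite /fits; under eq_forallb => i do rewrite add0r.
by case: ifP.
Qed.

End Profiles.
End ExactCounts.

(** * From Condorcet winners to walks *)

Section Condorcet.
Variables (R : realType) (n : nat).
Local Notation rk := (ranking n.+1).

(** Each voter changes the margin of candidate 0 over candidate i+1 by 1 or -1, so the end point of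
    the walk is the vector of margins. *)
Definition ranking_step (s : rk) : step :=
  (1%N, [seq (if ranks_above s ord0 (lift ord0 i) then 1 else -1) | i <- enum 'I_n]).

Definition condorcet_steps : seq step := [seq ranking_step s | s <- enum {perm 'I_n.+1}].

Definition cw_profiles k (a : 'I_n.+1) : {set {ffun rk -> 'I_k.+1}} :=
  [set x in profiles n.+1 k | is_condorcet_winner (fun s => val (x s)) a].

Lemma nth_ranking_step s (i : 'I_n) : (ranking_step s).2`_i =
  if ranks_above s ord0 (lift ord0 i) then 1 else -1.
Proof.
by rewrite (nth_map i) ?size_enum_ord // nth_ord_enum.
Qed.

Lemma supporters_margin (x : rk -> nat) (i : 'I_n) :
  \sum_s (x s)%:Z * (ranking_step s).2`_i =
  (supporters x ord0 (lift ord0 i))%:Z - (supporters x (lift ord0 i) ord0)%:Z.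
Proof.
rewrite /supporters -!natz !natr_sum [in RHS]big_mkcond [X in _ - X]big_mkcond -sumrB.
apply: eq_bigr => s _; rewrite nth_ranking_step /ranks_above.
have ne : (s ord0 != s (lift ord0 i)) by rewrite (inj_eq perm_inj).
rewrite -val_eqE /= in ne.
by case: ltngtP ne => // _ _; rewrite ?mulr1 ?subr0 ?mulrN1 ?sub0r natz.
Qed.

Lemma exact_count_cw k : exact_count R n condorcet_steps k (fun=> 0) = #|cw_profiles k ord0|%:R.
Proof.
rewrite exact_count_card //; congr (_%:R); apply: eq_card => x; rewrite !inE.
rewrite /voters; congr (_ && _); apply/forallP/forallP => H.
  move=> b; apply/implyP; case: (unliftP ord0 b) => [i ->|-> /eqP //] _.
  by have := H i; rewrite supporters_margin subr_gt0 ltz_nat.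
move=> i; rewrite (supporters_margin (fun s => val (x s))) subr_gt0 ltz_nat.
by have := H (lift ord0 i); rewrite eq_sym neq_lift.
Qed.

Lemma exact_count_profiles k : exact_count R 0 condorcet_steps k (fun=> 0) = #|profiles n.+1 k|%:R.
Proof.
rewrite exact_count_card //; congr (_%:R); apply: eq_card => x; rewrite !inE.
by rewrite /voters; case: eqP => //= _; apply/forallP => -[].
Qed.

Definition relabel k (p : rk) (x : {ffun rk -> 'I_k.+1}) : {ffun rk -> 'I_k.+1} :=
  [ffun s : rk => x (p * s)%g].

Lemma relabelK k p : cancel (@relabel k p) (relabel p^-1%g).
Proof. by move=> x; apply/ffunP => s; rewrite !ffunE mulKVg. Qed.

Lemma voters_relabel k p x :
  voters (fun s => val (@relabel k p x s)) = voters (fun s => val (x s)).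
Proof.
rewrite /voters [RHS](reindex_inj (mulgI p)) /=.
by apply: eq_bigr => s _; rewrite ffunE.
Qed.

Lemma supporters_relabel k p x (a b : 'I_n.+1) :
  supporters (fun s => val (@relabel k p x s)) a b =
  supporters (fun s => val (x s)) (p^-1%g a) (p^-1%g b).
Proof.
rewrite /supporters [RHS](reindex_inj (mulgI p)) /=; apply: eq_big => s.
  by rewrite /ranks_above !permM !permKV.
by rewrite ffunE.
Qed.

(** Relabelling candidates by q is a bijection of profiles that turns a winner c into a winner
    q(c). *)
Lemma card_cw_profiles k a : #|cw_profiles k a| = #|cw_profiles k ord0|.
Proof.
pose p : rk := tperm a ord0.
have pV : p^-1%g = p by rewrite tpermV.
rewrite -(card_imset _ (can_inj (relabelK p))) -[RHS](card_imset _ (can_inj (@relabelK k 1%g))).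
suff -> : relabel p @: cw_profiles k a = relabel 1%g @: cw_profiles k ord0 by [].
have E q c : relabel q @: cw_profiles k c = cw_profiles k (q c).
  apply/setP => x; apply/imsetP/idP => [[y + ->]|xc].
    rewrite !inE => /andP[yk /forallP yc]; rewrite voters_relabel yk /=.
    apply/forallP => b; apply/implyP => bc; rewrite /majority_beats !supporters_relabel permK.
    by have /implyP := yc (q^-1%g b); apply; rewrite -(inj_eq (@perm_inj _ q)) permKV.
  exists (relabel q^-1%g x); last by rewrite -{1}[q]invgK relabelK.
  move: xc; rewrite !inE => /andP[xk /forallP xc]; rewrite voters_relabel xk /=.
  apply/forallP => b; apply/implyP => bc; rewrite /majority_beats !supporters_relabel invgK.
  by have /implyP := xc (q b); apply; rewrite (inj_eq perm_inj).
by rewrite !E perm1 tpermL.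
Qed.

Lemma card_condorcet_profiles k :
  #|condorcet_profiles n.+1 k| = (n.+1 * #|cw_profiles k ord0|)%N.
Proof.
transitivity (\sum_(a : 'I_n.+1) #|cw_profiles k ord0|)%N; last first.
  by rewrite sum_nat_const card_ord.
under [RHS]eq_bigr => a _ do rewrite -(card_cw_profiles k a) -sum1_card big_mkcond.
rewrite [RHS]exchange_big -sum1_card big_mkcond /=; apply: eq_bigr => x _.
rewrite inE; under [RHS]eq_bigr => a _ do rewrite inE.
case: (x \in profiles n.+1 k) => /=; last by rewrite big1.
rewrite /has_condorcet_winner; case: existsP => [[a wa]|nw]; last first.
  by rewrite big1 // => a _; case: ifP => // wa; case: nw; exists a.
rewrite (bigD1 a) //= wa big1 // => b ba; case: ifP => // wb.
have /implyP/(_ ba) := forallP wa b; rewrite eq_sym in ba.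
have /implyP/(_ ba) := forallP wb a; rewrite /majority_beats => h1 h2.
by have := ltn_trans h1 h2; rewrite ltnn.
Qed.

Lemma positive_condorcet_steps : positive_steps condorcet_steps.
Proof. by rewrite /positive_steps all_map; apply/allP. Qed.

(** Winning profiles for candidate 0 and all profiles are exact counts for the same steps, with n
    and with 0 constraints. The normalisations cancel, the unconstrained value is 1, and the n+1
    possible winners are disjoint cases. *)
Theorem condorcet_limit (p : rat) : 0 <= p -> has_value R n condorcet_steps p ->
  iac_condorcet_probability R n.+1 k @[k --> \oo] --> (ratr (p *+ n.+1) : R).
Proof.
move=> p0 Hp.
(* The identity ranking puts candidate 0 first, so its step has only coordinates 1 and supplies the
   monotonicity needed for [tauber]. *)
have um : ranking_step 1%g \in condorcet_steps by rewrite map_f ?mem_enum.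
have up : all (fun c => 0 <= c) (ranking_step 1%g).2.
  apply/allP => c /mapP[i _ ->]; by rewrite /ranks_above !perm1.
have A := exact_count_cvg positive_condorcet_steps um erefl up p0 Hp.
have V0 := @has_value0 R _ positive_condorcet_steps.
have e1 : \prod_(f <- condorcet_steps) f.1%:R^-1 = 1 :> rat.
  by rewrite big_map big1 // => s _; rewrite invr1.
rewrite e1 in V0.
have B := exact_count_cvg positive_condorcet_steps um erefl up ler01 V0.
rewrite rmorph1 in B.
pose nrm k : R := ((size condorcet_steps).-1)`!%:R / k%:R ^+ (size condorcet_steps).-1.
have H : (fun k => n.+1%:R * (exact_count R n condorcet_steps k (fun=> 0) * nrm k *
    (exact_count R 0 condorcet_steps k (fun=> 0) * nrm k)^-1)) @ \oo -->
    (n.+1%:R * (ratr p * 1^-1) : R).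
  apply: cvgM; first exact: cvg_cst.
  under eq_fun do rewrite /nrm !mulrA.
  by apply: cvgM => //; apply: cvgV; rewrite ?oner_neq0.
have -> : ratr (p *+ n.+1) = n.+1%:R * (ratr p * 1^-1) :> R.
  by rewrite invr1 mulr1 mulr_natl rmorphMn.
apply: cvg_trans H; apply: near_eq_cvg; near=> k.
have k0 : k%:R ^+ (size condorcet_steps).-1 != 0 :> R.
  by rewrite expf_neq0 // pnatr_eq0 -lt0n; near: k; exact: nbhs_infty_gt.
have f0 : ((size condorcet_steps).-1)`!%:R != 0 :> R by rewrite pnatr_eq0 -lt0n fact_gt0.
rewrite /iac_condorcet_probability card_condorcet_profiles natrM -exact_count_cw.
rewrite -exact_count_profiles /nrm.
move: (exact_count _ _ _ _ _) (exact_count _ _ _ _ _) k0 f0 => v u.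
move: (_ ^+ _) (_`!%:R) => x y x0 y0.
have [->|v0] := eqVneq v 0; first by rewrite !mul0r invr0 !mulr0.
by field; rewrite v0 x0 y0.
Unshelve. all: by end_near. Qed.

End Condorcet.

(** * Symmetries and complements of values *)

Section Symmetries.
Variable R : realType.
Implicit Types (f : step) (m : seq step) (g : step -> step).

Lemma count_upto_reindex n (tau : nat -> nat) g m k w w' :
  (forall i, (i < n)%N -> (tau i < n)%N /\ tau (tau i) = i) ->
  (forall f, f \in m -> (g f).1 = f.1 /\ forall i, (i < n)%N -> (g f).2`_i = f.2`_(tau i)) ->
  (forall i, (i < n)%N -> w' i = w (tau i)) ->
  count_upto R n (map g m) k w' = count_upto R n m k w.
Proof.
move=> tauK; elim: m k w w' => [|f m IHm] k w w' gE wE.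
  rewrite /= /positive_part; congr (_%:R); congr (nat_of_bool _).
  apply/forallP/forallP => H i; have [ti tti] := tauK i (ltn_ord i).
    by have := H (Ordinal ti); rewrite /= wE // tti.
  by rewrite wE //; apply: (H (Ordinal ti)).
have [g1 g2] := gE f (mem_head _ _).
rewrite /= !repeated_sum; apply: eq_bigr => x _; rewrite g1; case: ifP => // _.
apply: IHm => [h hm|i lti]; first by apply: gE; rewrite inE hm orbT.
by rewrite /displace !nth_scale_step g2 // wE.
Qed.

(** For integers, 0 < a fails exactly when 0 < 1 - a. Negating the last coordinate of every step and
    starting it at 1 - w_n therefore counts the complement. *)
Lemma count_upto_complement n g m k w w' :
  (forall f, f \in m -> (g f).1 = f.1 /\
    (forall i, (i < n)%N -> (g f).2`_i = f.2`_i) /\ (g f).2`_n = - f.2`_n) ->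
  (forall i, (i < n)%N -> w' i = w i) -> w' n = 1 - w n ->
  count_upto R n.+1 m k w = count_upto R n m k w - count_upto R n.+1 (map g m) k w'.
Proof.
elim: m k w w' => [|f m IHm] k w w' gE wE wn.
  rewrite /= /positive_part.
  have E (v : nat -> int) : [forall i : 'I_n.+1, 0 < v i] = [forall i : 'I_n, 0 < v i] && (0 < v n).
    apply/forallP/andP => [H|[/forallP H vn] i].
      by split; [apply/forallP => i; exact: (H (widen_ord (leqnSn _) i)) | exact: (H ord_max)].
    have := ltn_ord i; rewrite ltnS leq_eqVlt => /orP[/eqP-> // | lti].
    exact: (H (Ordinal lti)).
  have -> : [forall i : 'I_n.+1, 0 < w' i] = [forall i : 'I_n, 0 < w i] && ~~ (0 < w n).
    rewrite E wn; congr (_ && _); last by lia.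
    by apply: eq_forallb => i; rewrite wE.
  by rewrite E; case: forallP => _; case: ltP => _; rewrite /= ?subrr ?subr0.
have [g1 [g2 g3]] := gE f (mem_head _ _).
rewrite /= !repeated_sum -sumrB; apply: eq_bigr => x _; rewrite g1.
case: ifP => _; last by rewrite subr0.
apply: IHm => [h hm|i lti|]; first by apply: gE; rewrite inE hm orbT.
  by rewrite /displace !nth_scale_step g2 // wE.
by rewrite /displace !nth_scale_step g3 wn; ring.
Qed.

Lemma has_value_reindex n (tau : nat -> nat) g m x :
  (forall i, (i < n)%N -> (tau i < n)%N /\ tau (tau i) = i) ->
  (forall f, f \in m -> (g f).1 = f.1 /\ forall i, (i < n)%N -> (g f).2`_i = f.2`_(tau i)) ->
  has_value R n m x -> has_value R n (map g m) x.
Proof.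
move=> tauK gE Hx w; have := Hx (fun i => w (tau i)).
set a := scaled_count _ _ _ _; set b := scaled_count _ _ _ _; suff -> : a = b by [].
apply/funext => k; rewrite /a /b /scaled_count size_map.
by rewrite (@count_upto_reindex n tau g m k (fun i => w (tau i)) w) // => i lti; rewrite (tauK i lti).2.
Qed.

Lemma has_value_complement n g m x y :
  (forall f, f \in m -> (g f).1 = f.1 /\
    (forall i, (i < n)%N -> (g f).2`_i = f.2`_i) /\ (g f).2`_n = - f.2`_n) ->
  has_value R n m x -> has_value R n.+1 (map g m) y -> has_value R n.+1 m (x - y).
Proof.
move=> gE Hx Hy w; pose w' i := if i == n then 1 - w n else w i.
have -> : scaled_count R n.+1 m w =
    (fun k => scaled_count R n m w k - scaled_count R n.+1 (map g m) w' k).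
  apply/funext => k; rewrite /scaled_count size_map -!mulrBl.
  rewrite (@count_upto_complement n g m k w w') // /w' ?eqxx // => i lti.
  by rewrite (ltn_eqF lti).
by rewrite rmorphB; apply: cvgB; [exact: Hx | exact: Hy].
Qed.

Lemma has_value_uniq n m x y : has_value R n m x -> has_value R n m y -> x = y.
Proof.
move=> /(_ (fun=> 0)) Hx /(_ (fun=> 0)) Hy; apply: (@fmorph_inj _ R ratr).
exact: (cvg_unique _ Hx Hy).
Qed.

(** One family serves finitely many systems, so that linear identities between integrands become
    identities between values. *)
Lemma flag_formula_all n (ms : seq (seq step)) :
  (forall m, m \in ms -> positive_steps m /\ nonzero_coords n m) ->
  exists2 B, admissible B & forall F, admissible F ->
    (forall i, (i < n)%N -> {subset B i <= F i}) ->
    forall m, m \in ms -> has_value R n m (signed_flag_sum n F m).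
Proof.
elim: ms => [|m ms IH] H; first by exists (fun=> [::]).
have [|B aB HB] := IH; first by move=> m' m'ms; apply: H; rewrite inE m'ms orbT.
have [pm nm] := H m (mem_head _ _).
have [C aC HC] := flag_formula_value R pm nm.
exists (fun i => undup (B i ++ C i)) => [i|F aF sF m' m'ms].
  split; first exact: undup_uniq.
  by move=> r; rewrite mem_undup mem_cat => /orP[/(proj2 (aB i))|/(proj2 (aC i))].
move: m'ms; rewrite inE => /orP[/eqP->|m'ms].
  by apply: HC => // i lti r rC; apply: sF; rewrite // mem_undup mem_cat rC orbT.
by apply: HB => // i lti r rB; apply: sF; rewrite // mem_undup mem_cat rB.
Qed.

End Symmetries.

(** * Partial fractions with integral coefficients *)

Definition ofZ (L : pzRingType) (z : Z) : L := (int_of_Z z)%:~R.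

Lemma ofZD (L : pzRingType) a b : ofZ L (a + b)%BZ = ofZ L a + ofZ L b.
Proof. by rewrite /ofZ raddfD /= rmorphD. Qed.

Lemma ofZM (L : pzRingType) a b : ofZ L (a * b)%BZ = ofZ L a * ofZ L b.
Proof. by rewrite /ofZ rmorphM /= rmorphM. Qed.

Lemma ofZ1 (L : pzRingType) : ofZ L 1%BZ = 1. Proof. by []. Qed.

Lemma ofZ0 (L : pzRingType) : ofZ L 0%BZ = 0. Proof. by []. Qed.

Section PartialFractions.
Variables (L : fieldType) (u v : L).
Hypotheses (u0 : u != 0) (v0 : v != 0) (uv : u + v = 1).

Fixpoint suffix_sums (s : seq Z) : seq Z :=
  if s is z :: s' then let t := suffix_sums s' in (z + head 0 t)%BZ :: t else [::].

Fixpoint pow_sum (x : L) (s : seq Z) : L :=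
  if s is z :: s' then x^-1 * (ofZ L z + pow_sum x s') else 0.

(* The partial fraction expansion of [u^-a v^-(b+1)] is obtained from the    *)
(* one of [u^-a v^-b] by [u^-1 v^-1 = u^-1 + v^-1].                          *)
Lemma pow_sum_step s : v^-1 * pow_sum u s =
  pow_sum u (suffix_sums s) + v^-1 * ofZ L (head 0%BZ (suffix_sums s)).
Proof.
elim: s => [|z s IHs] /=; first by rewrite ?ofZ0 !mulr0 addr0.
have E : u^-1 * v^-1 = u^-1 + v^-1.
  rewrite -[LHS]mul1r -uv; field; by rewrite u0 v0.
rewrite mulrCA mulrDr IHs ofZD !mulrDr !mulrA E; ring.
Qed.

(** The coefficients of u^-1, ..., u^-(a+1) in the expansion of u^-(a+1) v^-b when u + v = 1;
    [race_residuals] gives those of v^-1, ..., v^-b. *)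
Fixpoint race_weights a b : seq Z :=
  if b is b'.+1 then suffix_sums (race_weights a b') else rcons (nseq a 0%BZ) 1%BZ.

Fixpoint race_residuals a b : seq Z :=
  if b is b'.+1 then head 0%BZ (race_weights a b) :: race_residuals a b' else [::].

Lemma pow_sum_races a b : u^-1 ^+ a.+1 * v^-1 ^+ b =
  pow_sum u (race_weights a b) + pow_sum v (race_residuals a b).
Proof.
elim: b => [|b IHb].
  rewrite expr0 mulr1 addr0 /=; elim: a => [|a IHa] /=.
    by rewrite ofZ1 addr0 mulr1.
  by rewrite exprS IHa ofZ0 add0r.
rewrite [v^-1 ^+ _]exprS mulrCA IHb mulrDr pow_sum_step -addrA /=.
by rewrite [v^-1 * (_ + _)]mulrDr.
Qed.

End PartialFractions.

(** * The sign vectors for five candidates and inclusion-exclusion *)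

Definition all_above : step := (1%N, [:: 1; 1; 1; 1]).

Definition all_below : step := (1%N, [:: -1; -1; -1; -1]).

Definition signs (v : seq int) : step := (1%N, v).

(** Candidate 0 stands above a given set of s opponents, and below the others, in s! (4-s)!
    rankings: 6, 4 or 6 for s = 3, 2, 1. *)
Definition mixed_groups : seq (step * nat) :=
  [:: (signs [:: 1; 1; 1; -1], 6%N); (signs [:: 1; 1; -1; 1], 6%N);
      (signs [:: 1; -1; 1; 1], 6%N); (signs [:: -1; 1; 1; 1], 6%N);
      (signs [:: 1; 1; -1; -1], 4%N); (signs [:: 1; -1; 1; -1], 4%N);
      (signs [:: 1; -1; -1; 1], 4%N); (signs [:: -1; 1; 1; -1], 4%N);
      (signs [:: -1; 1; -1; 1], 4%N); (signs [:: -1; -1; 1; 1], 4%N);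
      (signs [:: 1; -1; -1; -1], 6%N); (signs [:: -1; 1; -1; -1], 6%N);
      (signs [:: -1; -1; 1; -1], 6%N); (signs [:: -1; -1; -1; 1], 6%N)].

Definition mixed_steps : seq step := flatten [seq nseq g.2 g.1 | g <- mixed_groups].

Definition ranking_code (s : ranking 5) : seq nat := [seq val (s i) | i <- enum 'I_5].

Definition code_step (c : seq nat) : step :=
  (1%N, [seq (if (nth 0%N c 0 < nth 0%N c i.+1)%N then 1 else -1) | i <- iota 0 4]).

Lemma nth_ranking_code s (i : 'I_5) : nth 0%N (ranking_code s) i = s i.
Proof. by rewrite (nth_map i) ?size_enum_ord // nth_ord_enum. Qed.

Lemma code_step_ranking s : code_step (ranking_code s) = ranking_step s.
Proof.
have sz : size (ranking_step s).2 = 4%N by rewrite size_map size_enum_ord.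
apply: injective_projections; first by [].
apply: (@eq_from_nth int 0) => [|i]; first by rewrite sz.
rewrite [X in (_ < X)%N](_ : _ = 4%N) // => lti; rewrite (nth_map 0%N) ?size_iota // nth_iota // add0n.
rewrite -[i in RHS]/(val (Ordinal lti)) nth_ranking_step /ranks_above.
by rewrite -!nth_ranking_code.
Qed.

(** Encoding rankings by their lists of positions turns the claim into a computation on
    [permutations (iota 0 5)]. *)
Lemma condorcet_steps_groups :
  perm_eq (condorcet_steps 4) (nseq 24 all_above ++ nseq 24 all_below ++ mixed_steps).
Proof.
have -> : condorcet_steps 4 = map code_step (map ranking_code (enum (ranking 5))).
  by rewrite -map_comp; apply: eq_map => s /=; rewrite code_step_ranking.
have P : perm_eq (map ranking_code (enum (ranking 5))) (permutations (iota 0 5)).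
  have inj : injective ranking_code.
    move=> s t E; apply/permP => i; apply: val_inj.
    by rewrite /= -!nth_ranking_code E.
  have uq : uniq (map ranking_code (enum (ranking 5))) by rewrite map_inj_uniq ?enum_uniq.
  apply: (uniq_perm uq (permutations_uniq _)).
  suff sub : {subset map ranking_code (enum (ranking 5)) <= permutations (iota 0 5)}.
    apply: (uniq_min_size uq sub _).2.
    rewrite size_permutations ?iota_uniq // size_iota size_map -cardE.
    by rewrite -card_Sn.
  move=> c /mapP[s _ ->]; rewrite mem_permutations; apply: uniq_perm.
  - rewrite map_inj_uniq ?enum_uniq // => i j /val_inj; exact: perm_inj.
  - exact: iota_uniq.
  move=> k; rewrite mem_iota add0n leq0n /=; apply/mapP/idP => [[i _ ->]|ltk]; first exact: ltn_ord.
  by exists ((s^-1)%g (Ordinal ltk)); rewrite ?mem_enum // permKV.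
by rewrite (perm_trans (perm_map code_step P)) //; vm_compute.
Qed.

Definition flip_first (j : nat) (f : step) : step :=
  (f.1, [seq (if (i < j)%N then - f.2`_i else f.2`_i) | i <- iota 0 4]).

Definition flip_coord (n : nat) (f : step) : step :=
  (f.1, [seq (if i == n then - f.2`_i else f.2`_i) | i <- iota 0 4]).

Definition transpose (j n i : nat) : nat := if i == j then n else if i == n then j else i.

Definition swap_coords j n (f : step) : step :=
  (f.1, [seq f.2`_(transpose j n i) | i <- iota 0 4]).

Lemma nth_map_iota4 (F : nat -> int) i : (i < 4)%N -> [seq F i | i <- iota 0 4]`_i = F i.
Proof. by move=> lti; rewrite (nth_map 0%N) ?size_iota // nth_iota. Qed.

Lemma nth_flip_first j f i : (i < 4)%N ->
  (flip_first j f).2`_i = if (i < j)%N then - f.2`_i else f.2`_i.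
Proof. exact: nth_map_iota4. Qed.

Lemma nth_flip_coord n f i : (i < 4)%N ->
  (flip_coord n f).2`_i = if i == n then - f.2`_i else f.2`_i.
Proof. exact: nth_map_iota4. Qed.

Lemma nth_swap_coords j n f i : (i < 4)%N ->
  (swap_coords j n f).2`_i = f.2`_(transpose j n i).
Proof. exact: nth_map_iota4. Qed.

Definition with_above J := nseq J all_above ++ mixed_steps.

Definition with_below J := nseq J all_below ++ mixed_steps.

Section InclusionExclusion.
Variables (R : realType) (V : nat -> rat) (J : nat).
Hypothesis V_below : forall j, (j <= 4)%N -> has_value R j (with_below J) (V j).

Fixpoint differences p j : rat :=
  if p is p'.+1 then differences p' j - differences p' j.+1 else V j.

(** Here the first [j] margins are required to be negative and the next [p] positive. Giving up one
    positive constraint and subtracting the case where it is reversed is the recursion of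
    [differences]. *)
Lemma has_value_flipped p j : (p + j <= 4)%N ->
  has_value R (p + j) (map (flip_first j) (with_above J)) (differences p j).
Proof.
elim: p j => [|p IHp] j pj.
  have H := V_below pj.
  (* The mixed steps are stable under negation, which exchanges [all_above] and [all_below]. *)
  have P : perm_eq (with_below J) (map (flip_first 4) (with_above J)).
    by rewrite map_cat map_nseq; apply: perm_cat => //; vm_compute.
  have pos : positive_steps (with_below J).
    by rewrite /positive_steps all_cat all_nseq orbT; vm_compute.
  have {}H := has_value_perm pos P H.
  have -> : map (flip_first j) (with_above J) =
      map (flip_first j \o flip_first 4) (map (flip_first 4) (with_above J)).
    rewrite -map_comp; apply/eq_in_map => f; rewrite mem_cat => fm.
    have {}fm : f \in all_above :: mixed_steps.
      case/orP: fm => [|fm]; last by rewrite inE fm orbT.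
      by rewrite mem_nseq => /andP[_ /eqP->]; exact: mem_head.
    suff /allP/(_ f fm)/eqP -> : all (fun h => flip_first j h ==
        (flip_first j \o flip_first 4 \o flip_first 4) h) (all_above :: mixed_steps) by [].
    by move: j pj {H P pos} => [|[|[|[|[|//]]]]] _; vm_compute.
  apply: (@has_value_reindex _ _ id) H => // f _; split=> // i lti.
  have lt4 := leq_trans lti pj.
  rewrite -[(_ \o _) f]/(flip_first j (flip_first 4 f)).
  by rewrite !nth_flip_first // lti lt4 opprK.
rewrite addSn in pj; have n4 : (p + j < 4)%N by [].
have H1 := IHp j (ltnW pj).
have H2 : has_value R (p + j).+1 (map (flip_first j.+1) (with_above J)) (differences p j.+1).
  by rewrite -addnS; apply: IHp; rewrite addnS.
rewrite addSn; apply: (@has_value_complement _ _ (flip_coord (p + j))) H1 _ => [f _|].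
  split=> //; split=> [i lti|]; rewrite nth_flip_coord ?eqxx //.
    by rewrite (ltn_eqF lti).
  exact: ltn_trans lti n4.
have jn : (j <= p + j)%N by exact: leq_addl.
move: (p + j)%N n4 jn H2 => n n4 jn H2.
(* The newly negated coordinate is moved next to the [j] negated ones by a transposition, under
   which the mixed steps are stable. *)
have tr i : (i < n.+1)%N -> (transpose j n i < n.+1)%N /\ transpose j n (transpose j n i) = i.
  move=> lti; rewrite /transpose.
  have [->|nij] := eqVneq i j; first by rewrite ltnSn eqxx; case: eqVneq.
  have [->|nin] := eqVneq i n; first by rewrite eqxx ltnS.
  by rewrite (negbTE nij) (negbTE nin).
have {}H2 := @has_value_reindex R n.+1 (transpose j n) (swap_coords j n) _ _ tr _ H2.
apply: has_value_perm (H2 _).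
- rewrite /positive_steps !all_map all_cat all_nseq; apply/andP; split; first by rewrite orbT.
  by apply/allP => f; move: f; apply/allP; vm_compute.
- have A : perm_eq (map (swap_coords j n \o flip_first j.+1) mixed_steps)
                   (map (flip_coord n \o flip_first j) mixed_steps) /\
           swap_coords j n (flip_first j.+1 all_above) = flip_coord n (flip_first j all_above).
    by move: n n4 jn {tr H2} => [|[|[|[|//]]]] _; move: j {pj IHp} => [|[|[|[|//]]]] _ //; split; vm_compute.
  rewrite -!map_comp !map_cat !map_nseq /= A.2; exact: perm_cat (perm_refl _) A.1.
- by move=> f _; split=> // i lti; rewrite nth_swap_coords // (leq_trans lti).
Qed.

Lemma has_value_with_above : has_value R 4 (with_above J)
  (V 0 - 4%:R * V 1 + 6%:R * V 2 - 4%:R * V 3 + V 4).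
Proof.
have := @has_value_flipped 4 0 isT.
have -> : map (flip_first 0) (with_above J) = with_above J.
  by rewrite map_cat map_nseq; congr (_ ++ _).
have -> // : differences 4 0 = V 0 - 4%:R * V 1 + 6%:R * V 2 - 4%:R * V 3 + V 4.
by rewrite /=; ring.
Qed.

End InclusionExclusion.

(** * Trading the two unanimous groups for powers of one form *)

Lemma pow_sumE (L : fieldType) (x : L) s : pow_sum x s =
  \sum_(i < size s) ofZ L (nth 0%BZ s i) * x^-1 ^+ i.+1.
Proof.
elim: s => [|z s IHs] /=; first by rewrite big_ord0.
rewrite big_ord_recl IHs mulrDr mulr_sumr expr1 mulrC; congr (_ + _).
by apply: eq_bigr => i _; rewrite /= mulrCA -exprS.
Qed.

(** The i-th entry is the binomial coefficient of 46 - i over 23; the expansion is symmetric in the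
    two forms. *)
Definition race_list := Eval vm_compute in race_weights 23 24.

Lemma race_weights_list : race_weights 23 24 = race_list.
Proof. by vm_compute. Qed.

Lemma race_residuals_list : race_residuals 23 24 = race_list.
Proof. by vm_compute. Qed.

Lemma size_race_list : size race_list = 24%N. Proof. by vm_compute. Qed.

Lemma race_list_expansion (L : fieldType) (a b t : L) :
  a != 0 -> b != 0 -> t != 0 -> a + b = t -> a^-1 ^+ 24 * b^-1 ^+ 24 =
  \sum_(i < 24) ofZ L (nth 0%BZ race_list i) * t ^+ i.+1 / t ^+ 48 *
    (a^-1 ^+ i.+1 + b^-1 ^+ i.+1).
Proof.
move=> a0 b0 t0 abt.
have u0 : a / t != 0 by rewrite mulf_neq0 ?invr_eq0.
have v0 : b / t != 0 by rewrite mulf_neq0 ?invr_eq0.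
have uv : a / t + b / t = 1 by rewrite -mulrDl abt divff.
have := pow_sum_races u0 v0 uv 23 24; rewrite race_residuals_list race_weights_list.
move: size_race_list; move: race_list => s ss; rewrite !pow_sumE ss -big_split.
rewrite !invf_div !exprMn mulrACA -exprD => E.
rewrite -[LHS](mulKf (expf_neq0 48 t0)) E mulr_sumr; apply: eq_bigr => i _.
rewrite -[X in _ * X]/(_ + _) !exprMn.
move: (ofZ _ _) (t ^+ i.+1) (a^-1 ^+ _) (b^-1 ^+ _) (t ^+ 48)^-1 => z ti ai bi t48.
ring.
Qed.

Definition race_weight i : rat := ofZ rat (nth 0%BZ race_list i) * 2 ^+ i.+1 / 2 ^+ 48.

Lemma integrand_nseq phi k s a :
  integrand phi (nseq k s ++ a) = (feval phi s)^-1 ^+ k * integrand phi a.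
Proof.
elim: k => [|k IHk]; first by rewrite mul1r.
by rewrite /= integrand_cons IHk exprS mulrA.
Qed.

Lemma tconst_ofZ n z : ofZ (tower n) z = tconst n (ofZ rat z).
Proof.
have nat_ k : k%:R = tconst n k%:R :> tower n.
  by elim: k => [|k IHk]; rewrite ?tconst0 // -!natr1 tconstD IHk tconst1.
rewrite /ofZ; case: (int_of_Z z) => k; first exact: nat_.
rewrite NegzE !mulrNz tconstN; congr (- _); exact: nat_ k.+1.
Qed.

Lemma flag_sum_extremes F a :
  flag_sum 4 F (nseq 24 (form_of all_above) ++ nseq 24 (form_of all_below) ++ a) =
  \sum_(i < 24) race_weight i * (flag_sum 4 F (nseq i.+1 (form_of all_above) ++ a) +
                                 flag_sum 4 F (nseq i.+1 (form_of all_below) ++ a)).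
Proof.
rewrite /flag_sum; under [RHS]eq_bigr do rewrite -big_split mulr_sumr.
rewrite exchange_big; apply: eq_bigr => phi _.
under eq_bigr do rewrite -[X in _ * X]/(_ + _) -iterresD -iterresZ.
rewrite -iterres_sum; congr iterres.
rewrite !integrand_nseq; under eq_bigr do rewrite !integrand_nseq -mulrDl.
set a1 := feval phi _; set b1 := feval phi _; set I := integrand _ _.
under eq_bigr do rewrite mulrA; rewrite -mulr_suml mulrA; congr (_ * _).
have two : tconst (size phi) 2 != 0 by rewrite tconst_eq0.
have a0 : a1 != 0 by rewrite (@feval_neq0 _ _ 0).
have b0 : b1 != 0 by rewrite (@feval_neq0 _ _ 0).
(* The forms 1 - (t_0 + ... + t_3) and 1 + (t_0 + ... + t_3) add up to 2. *)
have ab : a1 / tconst _ 2 + b1 / tconst _ 2 = 1.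
  rewrite -mulrDl -(@fevalD phi _ _ [:: 2]) => [|i _]; last first.
    by move: i => [|[|[|[|[|i]]]]] //=; rewrite ?nth_nil ?addr0 //; ring.
  rewrite (@fevalZ phi 2 [:: 1]) => [|[|i] _]; last 2 first.
  - by rewrite /= mulr1.
  - by rewrite /= !nth_nil mulr0.
  suff -> : feval phi [:: 1] = 1 by rewrite mulr1 divff.
  elim: phi {a1 b1 I two a0 b0} => [//|r phi IHphi].
  by rewrite feval_cons IHphi /= nth_nil tconst0 mul0r addr0 /fracL fracC1 fracC0 mul0r addr0.
have {}ab : a1 + b1 = tconst _ 2 by rewrite -[RHS]mul1r -ab mulrDl !divfK.
rewrite (race_list_expansion a0 b0 two ab); apply: eq_bigr => i _; congr (_ * _).
have p2 k : tconst (size phi) 2 ^+ k = tconst (size phi) (2 ^+ k).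
  by elim: k => [|k IHk]; rewrite ?tconst1 // !exprS IHk tconstM.
rewrite (p2 i.+1) (p2 48%N) tconst_ofZ -tconstV -!tconstM; exact: erefl.
Qed.

Lemma system_nseq n k f m :
  system n (nseq k f ++ m) = nseq k (form_of f) ++ system n m.
Proof. by rewrite /system map_cat map_nseq catA. Qed.

Lemma weighted_sum (A : comPzRingType) (w e x y a b c : A) :
  e * x = a -> e * y = b -> c = a + b -> w * c = e * (w * (x + y)).
Proof. by move=> <- <- ->; ring. Qed.

(** Partial fractions give, for each power, a system with only [all_above] and one with only
    [all_below]. The former is expanded by inclusion-exclusion, and the latter adds one more term V
    4, whence the coefficient 2. *)
Theorem has_value_condorcet (R : realType) (V : nat -> nat -> rat) :
  (forall j J, (j <= 4)%N -> (0 < J)%N -> has_value R j (with_below J) (V j J)) ->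
  has_value R 4 (condorcet_steps 4)
    (\sum_(i < 24) race_weight i * (V 0 i.+1 - 4%:R * V 1 i.+1 + 6%:R * V 2 i.+1
       - 4%:R * V 3 i.+1 + 2%:R * V 4 i.+1)).
Proof.
move=> HV; set all_steps := nseq 24 all_above ++ nseq 24 all_below ++ mixed_steps.
(* A single family of roots is fixed for all systems of the identity, so that their flag sums can be
   combined. *)
pose ms := all_steps :: map with_above (iota 1 24) ++ map with_below (iota 1 24).
have mixed4 s : positive_steps s -> positive_steps (s ++ mixed_steps) /\
    nonzero_coords 4 (s ++ mixed_steps).
  move=> ps; split=> [|i lti]; first by rewrite /positive_steps all_cat [all _ s]ps; vm_compute.
  by rewrite has_cat; apply/orP; right; move: i lti => [|[|[|[|//]]]] _; vm_compute.
have [|B aB HB] := @flag_formula_all R 4 ms.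
  move=> m; rewrite inE mem_cat => /or3P[/eqP->|/mapP[J _ ->]|/mapP[J _ ->]].
  - by rewrite /all_steps catA; apply: mixed4; vm_compute.
  - by apply: mixed4; rewrite /positive_steps all_nseq orbT.
  - by apply: mixed4; rewrite /positive_steps all_nseq orbT.
have {}HB := HB B aB (fun i _ r h => h).
have iJ (i : 'I_24) : i.+1 \in iota 1 24 by have := ltn_ord i; rewrite mem_iota; lia.
have msA (i : 'I_24) : with_above i.+1 \in ms.
  rewrite in_cons mem_cat; apply/orP; right; apply/orP; left; exact: map_f (iJ i).
have msB (i : 'I_24) : with_below i.+1 \in ms.
  rewrite in_cons mem_cat; apply/orP; right; apply/orP; right; exact: map_f (iJ i).
have main := HB _ (mem_head _ _).
have pos : positive_steps all_steps.
  by rewrite /all_steps catA; apply: (mixed4 _ _).1; vm_compute.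
have -> : \sum_(i < 24) race_weight i * (V 0 i.+1 - 4%:R * V 1 i.+1 + 6%:R * V 2 i.+1
       - 4%:R * V 3 i.+1 + 2%:R * V 4 i.+1) = signed_flag_sum 4 B all_steps.
  rewrite /signed_flag_sum /all_steps 2!system_nseq flag_sum_extremes [RHS]mulr_sumr.
  apply: eq_bigr => i _.
  have A : signed_flag_sum 4 B (with_above i.+1) =
      V 0 i.+1 - 4%:R * V 1 i.+1 + 6%:R * V 2 i.+1 - 4%:R * V 3 i.+1 + V 4 i.+1.
    apply: has_value_uniq (has_value_with_above (fun j lej => HV j i.+1 lej (ltn0Sn i))).
    exact: HB _ (msA i).
  have C : signed_flag_sum 4 B (with_below i.+1) = V 4 i.+1.
    apply: has_value_uniq (HV 4 i.+1 (leqnn 4) (ltn0Sn i)).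
    exact: HB _ (msB i).
  rewrite /signed_flag_sum system_nseq in A.
  rewrite /signed_flag_sum system_nseq in C.
  by apply: (weighted_sum _ A C); ring.
by apply: has_value_perm main; rewrite // perm_sym condorcet_steps_groups.
Qed.

(** * Which iterated residues vanish *)

(* Linear combinations of products of inverses of functions in [E], the      *)
(* number of factors being restricted to [Q].                                *)
Inductive fractions n (E : seq (seq rat)) (Q : nat -> Prop) : tower n -> Prop :=
| fractions0 : fractions E Q 0
| fractionsD f g : fractions E Q f -> fractions E Q g -> fractions E Q (f + g)
| fractionsZ c f : fractions E Q f -> fractions E Q (tconst n c * f)
| fractions_prod s : {subset s <= E} -> Q (size s) ->
    fractions E Q (\prod_(e <- s) (teval n e)^-1).

(** With the higher variables set to 0, the form is a nonzero multiple of e_k, so its inverse has a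
    pole at e_k = 0. *)
Definition leads k (e : seq rat) := (teval k e == 0) && (e`_k.+1 != 0).

Lemma fractions1 n E (Q : nat -> Prop) : Q 0%N -> @fractions n E Q 1.
Proof.
by move=> Q0; have := @fractions_prod n E Q [::]; rewrite big_nil; apply.
Qed.

Lemma fractionsV n E (Q Q' : nat -> Prop) e f : e \in E -> (forall k, Q k -> Q' k.+1) ->
  @fractions n E Q f -> fractions E Q' ((teval n e)^-1 * f).
Proof.
move=> eE QQ'; elim=> [|f1 f2 _ H1 _ H2|c f1 _ H1|s sE Qs].
- by rewrite mulr0; apply: fractions0.
- by rewrite mulrDr; apply: fractionsD.
- by rewrite mulrCA; apply: fractionsZ.
have -> : (teval n e)^-1 * (\prod_(x <- s) (teval n x)^-1) =
  \prod_(x <- e :: s) (teval n x)^-1 by rewrite big_cons.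
apply: fractions_prod; last exact: QQ'.
by move=> x; rewrite inE => /orP[/eqP->//|]; exact: sE.
Qed.

Lemma fractions_sub n E E' Q f : {subset E <= E'} -> @fractions n E Q f -> fractions E' Q f.
Proof.
move=> sub; elim=> [|f1 f2 _ H1 _ H2|c f1 _ H1|s sE Qs]; first exact: fractions0.
- exact: fractionsD.
- exact: fractionsZ.
by apply: fractions_prod => // x /sE/sub.
Qed.

Lemma pole_split (L : fieldType) (x u v p : L) N :
  x != 0 -> u != 0 -> u + v * x != 0 -> x ^- N.+1 * ((u + v * x)^-1 * p) =
  u^-1 * (x ^- N.+1 * p) - v / u * (x ^- N * ((u + v * x)^-1 * p)).
Proof.
move=> x0 u0 d0; rewrite exprS invfM.
have y0 : x ^+ N != 0 by rewrite expf_neq0.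
by move: (x ^+ N) y0 => y y0; field; rewrite x0 u0 d0 y0.
Qed.

Lemma pole_collect (L : fieldType) (x a c p : L) N :
  (a * x)^-1 * (c * (x ^- N * p)) = a^-1 * c * (x ^- N.+1 * p).
Proof. by rewrite exprS !invfM; ring. Qed.

Lemma factor_collect (L : fieldType) (x b c p : L) N :
  b^-1 * (c * (x ^- N * p)) = c * (x ^- N * (b^-1 * p)).
Proof. by ring. Qed.

(** Repeated use of [pole_split] either removes a factor regular at 0 or lowers the order of the
    pole. What remains are products of values at e_n = 0, with one factor less than before. *)
Lemma fractions_residue n E Q f : fractions E Q (f : tower n.+1) ->
  fractions [seq e <- E | teval n e != 0] (fun k => Q k.+1) (residue f).
Proof.
set E' := [seq e <- E | _].
have nonpole N s (P : nat -> Prop) : {subset s <= E'} -> P (N + size s)%N ->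
    fractions E' (fun k => P k.+1) (residue (fracX (tower n) ^- N *
      \prod_(e <- s) (fracL (teval n e) (tconst n e`_n.+1))^-1)).
  elim: s N P => [|e s IHs] N P sE.
    rewrite big_nil mulr1 residueXV addn0.
    by case: eqP => [->|_ _]; [exact: fractions1 | exact: fractions0].
  have eE : e \in E' by apply: sE; rewrite inE eqxx.
  have e0 : teval n e != 0 by move: eE; rewrite mem_filter => /andP[].
  have {}IHs M P' := IHs M P' (fun x xs => sE x (mem_behead (s := e :: s) xs)).
  elim: N P => [|N IHN] P PN.
    rewrite expr0 invr1 mul1r residue_prodL; first exact: fractions0.
    by apply/allP => x /sE; rewrite mem_filter => /andP[].
  have n0 : fracL (teval n e) (tconst n e`_n.+1) != 0 by rewrite fracL_eq0 negb_and e0.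
  have c0 : fracC (teval n e) != 0 by rewrite tofrac_neq0 ?polyC_eq0.
  rewrite big_cons (pole_split _ _ (fracX_neq0 _) c0 n0) -!fracCV -fracCM.
  rewrite residueB !residueZ -mulN1r -tconst1 -tconstN.
  have -> : (fracL (teval n e) (tconst n e`_n.+1))^-1 *
      \prod_(x <- s) (fracL (teval n x) (tconst n x`_n.+1))^-1 =
      \prod_(x <- e :: s) (fracL (teval n x) (tconst n x`_n.+1))^-1 by rewrite big_cons.
  apply: fractionsD.
    apply: (fractionsV eE _ (IHs N.+1 (fun k => P k.+1) _)) => //.
    by rewrite -addnS; exact: PN.
  apply: fractionsZ; rewrite -mulrA; apply: fractionsZ.
  apply: (fractionsV eE _ (IHN (fun k => P k.+1) _)) => //.
elim=> [|f1 f2 _ H1 _ H2|c f1 _ H1|s sE Qs].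
- by rewrite residue0; apply: fractions0.
- by rewrite residueD; apply: fractionsD.
- by rewrite /= residueZ; apply: fractionsZ.
(* The factors vanishing at e_n = 0 are collected into a power of e_n. *)
have [c [N [t [tE sz ->]]]] : exists c N t, [/\ {subset t <= E'}, (N + size t = size s)%N &
    \prod_(e <- s) (teval n.+1 e)^-1 = fracC (tconst n c) * (fracX (tower n) ^- N *
      \prod_(e <- t) (fracL (teval n e) (tconst n e`_n.+1))^-1)].
  elim: s sE {Qs} => [|e s IHs] sE.
    exists 1, 0%N, [::]; split=> //.
    by rewrite !big_nil tconst1 fracC1 expr0 invr1 !mulr1.
  have [x xs|c [N [t [tE sz E1]]]] := IHs; first by apply: sE; rewrite inE xs orbT.
  rewrite big_cons E1 /=; have [e0|e0] := eqVneq (teval n e) 0; last first.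
    exists c, N, (e :: t); split; [|by rewrite /= addnS sz|by rewrite big_cons factor_collect].
    move=> x; rewrite inE => /orP[/eqP->|/tE//]; rewrite mem_filter e0 sE ?mem_head //.
  exists ((e`_n.+1)^-1 * c), N.+1, t; split=> //; first by rewrite /= addSn sz.
  by rewrite e0 /fracL fracC0 add0r tconstM fracCM tconstV fracCV pole_collect.
by rewrite residueZ; apply: fractionsZ; apply: (nonpole _ _ Q tE); rewrite sz.
Qed.

Lemma residue_no_leader n E Q f : fractions E Q (f : tower n.+1) ->
  {in E, forall e, ~~ leads n e} -> residue f = 0.
Proof.
move=> H nl; elim: H => [|f1 f2 _ H1 _ H2|c f1 _ H1|s sE _].
- exact: residue0.
- by rewrite residueD H1 H2 addr0.
- by rewrite /= residueZ H1 mulr0.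
have [/allP/= s0|/allPn[e es]] := boolP (all (fun e => teval n e != 0) s).
  exact/residue_prodL/allP.
rewrite negbK => /eqP e0; suff -> : \prod_(x <- s) (teval n.+1 x)^-1 = 0 by exact: residue0.
apply/eqP; rewrite prodf_seq_eq0; apply/hasP; exists e; rewrite //= invr_eq0.
have := nl e (sE e es); rewrite /leads e0 eqxx negbK => /eqP ->.
by rewrite fracL_eq0 tconst0 !eqxx.
Qed.

(** The earlier residues only evaluate forms at zeros of the higher variables, so when e_k is
    reached a pole can come only from a form leading with e_k. *)
Lemma iterres_vanish n E Q f k : fractions E Q f -> (k < n)%N ->
  {in E, forall e, ~~ leads k e} -> iterres (f : tower n) = 0.
Proof.
elim: n E Q f => // n IHn E Q f Hf; rewrite ltnS leq_eqVlt => /orP[/eqP-> nl|ltk nl] /=.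
  by rewrite (residue_no_leader Hf nl) iterres0.
apply: (IHn _ _ _ (fractions_residue Hf) ltk) => e; rewrite mem_filter => /andP[_]; exact: nl.
Qed.

(** * The finitely many flags that contribute *)

Definition root_of n (s : seq rat) := mkseq (fun i => - s`_i / s`_n.+1) n.+1.

Definition roots_of n (a : seq (seq rat)) :=
  undup [seq root_of n s | s <- a & (s`_n.+1 != 0) && (0 < - s`_0 / s`_n.+1)].

Definition substitute n r (a : seq (seq rat)) :=
  undup [seq form_axpy n s`_n.+1 s r | s <- a].

(** The top entry must be the root of one of the forms, with positive constant term; the search
    continues with all forms restricted to this root. *)
Fixpoint poles n (a : seq (seq rat)) : seq (seq (seq rat)) :=
  if n is m.+1 then
    [seq r :: phi | r <- roots_of m a, phi <- poles m (substitute m r a)]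
  else [:: [::]].

Lemma poles_complete n F a phi : admissible F -> phi \in flags n F ->
  (forall k, (k < n)%N -> has (leads k) (map (subst phi) a)) -> phi \in poles n a.
Proof.
move=> aF; elim: n phi a => // n IHn phi a /allpairsP[[r psi] /= [rF psiF ->]] H.
have sz := size_flags psiF.
apply/allpairsPdep; exists r, psi; split=> //.
  have /hasP[_ /mapP[s sa ->]] := H n (ltnSn n).
  rewrite /leads /= sz nth_rcons size_subst sz ltnn eqxx => /andP[e0 sn].
  have {}e0 : feval psi (form_axpy n s`_n.+1 s r) = 0.
    apply/eqP; rewrite /feval sz -(eqP e0); apply/eqP; apply: eq_teval => i lei.
    by rewrite nth_rcons size_subst sz ltnS lei.
  have [szr r0] := proj2 (aF n) r rF.
  have E i : (i <= n)%N -> r`_i = - s`_i / s`_n.+1.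
    move=> lei; have : s`_i + s`_n.+1 * r`_i = 0.
      apply/eqP; rewrite -(nth_form_axpy _ _ _ lei); apply: contraTT isT => h.
      by move: (feval_neq0 (phi := psi) (leq_trans lei (eq_leq (esym sz))) h); rewrite e0 eqxx.
    by move=> /eqP; rewrite addrC addr_eq0 => /eqP Er; apply: (mulfI sn); rewrite Er mulrC divfK.
  rewrite mem_undup; apply/mapP; exists s; first by rewrite mem_filter sn sa -E // r0.
  apply: (@eq_from_nth _ 0); rewrite szr ?size_mkseq // => i lti.
  by rewrite nth_mkseq // E.
apply: IHn => // k ltk; have /hasP[_ /mapP[s sa ->] ls] := H k (ltnW ltk).
apply/hasP; exists (subst psi (form_axpy n s`_n.+1 s r)); first by apply: map_f; rewrite mem_undup; apply/mapP; exists s.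
move: ls; rewrite /leads /= sz nth_rcons size_subst sz ltnS ltk; congr (_ && _).
by congr (_ == _); apply: eq_teval => i lei; rewrite nth_rcons size_subst sz ltnS (leq_trans lei) // ltnW.
Qed.

Lemma sub_poles n a b : {subset a <= b} -> {subset poles n a <= poles n b}.
Proof.
elim: n a b => [|n IHn] a b ab phi; first by [].
case/allpairsPdep => r [psi []]; rewrite mem_undup => /mapP[s].
rewrite mem_filter => /andP[s0 sa] -> psiP ->; apply/allpairsPdep.
exists (root_of n s), psi; split=> //; first by rewrite mem_undup; apply/mapP; exists s; rewrite // mem_filter s0 ab.
apply: IHn psiP => x; rewrite !mem_undup => /mapP[t ta ->].
by apply: map_f; apply: ab.
Qed.

Lemma iterres_integrand_vanish n F a phi : admissible F -> phi \in flags n F ->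
  phi \notin poles n a -> iterres (integrand phi a) = 0.
Proof.
move=> aF pF npole; have sz := size_flags pF.
have [k ltk nl] : exists2 k, (k < n)%N & ~~ has (leads k) (map (subst phi) a).
  apply: contrapT => H; move/negP: npole; apply; apply: poles_complete aF pF _ => k ltk.
  by apply: contrapT => /negP nl; apply: H; exists k.
apply: (@iterres_vanish _ (map (subst phi) a) (fun=> True) _ k); rewrite ?sz //.
  rewrite /integrand -(big_map (subst phi) xpredT (fun e => (teval _ e)^-1)).
  exact: fractions_prod.
by move=> e eE; apply: contra nl => le; apply/hasP; exists e.
Qed.

Fixpoint is_flag n (phi : seq (seq rat)) : bool :=
  match n, phi with
  | 0, [::] => true
  | m.+1, r :: psi => [&& size r == n, 0 < r`_0 & is_flag m psi]
  | _, _ => false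
  end.

Lemma mem_flags n F phi : is_flag n phi ->
  {in phi, forall r, r \in F (size r).-1} -> phi \in flags n F.
Proof.
elim: n phi => [|n IHn] [|r psi] //= /and3P[/eqP sr _ fpsi] H.
apply/allpairsP; exists (r, psi); split=> //.
  by have := H r (mem_head _ _); rewrite sr.
by apply: IHn => // s spsi; apply: H; rewrite inE spsi orbT.
Qed.

Lemma is_flagP n phi r : is_flag n phi -> r \in phi -> (0 < size r)%N && (0 < r`_0).
Proof.
elim: n phi => [|n IHn] [|s psi] //= /and3P[/eqP ss s0 fpsi].
by rewrite inE => /orP[/eqP->|/(IHn _ fpsi)//]; rewrite ss s0.
Qed.

(** Flags outside [poles] have residue 0, so any duplicate-free list of flags containing them gives
    the value. *)
Theorem has_value_poles (R : realType) n m L : positive_steps m -> nonzero_coords n m ->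
  uniq L -> all (is_flag n) L -> {subset poles n (system n m) <= L} ->
  has_value R n m ((-1) ^+ n * \sum_(phi <- L) iterres (integrand phi (system n m))).
Proof.
move=> pos nz uL fL sub; have [B aB HB] := flag_formula_value R pos nz.
(* The entries of the flags in [L] are added to the family, so that all of [L] occurs in the flag
   sum. *)
pose F i := undup (B i ++ [seq r <- flatten L | size r == i.+1]).
have aF : admissible F.
  move=> i; split=> [|r]; first exact: undup_uniq.
  rewrite mem_undup mem_cat => /orP[/(proj2 (aB i))//|].
  rewrite mem_filter => /andP[/eqP sr /flattenP[phi phiL rphi]]; split=> //.
  by have /andP[] := is_flagP (allP fL phi phiL) rphi.
have subF i : (i < n)%N -> {subset B i <= F i}.
  by move=> _ r rB; rewrite mem_undup mem_cat rB.
have := HB F aF subF; rewrite /signed_flag_sum.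
have uF : uniq (flags n F).
  elim: {m pos nz sub HB fL subF} n => // n IHn /=; apply: allpairs_uniq => //.
    exact: (aF n).1.
  by move=> [x1 x2] [y1 y2] _ _ /= [-> ->].
have LF : {subset L <= flags n F}.
  move=> phi phiL; apply: mem_flags (allP fL phi phiL) _ => r rphi.
  have /andP[sr _] := is_flagP (allP fL phi phiL) rphi.
  rewrite mem_undup mem_cat mem_filter prednK // eqxx; apply/orP; right.
  by apply/flattenP; exists phi.
have -> : flag_sum n F (system n m) = \sum_(phi <- L) iterres (integrand phi (system n m)).
  rewrite /flag_sum (bigID (mem L)) /= [X in _ + X]big_seq_cond [X in _ + X]big1 ?addr0.
    rewrite -big_filter; apply: perm_big; apply: uniq_perm => //; first exact: filter_uniq.
    move=> phi; rewrite mem_filter; apply/andP/idP => [[]//|phiL]; split=> //; exact: LF.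
  move=> phi /andP[pF pL]; apply: iterres_integrand_vanish aF pF _.
  by apply: contra pL => /sub.
by [].
Qed.

(** * Integer arithmetic in base 64 *)

Inductive digit := d0 | d1 | d2 | d3 | d4 | d5 | d6 | d7 | d8 | d9 | d10 | d11 | d12 | d13 | d14
    | d15 | d16 | d17 | d18 | d19 | d20 | d21 | d22 | d23 | d24 | d25 | d26 | d27 | d28 | d29 |
    d30 | d31 | d32 | d33 | d34 | d35 | d36 | d37 | d38 | d39 | d40 | d41 | d42 | d43 | d44 |
    d45 | d46 | d47 | d48 | d49 | d50 | d51 | d52 | d53 | d54 | d55 | d56 | d57 | d58 | d59 |
    d60 | d61 | d62 | d63.

Definition digit_value (d : digit) : Z := match d with d0 => 0 | d1 => 1 | d2 => 2 | d3 => 3 |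
    d4 => 4 | d5 => 5 | d6 => 6 | d7 => 7 | d8 => 8 | d9 => 9 | d10 => 10 | d11 => 11 | d12 =>
    12 | d13 => 13 | d14 => 14 | d15 => 15 | d16 => 16 | d17 => 17 | d18 => 18 | d19 => 19 | d20
    => 20 | d21 => 21 | d22 => 22 | d23 => 23 | d24 => 24 | d25 => 25 | d26 => 26 | d27 => 27 |
    d28 => 28 | d29 => 29 | d30 => 30 | d31 => 31 | d32 => 32 | d33 => 33 | d34 => 34 | d35 =>
    35 | d36 => 36 | d37 => 37 | d38 => 38 | d39 => 39 | d40 => 40 | d41 => 41 | d42 => 42 | d43
    => 43 | d44 => 44 | d45 => 45 | d46 => 46 | d47 => 47 | d48 => 48 | d49 => 49 | d50 => 50 |
    d51 => 51 | d52 => 52 | d53 => 53 | d54 => 54 | d55 => 55 | d56 => 56 | d57 => 57 | d58 =>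
    58 | d59 => 59 | d60 => 60 | d61 => 61 | d62 => 62 | d63 => 63 end%BZ.

Definition to_digit (z : Z) : digit := match z with 1 => d1 | 2 => d2 | 3 => d3 | 4 => d4 | 5 =>
    d5 | 6 => d6 | 7 => d7 | 8 => d8 | 9 => d9 | 10 => d10 | 11 => d11 | 12 => d12 | 13 => d13 |
    14 => d14 | 15 => d15 | 16 => d16 | 17 => d17 | 18 => d18 | 19 => d19 | 20 => d20 | 21 =>
    d21 | 22 => d22 | 23 => d23 | 24 => d24 | 25 => d25 | 26 => d26 | 27 => d27 | 28 => d28 | 29
    => d29 | 30 => d30 | 31 => d31 | 32 => d32 | 33 => d33 | 34 => d34 | 35 => d35 | 36 => d36 |
    37 => d37 | 38 => d38 | 39 => d39 | 40 => d40 | 41 => d41 | 42 => d42 | 43 => d43 | 44 =>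
    d44 | 45 => d45 | 46 => d46 | 47 => d47 | 48 => d48 | 49 => d49 | 50 => d50 | 51 => d51 | 52
    => d52 | 53 => d53 | 54 => d54 | 55 => d55 | 56 => d56 | 57 => d57 | 58 => d58 | 59 => d59 |
    60 => d60 | 61 => d61 | 62 => d62 | 63 => d63 | _ => d0 end%BZ.

Definition tabulate T (f : digit -> T) (d : digit) : T := match d with d0 => f d0 | d1 => f d1 |
    d2 => f d2 | d3 => f d3 | d4 => f d4 | d5 => f d5 | d6 => f d6 | d7 => f d7 | d8 => f d8 |
    d9 => f d9 | d10 => f d10 | d11 => f d11 | d12 => f d12 | d13 => f d13 | d14 => f d14 | d15
    => f d15 | d16 => f d16 | d17 => f d17 | d18 => f d18 | d19 => f d19 | d20 => f d20 | d21 =>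
    f d21 | d22 => f d22 | d23 => f d23 | d24 => f d24 | d25 => f d25 | d26 => f d26 | d27 => f
    d27 | d28 => f d28 | d29 => f d29 | d30 => f d30 | d31 => f d31 | d32 => f d32 | d33 => f
    d33 | d34 => f d34 | d35 => f d35 | d36 => f d36 | d37 => f d37 | d38 => f d38 | d39 => f
    d39 | d40 => f d40 | d41 => f d41 | d42 => f d42 | d43 => f d43 | d44 => f d44 | d45 => f
    d45 | d46 => f d46 | d47 => f d47 | d48 => f d48 | d49 => f d49 | d50 => f d50 | d51 => f
    d51 | d52 => f d52 | d53 => f d53 | d54 => f d54 | d55 => f d55 | d56 => f d56 | d57 => f
    d57 | d58 => f d58 | d59 => f d59 | d60 => f d60 | d61 => f d61 | d62 => f d62 | d63 => f
    d63 end.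

(* Integers in base 64, the least digit first, ending with infinitely many   *)
(* digits 0 or infinitely many digits 63. The operations on digits are       *)
(* tabulated, since [Z] is too slow for the lazy reduction of the kernel.    *)
Inductive num := Zero | Minus | Dig of digit & num.

Fixpoint value (x : num) : Z :=
  match x with
  | Zero => 0
  | Minus => -1
  | Dig d r => Z.add (digit_value d) (Z.mul 64 (value r))
  end%BZ.

Definition bool_value (c : bool) : Z := if c then 1%BZ else 0%BZ.

Definition add_spec (p : digit * digit * bool) : digit * bool :=
  let s := Z.add (digit_value p.1.1) (Z.add (digit_value p.1.2) (bool_value p.2)) in
  (to_digit (Z.modulo s 64), Z.leb 64 s).

Definition add_digit : digit -> digit -> bool -> digit * bool := Eval vm_compute in
  tabulate (fun a => tabulate (fun b c => if c then add_spec (a, b, true) else add_spec (a, b, false))).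

Lemma add_digitE a b c :
  Z.add (digit_value a) (Z.add (digit_value b) (bool_value c)) =
  Z.add (digit_value (add_digit a b c).1) (Z.mul 64 (bool_value (add_digit a b c).2)).
Proof. by case: a; case: b; case: c. Qed.

(** One operand has run out: its remaining digits are all 0 or all 63, so it is worth 0 or -1. If
    [s] equals [c], it cancels with the carry. *)
Fixpoint add_end (s c : bool) (y : num) : num :=
  if eqb s c then y else
  match y with
  | Zero => if c then Dig d1 Zero else Minus
  | Minus => if c then Zero else Dig d62 Minus
  | Dig d r => let: (e, c') := add_digit d (if s then d63 else d0) c in Dig e (add_end s c' r)
  end.

Fixpoint add_num (c : bool) (x y : num) : num :=
  match x with
  | Zero => add_end false c y
  | Minus => add_end true c y
  | Dig a x' => match y with
    | Zero => add_end false c x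
    | Minus => add_end true c x
    | Dig b y' => let: (e, c') := add_digit a b c in Dig e (add_num c' x' y')
    end
  end.

Lemma value_Dig d r : value (Dig d r) = Z.add (digit_value d) (Z.mul 64 (value r)).
Proof. by []. Qed.

Lemma value_ends : (value Zero = Z0) * (value Minus = Zneg xH) *
  (bool_value false = Z0) * (bool_value true = Zpos xH).
Proof. by []. Qed.

Lemma value_add_end s c y :
  value (add_end s c y) = Z.sub (Z.add (value y) (bool_value c)) (bool_value s).
Proof.
elim: y c => [||d r IH] c.
- by case: s; case: c.
- by case: s; case: c.
have -> : add_end s c (Dig d r) = if eqb s c then Dig d r else
  let: (e, c') := add_digit d (if s then d63 else d0) c in Dig e (add_end s c' r) by [].
case: ifP => [/eqP ->|_]; first by lia.
have := add_digitE d (if s then d63 else d0) c.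
have -> : digit_value (if s then d63 else d0) = Z.mul 63 (bool_value s) by case: s {IH}.
case: (add_digit _ _ _) => e c'; rewrite [(e, c').1]/= [(e, c').2]/= => E.
rewrite !value_Dig IH; move: (bool_value s) (bool_value c) (bool_value c') E => x y z; lia.
Qed.

Lemma value_add c x y : value (add_num c x y) = Z.add (value x) (Z.add (value y) (bool_value c)).
Proof.
elim: x y c => [||a x IH] y c.
- by rewrite [LHS]value_add_end !value_ends; lia.
- by rewrite [LHS]value_add_end !value_ends; lia.
case: y => [||b y].
- by rewrite [LHS]value_add_end !value_ends; lia.
- by rewrite [LHS]value_add_end !value_ends; lia.
have -> : add_num c (Dig a x) (Dig b y) =
  let: (e, c') := add_digit a b c in Dig e (add_num c' x y) by [].
have := add_digitE a b c; case: (add_digit _ _ _) => e c'; rewrite [(e, c').1]/= [(e, c').2]/= => E.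
rewrite !value_Dig IH; move: (bool_value c) (bool_value c') E => u v; lia.
Qed.

Inductive multiplier := M2 | M3 | M4 | M6 | N1 | N2 | N3 | N4 | N6.

Definition multiplier_value m : Z :=
  match m with M2 => 2 | M3 => 3 | M4 => 4 | M6 => 6
  | N1 => -1 | N2 => -2 | N3 => -3 | N4 => -4 | N6 => -6 end%BZ.

Inductive carry := c0 | c1 | c2 | c3 | c4 | c5 | c6.

Definition carry_index (t : carry) : Z :=
  match t with c0 => 0 | c1 => 1 | c2 => 2 | c3 => 3 | c4 => 4 | c5 => 5 | c6 => 6 end%BZ.

Definition to_carry (z : Z) : carry :=
  match z with 1 => c1 | 2 => c2 | 3 => c3 | 4 => c4 | 5 => c5 | 6 => c6 | _ => c0 end%BZ.

(** The index standing for carry 0: multiplication by a negative number has negative carries, which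
    are stored shifted by this amount. *)
Definition start m : carry :=
  match m with N1 => c1 | N2 => c2 | N3 => c3 | N4 => c4 | N6 => c6 | _ => c0 end.

Definition carry_value m t : Z := Z.sub (carry_index t) (carry_index (start m)).

(* The carries of a multiplication by [m] range from 0 to [m - 1] if [m] is  *)
(* positive and from [m] to 0 if it is negative.                             *)
Definition valid_carry m t : bool :=
  Z.leb (carry_index t) (Z.max (Z.sub (multiplier_value m) 1) (carry_index (start m))).

Definition mul_spec (p : multiplier * digit * carry) : digit * carry :=
  let s := Z.add (Z.mul (multiplier_value p.1.1) (digit_value p.1.2)) (carry_value p.1.1 p.2) in
  (to_digit (Z.modulo s 64), to_carry (Z.add (Z.div s 64) (carry_index (start p.1.1)))).

Definition tabulate_carry T (f : carry -> T) (t : carry) : T :=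
  match t with c0 => f c0 | c1 => f c1 | c2 => f c2 | c3 => f c3 | c4 => f c4 | c5 => f c5 | c6 => f c6 end.

Definition tabulate_multiplier T (f : multiplier -> T) (m : multiplier) : T :=
  match m with M2 => f M2 | M3 => f M3 | M4 => f M4 | M6 => f M6 | N1 => f N1
  | N2 => f N2 | N3 => f N3 | N4 => f N4 | N6 => f N6 end.

Definition mul_digit : multiplier -> digit -> carry -> digit * carry := Eval vm_compute in
  tabulate_multiplier (fun m => tabulate (fun d => tabulate_carry (fun t => mul_spec (m, d, t)))).

Lemma mul_digitE m d t : valid_carry m t ==>
  Z.eqb (Z.add (Z.mul (multiplier_value m) (digit_value d)) (carry_value m t))
    (Z.add (digit_value (mul_digit m d t).1) (Z.mul 64 (carry_value m (mul_digit m d t).2))) &&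
  valid_carry m (mul_digit m d t).2.
Proof. by case: m; case: d; case: t. Qed.

Definition small_num (v : Z) : num :=
  if Z.eqb v 0 then Zero else if Z.eqb v (-1) then Minus
  else if Z.leb 0 v then Dig (to_digit v) Zero else Dig (to_digit (Z.add 64 v)) Minus.

Definition end_spec (p : multiplier * bool * carry) : num :=
  small_num (Z.sub (carry_value p.1.1 p.2) (Z.mul (multiplier_value p.1.1) (bool_value p.1.2))).

Definition mul_end : multiplier -> bool -> carry -> num := Eval vm_compute in
  tabulate_multiplier (fun m s => if s then tabulate_carry (fun t => end_spec (m, true, t))
    else tabulate_carry (fun t => end_spec (m, false, t))).

Lemma mul_endE m s t : valid_carry m t ==> Z.eqb (value (mul_end m s t))
  (Z.sub (carry_value m t) (Z.mul (multiplier_value m) (bool_value s))).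
Proof. by case: m; case: s; case: t. Qed.

Fixpoint mul_num m t (x : num) : num :=
  match x with
  | Zero => mul_end m false t
  | Minus => mul_end m true t
  | Dig d r => let: (e, t') := mul_digit m d t in Dig e (mul_num m t' r)
  end.

Lemma value_mul m t x : valid_carry m t ->
  value (mul_num m t x) = Z.add (Z.mul (multiplier_value m) (value x)) (carry_value m t).
Proof.
elim: x t => [||d r IH] t vt.
- have := mul_endE m false t; rewrite vt implyTb => /Z.eqb_spec.
  have -> : mul_num m t Zero = mul_end m false t by [].
  rewrite !value_ends => ->.
  by move: (multiplier_value m) (carry_value m t); lia.
- have := mul_endE m true t; rewrite vt implyTb => /Z.eqb_spec.
  have -> : mul_num m t Minus = mul_end m true t by [].
  rewrite !value_ends => ->.
  by move: (multiplier_value m) (carry_value m t); lia.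
have := mul_digitE m d t; rewrite vt implyTb.
have -> : mul_num m t (Dig d r) =
  let: (e, t') := mul_digit m d t in Dig e (mul_num m t' r) by [].
case: (mul_digit _ _ _) => e t'; rewrite [(e, t').1]/= [(e, t').2]/= => /andP[/Z.eqb_spec E vt'].
rewrite !value_Dig (IH _ vt').
move: (multiplier_value m) (carry_value m t) (carry_value m t') (value r) E => x y z u E.
have -> : Z.mul x (Z.add (digit_value d) (Z.mul 64 u)) =
  Z.add (Z.mul x (digit_value d)) (Z.mul 64 (Z.mul x u)) by rewrite Z.mul_add_distr_l Z.mul_shuffle3.
by move: (Z.mul x (digit_value d)) (Z.mul x u) E => xd xu; lia.
Qed.

Definition multiplier_of (z : Z) : option multiplier :=
  match z with
  | 2 => Some M2 | 3 => Some M3 | 4 => Some M4 | 6 => Some M6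
  | -1 => Some N1 | -2 => Some N2 | -3 => Some N3 | -4 => Some N4 | -6 => Some N6
  | _ => None
  end%BZ.

Lemma multiplier_ofE z m : multiplier_of z = Some m -> multiplier_value m = z.
Proof.
rewrite /multiplier_of; repeat (match goal with |- context [match ?x with _ => _ end] =>
  match type of x with positive => destruct x | Z => destruct x end end; try discriminate);
  by move=> [<-].
Qed.

(** Computes a - k p. The coefficient -1 needs one addition, the tabulated multipliers one product,
    and all others repeated addition. *)
Definition sub_mul (k : Z) (a p : num) : num :=
  match k with
  | Z0 => a
  | Zneg xH => add_num false a p
  | _ => if multiplier_of (Z.opp k) is Some m then add_num false a (mul_num m (start m) p)
    else match k with
      | Zpos q => iter (Pos.to_nat q) (fun b => add_num false b (mul_num N1 c1 p)) a
      | Zneg q => iter (Pos.to_nat q) (fun b => add_num false b p) a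
      | Z0 => a
      end
  end.

Lemma value_sub_mul k a p : value (sub_mul k a p) = Z.sub (value a) (Z.mul k (value p)).
Proof.
have iterE y s j : value y = s -> value (iter j (fun b => add_num false b y) a) =
    Z.add (value a) (Z.mul (Z.of_nat j) s).
  move=> E; elim: j => [|j IH]; first by rewrite [iter _ _ _]/=; lia.
  by rewrite iterS value_add IH E !value_ends; move: (value a) => x; lia.
have fast m : multiplier_value m = Z.opp k ->
    value (add_num false a (mul_num m (start m) p)) = Z.sub (value a) (Z.mul k (value p)).
  move=> mE; rewrite value_add value_mul ?mE; last by case: (m).
  rewrite !value_ends /carry_value; move: (carry_index _) (value a) (value p) => x y z; lia.
have neg1 : value (mul_num N1 c1 p) = Z.opp (value p).
  rewrite value_mul //; have -> : carry_value N1 c1 = Z0 by [].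
  by have -> : multiplier_value N1 = Zneg xH by []; move: (value p) => x; lia.
case: k fast => [|q|q] fast; first by rewrite [sub_mul _ _ _]/=; move: (value a) (value p) => x y; lia.
  rewrite /sub_mul; case E: multiplier_of => [m|]; first exact: fast (multiplier_ofE E).
  by rewrite (iterE _ _ _ neg1); move: (value a) (value p) => x y; lia.
have slow : value (iter (Pos.to_nat q) (fun b => add_num false b p) a) =
    Z.sub (value a) (Z.mul (Zneg q) (value p)) 
  by rewrite (iterE _ _ _ (erefl _)); move: (value a) (value p) => x y; lia.
have generic : value (if multiplier_of (Z.opp (Zneg q)) is Some m then
    add_num false a (mul_num m (start m) p)
    else iter (Pos.to_nat q) (fun b => add_num false b p) a) =
    Z.sub (value a) (Z.mul (Zneg q) (value p)).
  by case E: multiplier_of => [m|]; [exact: fast (multiplier_ofE E) | exact: slow].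
case: q {slow fast} generic => [q|q|] generic; [exact: generic | exact: generic |].
by rewrite /sub_mul value_add !value_ends; move: (value a) (value p) => x y; lia.
Qed.

Fixpoint to_num fuel (z : Z) : num :=
  if fuel is n.+1 then
    if Z.eqb z 0 then Zero else if Z.eqb z (-1) then Minus
    else Dig (to_digit (Z.modulo z 64)) (to_num n (Z.div z 64))
  else Zero.

Definition literal (z : Z) : num := to_num 40 z.

Arguments literal : simpl never.

Definition represented (z : Z) : bool := value (literal z) == z.

(** * Tables of residues and their recursion *)

Fixpoint array n : Type := if n is m.+1 then seq (array m) else num.

Fixpoint array_sub n (k : Z) : array n -> array n -> array n :=
  if n is m.+1 return array n -> array n -> array n then
    fix rows (A P : seq (array m)) := match A, P with
      | a :: A', p :: P' => array_sub k a p :: rows A' P'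
      | _, _ => [::]
      end
  else sub_mul k.

(* One division: given the table of the values [g M], compute the table of   *)
(* the [g' M] with [g M = g' (M - d) + sum_j k_j g' (M - e_j)], where [d] is *)
(* [0] if there are as many coefficients [k_j] as dimensions, and otherwise  *)
(* the first unit vector [e_j] without a coefficient.                        *)
Fixpoint pass n (ks : seq Z) : array n -> array n :=
  if n is m.+1 return array n -> array n then
    if ks is k :: ks' then
      if k is Z0 then map (@pass m ks') else
      fun A => if A is a :: A' then
        let b := pass ks' a in
        b :: (fix rows (prev : array m) (A : seq (array m)) :=
          if A is a :: A' then
            let b := pass ks' (array_sub k a prev) in b :: rows b A'
          else [::]) b A'
      else [::]
    else behead
  else id.

Fixpoint add_head n (z : Z) : array n -> array n :=
  if n is m.+1 return array n -> array n then
    fun A => if A is a :: A' then add_head z a :: A' else [::]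
  else fun a => add_num false a (literal z).

(* The number of entries in a row decreases with the positions [idx] of the  *)
(* row in the outer dimensions: each dimension has a size and weights for    *)
(* these positions.                                                          *)
Fixpoint zeros n (dims : seq (nat * seq nat)) (idx : seq nat) : array n :=
  if n is m.+1 return array n then
    let d := head (0%N, [::]) dims in
    mkseq (fun i => zeros m (behead dims) (rcons idx i))
      (d.1 - sumn [seq (p.1 * p.2)%N | p <- zip d.2 idx])
  else Zero.

Fixpoint entry n : array n -> seq nat -> option Z :=
  if n is m.+1 return array n -> seq nat -> option Z then
    fun A M => if M is i.+1 :: M' then
      if drop i A is a :: _ then entry a M' else None
    else None
  else fun a _ => Some (value a).

Fixpoint represents_rows T (P : T -> (seq nat -> rat) -> Prop) i (A : seq T) g : Prop :=
  if A is a :: A' then P a (fun M => g (i :: M)) /\ represents_rows P i.+1 A' g else True.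

(** Positions start at 1, as the exponents do, and only stored entries are constrained, so tables
    may be ragged. *)
Fixpoint represents n : array n -> (seq nat -> rat) -> Prop :=
  if n is m.+1 return array n -> (seq nat -> rat) -> Prop then
    represents_rows (@represents m) 1
  else fun a g => g [::] = ofZ rat (value a).

Lemma eq_represents n (A : array n) g h :
  (forall M, size M = n -> all (leq 1) M -> g M = h M) ->
  represents A g -> represents A h.
Proof.
elim: n A g h => [|n IHn] A g h E; first by rewrite /= E.
suff gen i B : (0 < i)%N -> represents_rows (@represents n) i B g -> represents_rows (@represents n) i B h by exact: gen.
elim: B i => //= a B IHB i i0 [ra rB]; split; last exact: IHB.
by apply: IHn ra => M sM M0; apply: E; rewrite /= ?sM // i0 M0.
Qed.

Lemma represents_entry n (A : array n) g M z : represents A g ->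
  size M = n -> entry A M = Some z -> g M = ofZ rat z.
Proof.
elim: n A g M => [|n IHn] A g [|i M] //=; first by move=> -> _ [->].
case: i => // i rA [sM].
suff gen j B : represents_rows (@represents n) j B g ->
    (if drop i B is a :: _ then entry a M else None) = Some z -> g (i + j :: M)%N = ofZ rat z.
  by rewrite -addn1; apply: gen rA.
elim: i B j {rA} => [|i IHi] [|a B] j //= [ra rB].
  exact: (IHn _ (fun M => g (j :: M))).
by rewrite addSnnS; apply: IHi.
Qed.

Lemma represents_sub n k (A P : array n) g h : represents A g -> represents P h ->
  represents (array_sub k A P) (fun M => g M - ofZ rat k * h M).
Proof.
elim: n A P g h => [|n IHn] A P g h /=.
  move=> -> ->; rewrite value_sub_mul -ofZM.
  have -> : Z.sub (value A) (Z.mul k (value P)) = Z.add (value A) (Z.opp (Z.mul k (value P))) by lia.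
  by rewrite ofZD /ofZ raddfN mulrNz.
move: (1%N); elim: A P => [|a A IHA] [|p P] i //= [ra rA] [rp rP].
by split; [exact: IHn ra rp | exact: IHA].
Qed.

Lemma represents_zeros n dims idx : represents (zeros n dims idx) (fun=> 0).
Proof.
elim: n dims idx => [|n IH] dims idx //=; rewrite /mkseq; move: (iota 0 _) (1%N).
by elim=> //= k s IHs i; split.
Qed.

Lemma represents_add_head n z (A : array n) g : represented z -> represents A g ->
  represents (add_head z A) (fun M => g M + ofZ rat z * (all (eq_op 1%N) M)%:R).
Proof.
move=> /eqP zE; elim: n A g => [|n IHn] A g /=.
  by move=> ->; rewrite value_add zE value_ends ofZD ofZD [ofZ rat Z0]ofZ0 addr0 mulr1.
case: A => //= a A [ra rA]; split; first exact: IHn.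
suff gen i B : (1 < i)%N -> represents_rows (@represents n) i B g -> represents_rows (@represents n) i B
    (fun M => g M + ofZ rat z * (all (eq_op 1%N) M)%:R) by exact: gen.
elim: B i => //= b B IHB i i2 [rb rB]; split; last by apply: IHB => //; exact: leqW.
by apply: eq_represents rb => M _ _; rewrite /= ltn_eqF //= mulr0 addr0.
Qed.

(** [g] is [h] with one linear factor multiplied back. Where a coefficient is nonzero, [h] must
    vanish at exponent 0, so that the first row has no predecessor. *)
Fixpoint pass_relation n (ks : seq Z) (g h : seq nat -> rat) : Prop :=
  if n is m.+1 then
    if ks is k :: ks' then
      (k = Z0 \/ forall M, h (0%N :: M) = 0) /\
      forall i, pass_relation m ks' (fun M => g (i.+1 :: M) - ofZ rat k * h (i :: M))
                                    (fun M => h (i.+1 :: M))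
    else forall i M, g (i.+2 :: M) = h (i.+1 :: M)
  else g [::] = h [::].

Lemma represents_pass n ks (A : array n) g h :
  pass_relation n ks g h -> represents A g -> represents (pass ks A) h.
Proof.
elim: n ks A g h => [|n IHn] ks A g h; first by move=> /= ->.
case: ks => [|k ks].
  move=> R; case: A => // a A [_]; change (represents_rows (@represents n) 2 A g -> represents_rows (@represents n) 1 A h).
  move: (0%N); elim: A => //= b A IHA i [rb rA]; split; last exact: IHA.
  by apply: eq_represents rb => M _ _; rewrite R.
move=> [k0 R]; have step i (a : array n) : represents a (fun M => g (i.+1 :: M) - ofZ rat k * h (i :: M)) ->
  represents (pass ks a) (fun M => h (i.+1 :: M)) by exact: IHn (R i).
have gen (B : seq (array n)) i prev : represents prev (fun M => h (i.+1 :: M)) ->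
    represents_rows (@represents n) i.+2 B g -> represents_rows (@represents n) i.+2
      ((fix rows (prev : array n) (A : seq (array n)) :=
          if A is a :: A' then
            let b := pass ks (array_sub k a prev) in b :: rows b A'
          else [::]) prev B) h.
  elim: B i prev => //= b B IHB i prev rp [rb rB].
  have rb' := step _ _ (represents_sub k rb rp); split; first exact: rb'.
  exact: IHB rb' rB.
have first_row (a : array n) : represents a (fun M => g (1%N :: M)) ->
    represents (pass ks a) (fun M => h (1%N :: M)).
  move=> ra; apply: step; apply: eq_represents ra => M _ _.
  by case: k0 => [->|->]; rewrite ?ofZ0 ?mul0r ?mulr0 subr0.
have zero_case : k = Z0 -> represents_rows (@represents n) 1 A g -> represents_rows (@represents n) 1 (map (pass ks) A) h.
  move=> kE; move: (0%N); elim: A => //= a A IHA i [ra rA]; split; last exact: IHA.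
  by apply: step; apply: eq_represents ra => M _ _; rewrite kE ofZ0 mul0r subr0.
have other_case : represents_rows (@represents n) 1 A g -> represents_rows (@represents n) 1
    (if A is a :: A' then let b := pass ks a in b ::
      (fix rows (prev : array n) (A : seq (array n)) :=
          if A is a :: A' then
            let b := pass ks (array_sub k a prev) in b :: rows b A'
          else [::]) b A' else [::]) h.
  case: (A) => //= a B [ra rB]; split; first exact: first_row.
  exact: gen (first_row _ ra) rB.
by case: k {k0 R step gen first_row} zero_case other_case => [zc _|p _ oc|p _ oc]; [exact: zc | exact: oc | exact: oc].
Qed.

(** * Division by a linear combination of the pivots *)

(* The Laurent monomial with exponents [- M_i].                              *)
Fixpoint mono (L : fieldType) (xs : seq L) (M : seq nat) : L :=
  if xs is x :: xs' then x ^- (head 0%N M) * mono xs' (behead M) else 1.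

(* [1 + sum_j k_j x_j] if there are enough coefficients, and otherwise       *)
(* [x_j + sum_(i < j) k_i x_i], where [x_j] is the first variable without a  *)
(* coefficient.                                                              *)
Fixpoint comb (L : fieldType) (xs : seq L) (ks : seq Z) : L :=
  match xs, ks with
  | [::], _ => 1
  | x :: _, [::] => x
  | x :: xs', k :: ks' => ofZ L k * x + comb xs' ks'
  end.

Section PassRelation.
Variables (L : fieldType) (phi : L -> rat).
Hypothesis phiD : {morph phi : f g / f + g}.
Hypothesis phiZ : forall k f, phi (ofZ L k * f) = ofZ rat k * phi f.

Let shift_exponent (f x m : L) i : x != 0 -> f * x * (x ^- i.+2 * m) = f * (x ^- i.+1 * m).
Proof.
move=> x0; rewrite exprS invfM; move: (x ^- i.+1) => y; rewrite -(mulrA f x) [x * _]mulrA.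
by rewrite [x * (_ * _)]mulrA divff // mul1r.
Qed.

Let split_factor (f k x c m : L) i : x != 0 ->
  f * (k * x + c) * (x ^- i.+1 * m) = f * x ^- i.+1 * c * m + k * (f * (x ^- i * m)).
Proof.
move=> x0; rewrite exprS invfM; move: (x ^- i) => y; field; exact: x0.
Qed.

(** Each term of the combination lowers one exponent of the monomial; the hypothesis disposes of the
    exponents that reach 0. *)
Lemma pass_relation_comb xs ks F : all (fun x => x != 0) xs ->
  (forall j M, nth 0%BZ ks j != 0%BZ -> nth 0%N M j = 0%N -> phi (F * mono xs M) = 0) ->
  pass_relation (size xs) ks (fun M => phi (F * comb xs ks * mono xs M))
                             (fun M => phi (F * mono xs M)).
Proof.
elim: xs ks F => [|x xs IH] ks F /=; first by rewrite !mulr1.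
case/andP=> x0 xs0; case: ks => [|k ks] /= bd; first by move=> i M; rewrite shift_exponent.
split.
  case: (eqVneq k 0%BZ) => [->|k0]; first by left.
  by right=> M; apply: (bd 0%N (0%N :: M)).
move=> i; have := IH ks (F * x ^- i.+1) xs0.
rewrite (_ : (fun M => phi (F * x ^- i.+1 * mono xs M)) = (fun M => phi (F * (x ^- i.+1 * mono xs M)))); last first.
  by apply/funext => M; rewrite mulrA.
rewrite (_ : (fun M => phi (F * x ^- i.+1 * comb xs ks * mono xs M)) =
  (fun M => phi (F * (ofZ L k * x + comb xs ks) * (x ^- i.+1 * mono xs M)) -
    ofZ rat k * phi (F * (x ^- i * mono xs M)))).
  apply=> j M kj Mj; rewrite -mulrA; exact: (bd j.+1 (i.+1 :: M)).
by apply/funext => M; rewrite split_factor // phiD phiZ addrK.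
Qed.

End PassRelation.

(** * Leading variables, and residues of monomials *)

Definition lead (e : seq rat) : nat := find (fun c => c != 0) e.

Lemma leads_lead k e : leads k e -> lead e = k.+1.
Proof.
rewrite /leads teval_eq0 => /andP[/forallP e0 ek].
have lek : (k.+1 < size e)%N by apply: contraNT ek; rewrite -leqNgt => /(nth_default 0) ->.
apply/eqP; rewrite eqn_leq; apply/andP; split.
  by rewrite leqNgt; apply/negP => /(before_find 0) /negbFE h; rewrite h in ek.
rewrite ltnNge; apply/negP => h.
have : has (fun c => c != 0) e by apply/hasP; exists e`_k.+1; rewrite // mem_nth.
move/(nth_find 0); rewrite -/(lead e).
by have := e0 (Ordinal (h : (lead e < k.+1)%N)); rewrite /= => ->.
Qed.

Lemma teval_lead0 k n e : lead e = k -> (n < k)%N -> teval n e = 0.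
Proof.
move=> le ltn; apply/eqP; rewrite teval_eq0; apply/forallP => i.
have lti : (i < lead e)%N by rewrite le (leq_trans (ltn_ord i)).
exact: negbFE (before_find 0 lti).
Qed.

Lemma nth_lead_neq0 e : (lead e < size e)%N -> e`_(lead e) != 0.
Proof. by rewrite -has_find; apply: nth_find. Qed.

Lemma teval_lead_neq0 n e : (lead e < size e)%N -> (lead e <= n)%N -> teval n e != 0.
Proof. by move=> /nth_lead_neq0 e0 len; apply: teval_neq0 e0. Qed.

(** [bad] lists positions of first nonzero coefficients: 0 for a constant term, k+1 for the variable
    e_k. *)
Definition tame n (bad : seq nat) (F : tower n) :=
  exists2 E, fractions E (fun=> True) F & {in E, forall e, lead e \in bad}.

Lemma tame_vanish n bad (F : tower n) k : tame bad F -> (k < n)%N -> k.+1 \notin bad ->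
  iterres F = 0.
Proof.
move=> [E EF Eb] ltk kb; apply: (iterres_vanish EF ltk) => e eE.
by apply: contra kb => /leads_lead <-; apply: Eb.
Qed.

Lemma tame_sub n bad bad' (F : tower n) : {subset bad <= bad'} -> tame bad F -> tame bad' F.
Proof. by move=> sub [E EF Eb]; exists E => // e /Eb/sub. Qed.

Lemma tame0 n bad : tame bad (0 : tower n).
Proof. by exists [::]; first exact: fractions0. Qed.

Lemma tame_const n bad c : tame bad (tconst n c).
Proof. by exists [::] => //; rewrite -[tconst n c]mulr1; apply: fractionsZ; apply: fractions1. Qed.

Lemma tameD n bad (F G : tower n) : tame bad F -> tame bad G -> tame bad (F + G).
Proof.
move=> [E EF Eb] [E' EG Eb']; exists (E ++ E') => [|e].
  apply: fractionsD; [apply: fractions_sub EF|apply: fractions_sub EG] => e;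
  by rewrite mem_cat => ->; rewrite ?orbT.
by rewrite mem_cat => /orP[/Eb|/Eb'].
Qed.

Lemma tameZ n bad c (F : tower n) : tame bad F -> tame bad (tconst n c * F).
Proof. by move=> [E EF Eb]; exists E => //; apply: fractionsZ. Qed.

Lemma tameV n bad e (F : tower n) : lead e \in bad -> tame bad F -> tame bad (F * (teval n e)^-1).
Proof.
move=> eb [E EF Eb]; exists (e :: E); last by move=> x; rewrite inE => /orP[/eqP->|/Eb].
rewrite mulrC; apply: (@fractionsV _ _ (fun=> True)); rewrite ?mem_head //.
by apply: fractions_sub EF => x xE; rewrite inE xE orbT.
Qed.

Lemma tame_mono n bad (F : tower n) P M : tame bad F ->
  (forall i, (i < size P)%N -> nth 0%N M i != 0%N -> lead (nth [::] P i) \in bad) ->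
  tame bad (F * mono (map (teval n) P) M).
Proof.
elim: P F M => [|p P IH] F M tF bd /=; first by rewrite mulr1.
rewrite mulrA; apply: IH => [|i lti Mi]; last by apply: (bd i.+1) => //; rewrite -nth_behead.
have := bd 0%N isT; rewrite nth0 /=; elim: (head 0%N M) => [|m IHm] pb; first by rewrite expr0 invr1 mulr1.
have {}pb := pb isT; rewrite exprSr invfM mulrA.
by apply: (tameV pb); exact: IHm.
Qed.

(* Counting degrees: each of the [n] residues lowers the number of factors   *)
(* by one, and what is left vanishes.                                        *)
Lemma iterres_homogeneous n E (f : tower n) : fractions E (fun k => (n < k)%N) f ->
  {in E, forall e, e`_0 = 0} -> iterres f = 0.
Proof.
elim: n E f => [|n IHn] E f Ef E0 /=.
  elim: Ef => [//|f1 f2 _ H1 _ H2|c f1 _ H1|s sE]; first by rewrite H1 H2 addr0.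
    by rewrite H1 mulr0.
  case: s sE => [//|e s] sE _; rewrite big_cons /= E0; last exact/sE/mem_head.
  by rewrite invr0 mul0r.
apply: IHn (fractions_residue Ef) _ => e.
by rewrite mem_filter => /andP[_]; apply: E0.
Qed.

(** The first pivot leads with the highest variable and the last with e_0, so pivot j of n has lead
    n - j. *)
Fixpoint triangular (P : seq (seq rat)) : bool :=
  if P is p :: P' then [&& lead p == size P, (size P < size p)%N & triangular P'] else true.

Fixpoint diag_product (P : seq (seq rat)) : rat :=
  if P is p :: P' then p`_(size P) * diag_product P' else 1.

Lemma nth_triangular P i : triangular P -> (i < size P)%N ->
  lead (nth [::] P i) = (size P - i)%N /\ (size P - i < size (nth [::] P i))%N.
Proof.
elim: P i => [|p P IH] [|i] //=; first by case/and3P => /eqP -> ? _.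
by case/and3P => _ _ tP; rewrite ltnS subSS; apply: IH.
Qed.

Definition prodZ (s : seq Z) : Z := foldr Z.mul 1%BZ s.

Definition zratio (s : Z * Z) : rat := ofZ rat s.1 / ofZ rat s.2.

Lemma diag_productE P ds : triangular P -> all2 (fun p d => p`_(lead p) == zratio d) P ds ->
  diag_product P = zratio (prodZ (map fst ds), prodZ (map snd ds)).
Proof.
elim: P ds => [|p P IH] [|d ds] //=.
case/and3P => /eqP lp _ tP /andP[/eqP pd /(IH _ tP) ->].
rewrite -lp pd /zratio -[RHS]/(ofZ rat (Z.mul d.1 _) / ofZ rat (Z.mul d.2 _)) !ofZM; exact: mulf_div.
Qed.

Lemma triangular_mem P p : triangular P -> p \in P ->
  [/\ (0 < lead p)%N, (lead p <= size P)%N & (lead p < size p)%N].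
Proof.
move=> tP /(nthP [::])[i lti <-]; have [-> ->] := nth_triangular tP lti.
by split=> //; [rewrite subn_gt0 | rewrite leq_subr].
Qed.

Lemma diag_product_neq0 P : triangular P -> diag_product P != 0.
Proof.
elim: P => //= p P IH /and3P[/eqP lp sp /IH d0]; rewrite mulf_neq0 //.
by rewrite -lp nth_lead_neq0 // lp.
Qed.

Lemma fractions_mono n P M :
  fractions P (eq (sumn (take (size P) M))) (mono (map (teval n) P) M).
Proof.
suff gen E : {subset P <= E} -> fractions E (eq (sumn (take (size P) M))) (mono (map (teval n) P) M).
  exact: gen.
elim: P M => [|p P IH] M sub /=; first by rewrite take0; apply: fractions1.
have {}IH := IH (behead M) (fun x xP => sub x (mem_behead (s := p :: P) xP)).
have pE : p \in E by apply: sub; apply: mem_head.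
case: M IH => [|m M] /= IH; first by rewrite expr0 invr1 mul1r; case: (P) IH.
elim: m => [|m IHm]; first by rewrite expr0 invr1 mul1r.
rewrite exprS invfM -mulrA.
by apply: (fractionsV pE _ IHm) => k <-.
Qed.

Lemma sumn_positive M : all (leq 1) M -> (size M <= sumn M ?= iff all (eq_op 1%N) M)%N.
Proof.
elim: M => //= m M IH /andP[m0 /IH IHM]; rewrite -add1n.
by apply: (leqif_add _ IHM); split=> //.
Qed.

Lemma mono_ones (L : fieldType) (xs : seq L) : mono xs (nseq (size xs) 1%N) = \prod_(x <- xs) x^-1.
Proof. by elim: xs => [|x xs IH] /=; rewrite ?big_nil // big_cons IH expr1. Qed.

(** With all exponents 1 the poles are simple and each residue divides by a diagonal coefficient.
    Other positive exponents give more factors than variables, and the residue vanishes by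
    homogeneity. *)
Lemma iterres_mono P M : triangular P -> size M = size P -> all (leq 1) M ->
  diag_product P * iterres (mono (map (teval (size P)) P) M) = (all (eq_op 1%N) M)%:R.
Proof.
move=> tP sM M1; case: (boolP (all _ M)) => [|nM]; last first.
  have [leM eM] := sumn_positive M1.
  rewrite (@iterres_homogeneous _ P) ?mulr0 //.
    have := fractions_mono (size P) P M; rewrite -sM take_size.
    have : (size M < sumn M)%N by rewrite ltn_neqAle eM nM.
    move: (mono _ _) => f ltM; elim=> [|f1 f2 _ H1 _ H2|c f1 _ H1|s sE Qs].
    - exact: fractions0.
    - exact: fractionsD.
    - exact: fractionsZ.
    - by apply: fractions_prod; rewrite // -Qs.
  move=> e /(triangular_mem tP)[l0 _ _]; apply/eqP; apply: negbFE.
  exact: before_find l0.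
move=> allM; have -> : M = nseq (size P) 1%N.
  by rewrite -sM; apply/all_pred1P/allP => x /(allP allM) /=; rewrite eq_sym.
move=> {M sM M1 allM}.
elim: P tP => [|p P IH] /=; first by rewrite mul1r.
case/and3P => /eqP lp sp tP; rewrite -[RHS](IH tP).
have up : teval (size P) p = 0 by apply: teval_lead0 lp _.
set c := p`_(size P).+1; have c0 : c != 0 by rewrite /c -lp nth_lead_neq0 // lp.
pose ls := map (fun q => (teval (size P) q, tconst (size P) q`_(size P).+1)) P.
have -> : (fracL (teval (size P) p) (tconst (size P) c)) ^- 1 *
    mono (map (teval (size P).+1) P) (nseq (size P) 1%N) =
    fracC (tconst (size P) c^-1) * ((fracL 0 1)^-1 * \prod_(l <- ls) (fracL l.1 l.2)^-1).
  have := mono_ones (map (teval (size P).+1) P); rewrite size_map => ->.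
  rewrite up expr1 /fracL tconstV fracC0 fracC1 !add0r mul1r fracCV invfM -mulrA.
  by rewrite /ls !big_map.
rewrite residueZ residue_simple_pole; last first.
  rewrite all_map; apply/allP => q qP /=.
  by have [_ lq sq] := triangular_mem tP qP; apply: teval_lead_neq0.
have -> : \prod_(l <- ls) l.1^-1 = mono (map (teval (size P)) P) (nseq (size P) 1%N).
  by have := mono_ones (map (teval (size P)) P); rewrite size_map => ->; rewrite !big_map.
by rewrite iterresZ mulrACA (divff c0) mul1r.
Qed.

(** * Correctness of the table operations *)

(* The state of the computation: the table [A] represents [F], whose poles   *)
(* lead with the variables listed in [bad].                                  *)
Section Tables.
Variable P : seq (seq rat).
Hypothesis tP : triangular P.
Local Notation n := (size P).
Local Notation xs := (map (teval n) P).

Let phi (f : tower n) := diag_product P * iterres f.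

Let phiD : {morph phi : f g / f + g}.
Proof. by move=> f g; rewrite /phi iterresD mulrDr. Qed.

Let phiZ k f : phi (ofZ (tower n) k * f) = ofZ rat k * phi f.
Proof. by rewrite /phi tconst_ofZ iterresZ mulrCA. Qed.

Definition tabulates bad (F : tower n) (A : array n) :=
  represents A (fun M => diag_product P * iterres (F * mono xs M)) /\ tame bad F.

Lemma tabulates0 bad dims : tabulates bad 0 (zeros n dims [::]).
Proof.
split; last exact: tame0.
apply: eq_represents (represents_zeros n dims [::]) => M _ _.
by rewrite mul0r iterres0 mulr0.
Qed.

Lemma tabulates_add bad F A z : represented z -> tabulates bad F A ->
  tabulates bad (ofZ (tower n) z + F) (add_head z A).
Proof.
move=> zr [rA tF]; split; last by rewrite tconst_ofZ; apply: tameD tF; apply: tame_const.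
apply: eq_represents (represents_add_head zr rA) => M sM M1.
by rewrite -(iterres_mono tP sM M1) tconst_ofZ mulrDl iterresD iterresZ mulrDr mulrCA addrC.
Qed.

Definition pass_ok (bad : seq nat) (ks : seq Z) :=
  (size ks <= n)%N && all (fun j => (nth 0%BZ ks j == 0%BZ) || ((n - j)%N \notin bad)) (iota 0 (size ks)).

(** A pivot with nonzero coefficient has a leading variable that leads neither the divisor nor any
    pole of [F]. At exponent 0 no form leads with this variable any more, and the residue vanishes
    as the recursion requires. *)
Lemma tabulates_pass bad F A e c ks : (lead e <= n)%N -> (lead e < size e)%N ->
  teval n e = tconst n c * comb xs ks -> pass_ok (lead e :: bad) ks ->
  lead e \in bad -> tabulates bad F A -> tabulates bad (F / comb xs ks) (pass ks A).
Proof.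
move=> le se E ok eb [rA tF].
have e0 : teval n e != 0 by apply: teval_lead_neq0.
have [c0 y0] : tconst n c != 0 /\ comb xs ks != 0 by apply/andP; move: e0; rewrite E mulf_eq0 negb_or.
have tF' : tame bad (F / comb xs ks).
  have -> : F / comb xs ks = tconst n c * (F * (teval n e)^-1).
    by rewrite E invfM mulrCA [tconst n c * _]mulrA divff // mul1r.
  exact: tameZ (tameV eb tF).
split=> //; move: rA; rewrite -{1}(divfK y0 F); move: (F / _) tF' => G tG {F tF}.
apply: represents_pass; rewrite -[X in pass_relation X](size_map (teval n) P).
apply: (pass_relation_comb phiD phiZ).
  rewrite all_map; apply/allP => p pP; have [_ lp sp] := triangular_mem tP pP.
  exact: teval_lead_neq0.
move=> j M kj Mj; have ltj : (j < size ks)%N by rewrite ltnNge; apply: contra kj => /(nth_default 0%BZ) ->.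
have [sk /allP/(_ j)] := andP ok; rewrite mem_iota add0n ltj (negbTE kj) => /(_ isT) /= jb.
have ltjn := leq_trans ltj sk.
(* Without the j-th pivot, the possible leads are those of [G] and of the other pivots; the position
   n - j is missing. *)
rewrite /phi (@tame_vanish _ [seq l <- (lead e :: bad) ++ iota 1 n | l != n - j]%N _ (n - j.+1)) ?mulr0 //.
- apply: tame_mono => [|i lti Mi].
    apply: tame_sub tG => l lb; rewrite mem_filter mem_cat inE lb orbT andbT.
    by apply: contraNneq jb => <-; rewrite inE lb orbT.
  have [-> _] := nth_triangular tP lti; rewrite mem_filter mem_cat mem_iota.
  have ij : i != j by apply: contraNneq Mi => ->; apply/eqP.
  by apply/andP; split; [lia | apply/orP; right; lia].
- by lia.
- by rewrite -subSn // subSS mem_filter eqxx.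
Qed.

Lemma tabulates_passes bad F A e c ks m : (lead e <= n)%N -> (lead e < size e)%N ->
  teval n e = tconst n c * comb xs ks -> pass_ok (lead e :: bad) ks ->
  tabulates bad F A -> tabulates (lead e :: bad) (F * (comb xs ks)^-1 ^+ m) (iter m (pass ks) A).
Proof.
move=> le se E ok [rA tF].
have ok' : pass_ok (lead e :: lead e :: bad) ks.
  move: ok; rewrite /pass_ok => /andP[-> /allP ok] /=; apply/allP => j /ok.
  by rewrite !inE orbA orbb.
elim: m => [|m IH]; first by rewrite expr0 mulr1; split=> //; apply: tame_sub tF => l; rewrite inE orbC => ->.
rewrite iterS exprSr mulrA.
by apply: (tabulates_pass le se E ok' _ IH); rewrite mem_head.
Qed.

(** Horner's rule: a sum of negative powers of one combination is built by alternately adding a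
    constant and dividing. *)
Lemma tabulates_horner bad dims e c ks zs : (lead e <= n)%N -> (lead e < size e)%N ->
  teval n e = tconst n c * comb xs ks -> pass_ok (lead e :: bad) ks -> all represented zs ->
  tabulates (lead e :: bad) (pow_sum (comb xs ks) zs)
    (foldr (fun z A => pass ks (add_head z A)) (zeros n dims [::]) zs).
Proof.
move=> le se E ok; elim: zs => [|z zs IH] /=; first by move=> _; exact: tabulates0.
case/andP => zr {}/IH IH.
have ok' : pass_ok (lead e :: lead e :: bad) ks.
  move: ok; rewrite /pass_ok => /andP[-> /allP ok] /=; apply/allP => j /ok.
  by rewrite !inE orbA orbb.
rewrite mulrC; apply: (tabulates_pass le se E ok'); rewrite ?mem_head //.
exact: tabulates_add zr IH.
Qed.

Lemma tabulates_entry bad F A M z : tabulates bad F A -> size M = n -> entry A M = Some z ->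
  diag_product P * iterres (F * mono xs M) = ofZ rat z.
Proof.
by move=> [rA _] sM eM; apply: (represents_entry rA sM eM).
Qed.

End Tables.

Fixpoint comb_coef (P : seq (seq rat)) (ks : seq Z) i : rat :=
  match P, ks with
  | [::], _ => (i == 0%N)%:R
  | p :: _, [::] => p`_i
  | p :: P', k :: ks' => ofZ rat k * p`_i + comb_coef P' ks' i
  end.

Lemma teval_comb n P ks c e : (forall i, (i <= n)%N -> e`_i = c * comb_coef P ks i) ->
  teval n e = tconst n c * comb (map (teval n) P) ks.
Proof.
move=> E; rewrite (@tevalZ n c (mkseq (comb_coef P ks) n.+1)) => [|i lei]; last first.
  by rewrite nth_mkseq // E.
congr (_ * _) => {e c E}; elim: P ks => [|p P IH] ks.
  suff gen e : (forall i, (i <= n)%N -> e`_i = (i == 0%N)%:R) -> teval n e = 1.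
    by apply: gen => i lei; rewrite nth_mkseq.
  elim: n => [|n IHn] E /=; first by rewrite E.
  by rewrite E // IHn => [|i lei]; rewrite ?tconst0 ?E ?leqW // /fracL fracC1 fracC0 mul0r addr0.
case: ks => [|k ks] /=; first by apply: eq_teval => i lei; rewrite nth_mkseq.
rewrite -IH tconst_ofZ -(@tevalZ n _ p (mkseq (fun i => ofZ rat k * p`_i) n.+1)) => [|i lei]; last by rewrite nth_mkseq.
by apply: tevalD => i lei; rewrite !nth_mkseq.
Qed.

(** * The distinct forms of the systems and their multiplicities *)

Definition zpow (a : Z) m := iter m (Z.mul a) 1%BZ.

Lemma ofZ_pow (L : pzRingType) a m : ofZ L (zpow a m) = ofZ L a ^+ m.
Proof. by elim: m => [|m IHm] //=; rewrite ofZM IHm exprS. Qed.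

(** The 14 mixed groups come first, then the coordinates; [all_below], the only form of variable
    multiplicity, has index j + 14. *)
Definition system_forms j : seq (seq rat) :=
  [seq form_of g.1 | g <- mixed_groups] ++ map coord_form (iota 0 j) ++ [:: form_of all_below].

Definition multiplicity j J i : nat :=
  nth 0%N ([seq g.2 | g <- mixed_groups] ++ nseq j 1%N ++ [:: J]) i.

Lemma prod_system (L : comPzRingType) (g : seq rat -> L) j J :
  \prod_(s <- system j (with_below J)) g s =
  \prod_(i <- iota 0 (j + 15)) g (nth [::] (system_forms j) i) ^+ multiplicity j J i.
Proof.
pose fs := system_forms j; pose ms := [seq h.2 | h <- mixed_groups] ++ nseq j 1%N ++ [:: J].
have sz : size fs = (j + 15)%N by rewrite !size_cat !size_map size_iota /= addnCA addnC.
have szm : size ms = (j + 15)%N by rewrite !size_cat !size_map size_nseq /= addnCA addnC.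
transitivity (\prod_(p <- zip fs ms) g p.1 ^+ p.2); last first.
  rewrite (big_nth ([::], 0%N)) size_zip sz szm minnn /index_iota subn0.
  rewrite big_seq [RHS]big_seq; apply: eq_bigr => i; rewrite mem_iota => /andP[_ lti].
  by rewrite nth_zip ?sz ?szm.
rewrite /fs /ms /system_forms zip_cat ?size_map // zip_cat ?size_map ?size_nseq ?size_iota //.
rewrite /with_below system_nseq /system !big_cat big_seq1.
have -> : \prod_(s <- nseq J (form_of all_below)) g s = g (form_of all_below) ^+ J.
  by elim: J {ms szm} => [|J IH] /=; rewrite ?big_nil ?expr0 // big_cons IH exprS.
have zip1 (t : seq (seq rat)) : \prod_(p <- zip t (nseq (size t) 1%N)) g p.1 ^+ p.2 = \prod_(s <- t) g s.
  by elim: t => [|x t IH] /=; rewrite ?big_nil // !big_cons IH expr1.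
have := zip1 (map coord_form (iota 0 j)); rewrite size_map size_iota => ->.
have -> : \prod_(s <- map form_of mixed_steps) g s =
    \prod_(p <- zip [seq form_of h.1 | h <- mixed_groups] [seq h.2 | h <- mixed_groups]) g p.1 ^+ p.2.
  rewrite /mixed_steps; elim: mixed_groups => [|h hs IH] /=; first by rewrite !big_nil.
  rewrite map_cat big_cat big_cons -IH; congr (_ * _).
  by elim: h.2 => [|m IHm] /=; rewrite ?big_nil ?expr0 // big_cons IHm exprS.
by rewrite -[LHS]/(_ * (_ * _)) -[RHS]/(_ * (_ * _)) [LHS]mulrC -[LHS]mulrA.
Qed.

Lemma multiplicity_neq j J J' i : i != (j + 14)%N -> multiplicity j J i = multiplicity j J' i.
Proof.
move=> nei; rewrite /multiplicity !catA; set ms := _ ++ nseq j 1%N.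
have sz : size ms = (j + 14)%N by rewrite size_cat size_map size_nseq addnC.
rewrite !nth_cat sz; have [//|lei] := ltnP i (j + 14).
have [k ->] : exists k, (i - (j + 14))%N = k.+1.
  by exists (i - (j + 15))%N; move/eqP: nei; move: (j + 14)%N (j + 15)%N lei (addnS j 14); lia.
by rewrite [LHS]nth_default ?[RHS]nth_default.
Qed.

Lemma ofZ_eq0 (L : numDomainType) z : (ofZ L z == 0) = (z == 0%BZ).
Proof.
rewrite intr_eq0; apply/eqP/eqP => [|-> //].
by move/(congr1 Z_of_int); rewrite int_of_ZK.
Qed.

Lemma cross_field (L : fieldType) (r p q x y d e f z k : L) :
  q != 0 -> y != 0 -> d != 0 -> e != 0 ->
  r * (p * (x * (d * e))) = z * (k * (q * (y * f))) ->
  r * p / q * (x / y) = z * (k / d) * (f / e).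
Proof.
move=> q0 y0 d0 e0 E; have -> : r * p / q * (x / y) = r * (p * (x * (d * e))) / (q * y * d * e).
  by field; rewrite q0 y0 d0 e0.
by rewrite E; field; rewrite q0 y0 d0 e0.
Qed.

Lemma cross_ratio (r p q x y d e f z k : Z) :
  q != 0%BZ -> y != 0%BZ -> d != 0%BZ -> e != 0%BZ ->
  Z.mul r (Z.mul p (Z.mul x (Z.mul d e))) = Z.mul z (Z.mul k (Z.mul q (Z.mul y f))) ->
  ofZ rat r * ofZ rat p / ofZ rat q * (ofZ rat x / ofZ rat y) =
  ofZ rat z * (ofZ rat k / ofZ rat d) * (ofZ rat f / ofZ rat e).
Proof.
rewrite -!(ofZ_eq0 rat) => q0 y0 d0 e0 /(congr1 (ofZ rat)); rewrite !ofZM.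
move: (ofZ rat r) (ofZ rat p) (ofZ rat q) (ofZ rat x) (ofZ rat y) (ofZ rat d) (ofZ rat e)
  (ofZ rat f) (ofZ rat z) (ofZ rat k) q0 y0 d0 e0 => {}r {}p {}q {}x {}y {}d {}e {}f {}z {}k.
move=> q0 y0 d0 e0 E.
by apply: cross_field E.
Qed.

Lemma rescale (A : comPzRingType) (w a z k d x : A) :
  w * a = z * k * d -> w * (a * x) = k * (d * (z * x)).
Proof. by move=> E; rewrite mulrA E; ring. Qed.

(** * Certificates and their evaluation *)

(* A certificate for one flag. Every form of the system (the coordinates,    *)
(* the groups and, last, [all_below]) is a rational multiple either of one   *)
(* of the [pivots], triangular vectors in the variables of the tower, or of  *)
(* the combination of them with integral coefficients listed in [factors],   *)
(* in the order in which the divisions take place.                           *)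
Record certificate := Certificate {
  flag : seq (seq rat);
  pivots : seq (nat * (Z * Z) * seq rat);
  factors : seq (nat * (Z * Z) * seq Z);
  diag : seq (Z * Z);
  race : Z * Z;
  sides : seq (nat * seq nat);
  result_scale : Z }.

Section Evaluation.
Variables (D : Z) (c : certificate).
Local Notation j := (size (flag c)).
Local Notation n := (size (map snd (pivots c))).
Let P : seq (seq rat) := map snd (pivots c).
Let below := (j + 14)%N.

Definition form i := subst (flag c) (nth [::] (system_forms j) i).

Definition pivot_ok (p : nat * (Z * Z) * seq rat) :=
  all (fun i => (form p.1.1)`_i == zratio p.1.2 * p.2`_i) (iota 0 n.+1).

Fixpoint factors_ok bad (fs : seq (nat * (Z * Z) * seq Z)) : bool :=
  if fs is f :: fs' then
    let e := form f.1.1 in let bad' := lead e :: bad in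
    [&& (lead e <= n)%N,
        all (fun i => e`_i == zratio f.1.2 * comb_coef P f.2 i) (iota 0 n.+1),
        pass_ok P bad' f.2 & factors_ok bad' fs']
  else true.

Definition run_factors (fs : seq (nat * (Z * Z) * seq Z)) (A : array n) : array n :=
  foldl (fun A f => iter (multiplicity j 0 f.1.1) (pass f.2) A) A fs.

Definition exponents J := [seq multiplicity j J p.1.1 | p <- pivots c].

Definition entries := map fst (pivots c) ++ map fst (factors c).

Definition scale_powers J : Z * Z :=
  foldr (fun e w => let m := multiplicity j J e.1 in
    (Z.mul (zpow e.2.2 m) w.1, Z.mul (zpow e.2.1 m) w.2)) (1%BZ, 1%BZ) entries.

(** The weight depends on i through powers of 2 and of the scalar of [all_below]. Their ratio is
    given by [race], and the homogeneous powers keep the coefficients integral. *)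
Definition race_coef i : Z :=
  Z.mul (nth 0%BZ race_list i) (Z.mul (zpow (race c).1 i) (zpow (race c).2 (23 - i))).

Definition race_coefs := mkseq race_coef 24.

(** The identity of [scale_racesE] with denominators cleared. *)
Definition scale_ok i : bool := let w := scale_powers i.+1 in
  (w.2 != 0%BZ) &&
  (Z.mul (nth 0%BZ race_list i) (Z.mul (zpow 2%BZ i.+1) (Z.mul w.1 (Z.mul D (prodZ (map snd (diag c)))))) ==
   Z.mul (race_coef i) (Z.mul (result_scale c) (Z.mul (zpow 2%BZ 48) (Z.mul w.2 (prodZ (map fst (diag c))))))).

Definition certificate_ok : bool :=
  [&& size P == j, triangular P, all2 (fun p d => p`_(lead p) == zratio d) P (diag c) & all pivot_ok (pivots c)] &&
  [&& factors_ok [::] (factors c),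
      perm_eq (map fst entries) (iota 0 (j + 15)) && all represented race_coefs, D != 0%BZ, (prodZ (map snd (diag c))) != 0%BZ & all scale_ok (iota 0 24)].

Let value J : rat := iterres (integrand (flag c) (system j (with_below J))).
Let xs := map (teval n) P.

Hypothesis ok : certificate_ok.

Lemma scale_powersE J :
  \prod_(e <- entries) (zratio e.2)^-1 ^+ multiplicity j J e.1 =
  ofZ rat (scale_powers J).1 / ofZ rat (scale_powers J).2.
Proof.
rewrite /scale_powers; elim: entries => [|e es IH] /=; first by rewrite big_nil !ofZ1 divr1.
rewrite big_cons IH !ofZM !ofZ_pow /zratio invf_div expr_div_n.
by rewrite [LHS]mulf_div.
Qed.

Lemma scale_racesE i : (i < 24)%N -> race_weight i *
    (ofZ rat (scale_powers i.+1).1 / ofZ rat (scale_powers i.+1).2) =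
  ofZ rat (race_coef i) * (ofZ rat (result_scale c) / ofZ rat D) * diag_product P.
Proof.
move=> lti; have [/and4P[_ tP dP _] /and5P[_ _ D0 d0 /allP/(_ i)]] := andP ok.
rewrite mem_iota add0n => /(_ lti) /andP[w0 /eqP E].
have p2 m : 2 ^+ m = ofZ rat (zpow 2%BZ m) by rewrite ofZ_pow.
rewrite (diag_productE tP dP) /race_weight (p2 i.+1) (p2 48%N) /zratio; apply: cross_ratio E; rewrite //.
Qed.

Lemma factors_ok_cons bad f fs : factors_ok bad (f :: fs) =
  [&& (lead (form f.1.1) <= n)%N,
      all (fun i => (form f.1.1)`_i == zratio f.1.2 * comb_coef P f.2 i) (iota 0 n.+1),
      pass_ok P (lead (form f.1.1) :: bad) f.2 & factors_ok (lead (form f.1.1) :: bad) fs].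
Proof. by []. Qed.

Let size_n : j = n.
Proof. by have [/and4P[/eqP <-]] := andP ok. Qed.

Lemma eval_pivot p : p \in pivots c ->
  teval n (form p.1.1) = tconst n (zratio p.1.2) * teval n p.2.
Proof.
have [/and4P[_ _ _ /allP pok] _] := andP ok => /pok /allP E.
by apply: tevalZ => i lei; apply/eqP/E; rewrite mem_iota.
Qed.

Lemma eval_factor f : f \in factors c ->
  teval n (form f.1.1) = tconst n (zratio f.1.2) * comb xs f.2.
Proof.
have [_ /and5P[+ _ _ _ _]] := andP ok; elim: (factors c) [::] => // g fs IH bad.
rewrite factors_ok_cons => /and4P[_ /allP E _ fok]; rewrite inE => /orP[/eqP->|]; last exact: IH fok.
by apply: teval_comb => i lei; apply/eqP/E; rewrite mem_iota.
Qed.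

Definition product J : tower n :=
  \prod_(f <- factors c) (comb xs f.2)^-1 ^+ multiplicity j J f.1.1.

(** The scalars of all forms are pulled out, leaving combinations of pivots and a monomial in the
    pivots. *)
Lemma valueE J : value J =
  ofZ rat (scale_powers J).1 / ofZ rat (scale_powers J).2 *
  iterres (product J * mono xs (exponents J)).
Proof.
have -> : value J = iterres (\prod_(s <- system j (with_below J)) (teval n (subst (flag c) s))^-1).
  rewrite /value /integrand /feval; move: (system _ _) => a.
  by case: _ / size_n.
rewrite (prod_system (fun s => (teval n (subst (flag c) s))^-1)).
have [_ /and5P[_ /andP[pE _] _ _ _]] := andP ok.
rewrite -(perm_big _ pE) big_map /= -scale_powersE /entries 2!big_cat !big_map.
have split_scale m r (x : tower n) :
    (tconst n r * x)^-1 ^+ m = tconst n (r^-1 ^+ m) * x^-1 ^+ m.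
  rewrite invfM exprMn -tconstV; congr (_ * _).
  by elim: m => [|m IHm]; rewrite ?expr0 ?tconst1 // !exprS tconstM IHm.
have prodZ (I : eqType) (s : seq I) (u : I -> rat) (x y : I -> tower n) :
    {in s, forall i, x i = tconst n (u i) * y i} ->
    \prod_(i <- s) x i = tconst n (\prod_(i <- s) u i) * \prod_(i <- s) y i.
  elim: s => [|i s IH] H; first by rewrite !big_nil tconst1 mulr1.
  rewrite !big_cons H ?mem_head // IH => [|k ks]; last by rewrite H // inE ks orbT.
  by rewrite tconstM mulrACA.
rewrite (@prodZ _ (pivots c) (fun p => (zratio p.1.2)^-1 ^+ multiplicity j J p.1.1) _
  (fun p => (teval n p.2)^-1 ^+ multiplicity j J p.1.1)) => [|p pP]; last first.
  by rewrite (eval_pivot pP) split_scale.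
rewrite (@prodZ _ (factors c) (fun p => (zratio p.1.2)^-1 ^+ multiplicity j J p.1.1) _
  (fun f => (comb xs f.2)^-1 ^+ multiplicity j J f.1.1)) => [|f fF]; last first.
  by rewrite (eval_factor fF) split_scale.
have -> : mono xs (exponents J) = \prod_(p <- pivots c) (teval n p.2)^-1 ^+ multiplicity j J p.1.1.
  rewrite /xs /P /exponents; move: n => k; elim: (pivots c) => [|p ps IH] /=; rewrite ?big_nil //.
  by rewrite big_cons IH exprVn.
rewrite -iterresZ -/(product J); congr iterres.
set a := \prod_(p <- pivots c) (zratio p.1.2)^-1 ^+ _.
set b := \prod_(f <- factors c) (zratio f.1.2)^-1 ^+ _.
rewrite -[LHS]/(_ * _) -[RHS]/(tconst n (a * b) * (product J * _)) tconstM.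
by rewrite [LHS]mulrACA [product J * _]mulrC.
Qed.

Lemma tabulates_factors bad F A fs : factors_ok bad fs -> @tabulates P bad F A ->
  exists bad', @tabulates P bad'
    (F * \prod_(f <- fs) (comb xs f.2)^-1 ^+ multiplicity j 0 f.1.1) (run_factors fs A).
Proof.
have [/and4P[_ tP _ _] _] := andP ok.
elim: fs bad F A => [|f fs IH] bad F A; first by exists bad; rewrite big_nil mulr1.
rewrite factors_ok_cons big_cons mulrA => /and4P[le /allP E pok fok] tF; apply: IH fok _.
apply: (tabulates_passes tP _ le _ _ pok tF); first by rewrite size_subst size_n.
by apply: teval_comb => i lei; apply/eqP/E; rewrite mem_iota.
Qed.

Definition avoids_below I (s : seq (nat * (Z * Z) * I)) := all (fun x => x.1.1 != below) s.

(* If [all_below] is a factor then the sum over its powers is evaluated by   *)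
(* Horner's rule before the other divisions; if it is a pivot then its       *)
(* powers correspond to different entries of one table.                      *)
Definition run : option Z :=
  if factors c is f :: fs then
    if f.1.1 == below then
      if avoids_below fs && avoids_below (pivots c) then
        entry (run_factors fs (foldr (fun z A => pass f.2 (add_head z A))
          (zeros n (sides c) [::]) race_coefs)) (exponents 0)
      else None
    else if avoids_below (factors c) then
      let A := run_factors (factors c) (add_head 1%BZ (zeros n (sides c) [::])) in
      foldr (fun i s => if entry A (exponents i.+1) is Some z then
          if s is Some s' then Some (Z.add (Z.mul (race_coef i) z) s') else None
        else None) (Some 0%BZ) (iota 0 24)
    else None
  else None.

Lemma avoids_product I (s : seq (nat * (Z * Z) * I)) (g : nat * (Z * Z) * I -> tower n) J :
  avoids_below s -> \prod_(f <- s) g f ^+ multiplicity j J f.1.1 =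
  \prod_(f <- s) g f ^+ multiplicity j 0 f.1.1.
Proof.
elim: s => [|f s IH] /=; first by rewrite !big_nil.
by case/andP => nf /IH E; rewrite !big_cons E (multiplicity_neq J 0 nf).
Qed.

Lemma multiplicity_below J : multiplicity j J below = J.
Proof.
rewrite /multiplicity catA nth_cat size_cat size_map size_nseq /below addnC.
by rewrite ltnn subnn.
Qed.

(** By linearity the 24 powers of [all_below] need only one table: they enter either through
    Horner's rule or as 24 entries of it. *)
Theorem run_value N : run = Some N ->
  \sum_(i < 24) race_weight i * value i.+1 = ofZ rat (Z.mul (result_scale c) N) / ofZ rat D.
Proof.
have [/and4P[_ tP _ _] /and5P[fok /andP[_ zr] _ _ _]] := andP ok.
set k := ofZ rat (result_scale c) / ofZ rat D.
have -> : ofZ rat (Z.mul (result_scale c) N) / ofZ rat D = k * ofZ rat N by rewrite ofZM mulrAC.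
have -> : \sum_(i < 24) race_weight i * value i.+1 = k * \sum_(i < 24)
    diag_product P * (ofZ rat (race_coef i) * iterres (product i.+1 * mono xs (exponents i.+1))).
  rewrite [RHS]mulr_sumr; apply: eq_bigr => i _; rewrite valueE.
  exact: rescale (scale_racesE (ltn_ord i)).
rewrite /run; move: fok; rewrite /product; case: (factors c) => // f fs fok.
case: eqP => [fE|_].
  case: ifP => // /andP[nfs npv] eN; congr (k * _).
  move: fok; rewrite factors_ok_cons => /and4P[le /allP E pok fok].
  have tE : teval n (form f.1.1) = tconst n (zratio f.1.2) * comb xs f.2.
    by apply: teval_comb => i lei; apply/eqP/E; rewrite mem_iota.
  have se : (lead (form f.1.1) < size (form f.1.1))%N by rewrite size_subst size_n.
  have [bad T] := tabulates_factors fok (tabulates_horner tP (sides c) le se tE pok zr).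
  rewrite -(tabulates_entry T _ eN); last by rewrite !size_map.
  rewrite pow_sumE size_mkseq !mulr_suml iterres_sum mulr_sumr.
  apply: eq_bigr => i _; rewrite nth_mkseq // tconst_ofZ big_cons fE multiplicity_below.
  rewrite (avoids_product (fun f => (comb xs f.2)^-1) _ nfs).
  have -> : exponents i.+1 = exponents 0.
    move: npv; rewrite /exponents; elim: (pivots c) => //= p ps IH /andP[np /IH ->].
    by rewrite (multiplicity_neq i.+1 0 np).
  set a := (comb xs f.2)^-1 ^+ _; set u := \prod_(_ <- fs) _; set m := mono xs _.
  congr (_ * _); rewrite -iterresZ; congr iterres.
  by rewrite -(mulrA a u m) -(mulrA _ u m) -(mulrA _ a (u * m)).
case: ifP => // nfs; set A := run_factors _ _ => eN; congr (k * _).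
have [bad T] := tabulates_factors fok (tabulates_add tP (z := 1%BZ) isT (tabulates0 P [::] (sides c))).
rewrite ofZ1 addr0 mul1r -/A in T.
under eq_bigr do rewrite (avoids_product (fun f => (comb xs f.2)^-1) _ nfs).
rewrite -(big_mkord xpredT (fun i => diag_product P * (ofZ rat (race_coef i) * iterres
  (\prod_(f <- f :: fs) (comb xs f.2)^-1 ^+ multiplicity j 0 f.1.1 * mono xs (exponents i.+1))))).
rewrite /index_iota subn0; elim: (iota 0 24) N eN => [|i s IH] N /=; first by move=> [<-]; rewrite big_nil.
case eA : entry => [z|//]; case: foldr IH => // N' IH [<-].
rewrite big_cons (IH N') // ofZD ofZM mulrCA; congr (_ * _ + _).
by rewrite (tabulates_entry T _ eA) // !size_map.
Qed.

End Evaluation.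

(** * Summing the certified residues *)

Definition flag_result D c : option Z :=
  if certificate_ok D c then
    if run c is Some N then Some (Z.mul (result_scale c) N) else None
  else None.

Fixpoint have_results D (cs : seq certificate) (zs : seq Z) : Prop :=
  match cs, zs with
  | c :: cs', z :: zs' => flag_result D c = Some z /\ have_results D cs' zs'
  | [::], [::] => True
  | _, _ => False
  end.

Definition sumZ (zs : seq Z) : Z := foldr Z.add 0%BZ zs.

(** The forms in [system_forms] cover the system for every multiplicity J, so one list of flags
    serves all powers. *)
Definition complete_flags j (cs : seq certificate) : bool :=
  let L := map flag cs in
  [&& uniq L, all (is_flag j) L & all (mem L) (poles j (system_forms j))].

Lemma size_is_flag j phi : is_flag j phi -> size phi = j.
Proof. by elim: j phi => [|j IH] [|r phi] //= /and3P[_ _ /IH ->]. Qed.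

Lemma sum_results D j cs zs : all (is_flag j) (map flag cs) -> have_results D cs zs ->
  \sum_(i < 24) race_weight i *
    \sum_(phi <- map flag cs) iterres (integrand phi (system j (with_below i.+1))) =
  ofZ rat (sumZ zs) / ofZ rat D.
Proof.
move=> fl res; transitivity (\sum_(c <- cs) \sum_(i < 24) race_weight i *
    iterres (integrand (flag c) (system j (with_below i.+1)))).
  by under eq_bigr do rewrite big_map mulr_sumr; exact: exchange_big.
elim: cs zs fl res => [|c cs IH] [|z zs] //=; first by rewrite big_nil ofZ0 mul0r.
case/andP => /size_is_flag sc /IH{}IH [+ /IH E].
rewrite /flag_result; case: ifP => // ok; case eN: run => [N|//] [<-].
rewrite big_cons E ofZD [RHS]mulrDl; congr (_ + _).
by case: _ / sc; rewrite -(run_value ok eN); apply: eq_bigr.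
Qed.

Lemma sub_system j J : {subset system j (with_below J) <= system_forms j}.
Proof.
move=> s; have -> : (s \in system_forms j) =
    [|| s \in [seq form_of g.1 | g <- mixed_groups], s \in map coord_form (iota 0 j) |
        s == form_of all_below] by rewrite /system_forms !mem_cat mem_seq1.
rewrite /system mem_cat => /orP[/mapP[f]|->]; last by rewrite orbT.
rewrite /with_below mem_cat => /orP[|/flattenP[_ /mapP[g gG ->]]]; rewrite mem_nseq => /andP[_ /eqP ->] ->.
  by rewrite eqxx !orbT.
by apply/orP; left; apply/mapP; exists g.
Qed.

Lemma has_value_complete (R : realType) j J cs : (j <= 4)%N -> complete_flags j cs ->
  has_value R j (with_below J)
    ((-1) ^+ j * \sum_(phi <- map flag cs) iterres (integrand phi (system j (with_below J)))).
Proof.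
move=> j4 /and3P[uL fL /allP sub]; apply: has_value_poles => //.
- by rewrite /positive_steps all_cat all_nseq orbT; vm_compute.
- move=> i lti; rewrite has_cat; apply/orP; right.
  by move: i {lti} (leq_trans lti j4) => [|[|[|[|//]]]] _; vm_compute.
- by move=> phi /(sub_poles (sub_system (J := J)))/sub.
Qed.

Definition vec d (v : seq Z) : seq rat := [seq ofZ rat z / ofZ rat d | z <- v].

Definition piv i a b (v : seq rat) : nat * (Z * Z) * seq rat := (i, (a, b), v).

Definition fac i a b (ks : seq Z) : nat * (Z * Z) * seq Z := (i, (a, b), ks).

(** * The certificates and their results *)

Local Open Scope Z_scope.

(** Over this denominator the weighted residue of every flag is an integer. *)
Definition common_denominator : Z := 94322313523178914232520025794807883980213674922500463984220102773562146816.

Definition certificates0 : seq certificate := [::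
Certificate [::]
  [::]
  [:: fac 14 1 1 [::]; fac 0 1 1 [::]; fac 1 1 1 [::]; fac 2 1 1 [::]; fac 3 1 1 [::]; fac 4 1 1 [::]; fac 5 1
    1 [::]; fac 6 1 1 [::]; fac 7 1 1 [::]; fac 8 1 1 [::]; fac 9 1 1 [::]; fac 10 1 1 [::]; fac 11 1 1 [::];
    fac 12 1 1 [::]; fac 13 1 1 [::]]
  [::] (2, 1) [::] 670200346939814396538679558509044539819496399406520936169472].

Definition certificates1 : seq certificate := [::
Certificate [:: vec 1 [:: 1]]
  [:: piv 0 2 1 (vec 2 [:: 0; -1])]
  [:: fac 15 2 1 [:: -1]; fac 3 2 1 [:: -1]; fac 7 2 1 [:: -1]; fac 8 2 1 [:: -1]; fac 9 2 1 [:: -1]; fac 11 2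
    1 [:: -1]; fac 12 2 1 [:: -1]; fac 13 2 1 [:: -1]; fac 14 1 1 [:: -2]; fac 1 2 1 [::]; fac 2 2 1 [::]; fac
    4 2 1 [::]; fac 5 2 1 [::]; fac 6 2 1 [::]; fac 10 2 1 [::]]
  [:: (-1, 2)] (1, 1) [:: (36, [::])]%N (-141920443779821398850921630807183327232)].

Definition certificates2 : seq certificate := [::
Certificate [:: vec 1 [:: 1; -1]; vec 1 [:: 1]]
  [:: piv 0 2 1 (vec 2 [:: 0; 0; -1]); piv 2 2 1 (vec 2 [:: 0; -2; 1])]
  [:: fac 16 2 1 [:: -1; 0]; fac 9 2 1 [:: -1; 0]; fac 12 2 1 [:: -1; 0]; fac 13 2 1 [:: -1; 0]; fac 3 2 1 [::
    0; -1]; fac 7 2 1 [:: 0; -1]; fac 8 2 1 [:: 0; -1]; fac 11 2 1 [:: 0; -1]; fac 14 1 1 [:: -1; -1]; fac 5 2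
    1 [:: 0]; fac 6 2 1 [:: 0]; fac 10 2 1 [:: 0]; fac 15 1 1 [:: -1]; fac 1 2 1 [::]; fac 4 2 1 [::]]
  [:: (-1, 2); (-1, 1)] (1, 1) [:: (16, [::]); (36, [:: 1])]%N 141920443779821398850921630807183327232].

Definition certificates3 : seq certificate := [::
Certificate [:: vec 1 [:: 1; -1; -1]; vec 1 [:: 1; -1]; vec 1 [:: 1]]
  [:: piv 0 2 1 (vec 2 [:: 0; 0; 0; -1]); piv 1 2 1 (vec 2 [:: 0; 0; -2; 1]); piv 2 2 1 (vec 2 [:: 0; -2; 2;
    -1])]
  [:: fac 17 2 1 [:: -1; 0; 0]; fac 13 2 1 [:: -1; 0; 0]; fac 9 2 1 [:: 0; -1; 0]; fac 12 2 1 [:: 0; -1; 0];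
    fac 8 2 1 [:: 0; 0; -1]; fac 11 2 1 [:: 0; 0; -1]; fac 14 1 1 [:: 0; -1; -1]; fac 3 2 1 [:: 1; -1; -1];
    fac 7 2 1 [:: 1; -1; -1]; fac 5 2 1 [:: 0; 0]; fac 6 2 1 [:: -1; 1]; fac 10 2 1 [:: -1; 1]; fac 15 1 1 [::
    -1; 0]; fac 4 2 1 [:: 0]; fac 16 1 1 [:: -1]]
  [:: (-1, 2); (-1, 1); (-1, 1)] (1, 1) [:: (6, [::]); (16, [:: 1]); (36, [:: 1; 1])]%N
    (-141920443779821398850921630807183327232);
Certificate [:: vec 1 [:: 1; -1; -1]; vec 1 [:: 1; 0]; vec 1 [:: 1]]
  [:: piv 0 4 1 (vec 4 [:: 0; 0; 0; -1]); piv 8 4 1 (vec 4 [:: 0; 0; -2; 1]); piv 6 4 1 (vec 4 [:: 0; -2; 0;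
    1])]
  [:: fac 17 2 1 [:: -2; 0; 0]; fac 13 2 1 [:: -2; 0; 0]; fac 2 2 1 [:: 0; -2; 0]; fac 5 2 1 [:: 0; -2; 0];
    fac 3 2 1 [:: 0; 0; -2]; fac 7 2 1 [:: 0; 0; -2]; fac 15 1 1 [:: -2; -2; 0]; fac 14 1 1 [:: -2; 0; -2];
    fac 16 (-1) 1 [:: 0; -2; -2]; fac 1 (-2) 1 [:: -2; -2; -2]; fac 4 (-2) 1 [:: -2; -2; -2]; fac 9 4 1 [::
    -1; -1; -1]; fac 12 4 1 [:: -1; -1; -1]; fac 10 4 1 [:: 0; 0]; fac 11 4 1 [:: 0]]
  [:: (-1, 4); (-1, 2); (-1, 2)] (1, 1) [:: (6, [::]); (10, [:: 0]); (10, [:: 0; 0])]%N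
    16521714136449317314070839296;
Certificate [:: vec 1 [:: 1; 1; -1]; vec 1 [:: 1; 0]; vec 1 [:: 1]]
  [:: piv 3 4 1 (vec 4 [:: 0; 0; 0; -1]); piv 1 4 1 (vec 4 [:: 0; 0; -2; 1]); piv 2 4 1 (vec 4 [:: 0; -2; 2;
    -1])]
  [:: fac 17 4 1 [:: -1; -1; -1]; fac 6 2 1 [:: -2; 0; 0]; fac 10 2 1 [:: -2; 0; 0]; fac 9 2 1 [:: 0; -2; 0];
    fac 12 2 1 [:: 0; -2; 0]; fac 8 2 1 [:: 0; 0; -2]; fac 11 2 1 [:: 0; 0; -2]; fac 15 1 1 [:: -2; -2; 0];
    fac 16 1 1 [:: -2; 0; -2]; fac 14 1 1 [:: 0; -2; -2]; fac 0 (-2) 1 [:: -2; -2; -2]; fac 13 4 1 [:: -1; -1;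
    -1]; fac 5 4 1 [:: 0; 0]; fac 4 4 1 [:: 0]; fac 7 4 1 [::]]
  [:: (-1, 4); (-1, 2); (-1, 2)] (1, 2) [:: (10, [::]); (10, [:: 0]); (10, [:: 0; 0])]%N
    (-984770902183611232881)].

Definition certificates4 : seq certificate := [::
Certificate [:: vec 1 [:: 1; -1; 1; -1]; vec 1 [:: 1; -1; 0]; vec 1 [:: 1; -1]; vec 1 [:: 1]]
  [:: piv 2 4 1 (vec 4 [:: 0; 0; 0; 0; -1]); piv 0 4 1 (vec 4 [:: 0; 0; 0; -2; 1]); piv 1 4 1 (vec 4 [:: 0; 0;
    -2; 2; -1]); piv 15 1 1 (vec 1 [:: 0; -1; 1; 0; 0])]
  [:: fac 18 2 1 [:: -2; 0; 0; 1]; fac 11 2 1 [:: -2; 0; 0; 0]; fac 13 2 1 [:: 0; -2; 0; 0]; fac 12 2 1 [:: 0;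
    0; -2; 0]; fac 8 2 1 [:: 0; -2; 0; -1]; fac 7 2 1 [:: 0; 0; -2; -1]; fac 14 1 1 [:: 0; -2; -2; -1]; fac 3
    2 1 [:: 2; -2; -2; -2]; fac 9 2 1 [:: 2; -2; -2; -1]; fac 4 2 1 [:: -2; 2; 2]; fac 5 2 1 [:: 0; 2; 0]; fac
    6 2 1 [:: 0; 0; 2]; fac 10 4 1 [:: -1; 1; 1]; fac 16 1 1 [:: -2; 0; 2]; fac 17 1 1 [:: -2; 2; 0]]
  [:: (-1, 4); (-1, 2); (-1, 2); (-1, 1)] (1, 1) [:: (6, [::]); (6, [:: 0]); (6, [:: 0; 0]); (36, [:: 1; 1;
    1])]%N 67672941102896403718434157756416;
Certificate [:: vec 1 [:: 1; -1; 1; -1]; vec 1 [:: 1; -1; 0]; vec 1 [:: 1; -1]; vec 2 [:: 1]]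
  [:: piv 2 6 1 (vec 6 [:: 0; 0; 0; 0; -1]); piv 0 6 1 (vec 6 [:: 0; 0; 0; -2; 1]); piv 1 6 1 (vec 6 [:: 0; 0;
    -2; 2; -1]); piv 3 6 1 (vec 6 [:: 0; 4; -2; 0; -1])]
  [:: fac 18 3 1 [:: -1; -1; -1; -1]; fac 11 2 1 [:: -3; 0; 0; 0]; fac 13 2 1 [:: 0; -3; 0; 0]; fac 12 2 1 [::
    0; 0; -3; 0]; fac 10 2 1 [:: 0; 0; 0; -3]; fac 4 1 1 [:: -3; 3; 3; -3]; fac 5 1 1 [:: 3; 3; -3; -3]; fac 6
    1 1 [:: 3; -3; 3; -3]; fac 7 1 1 [:: -3; 3; -3; 3]; fac 8 1 1 [:: -3; -3; 3; 3]; fac 9 1 1 [:: 3; -3; -3;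
    3]; fac 14 1 2 [:: -3; -3; -3; 3]; fac 15 1 2 [:: 3; -3; -3; -3]; fac 16 1 2 [:: -3; -3; 3; -3]; fac 17 1
    2 [:: -3; 3; -3; -3]]
  [:: (-1, 6); (-1, 3); (-1, 3); (2, 3)] (2, 3) [:: (6, [::]); (6, [:: 0]); (6, [:: 0; 0]); (6, [:: 0; 0;
    0])]%N (-38685626227668133590597632);
Certificate [:: vec 1 [:: 1; -1; 1; -1]; vec 1 [:: 1; -1; 0]; vec 1 [:: 1; -1]; vec 1 [:: 2]]
  [:: piv 2 12 1 (vec 12 [:: 0; 0; 0; 0; -1]); piv 0 12 1 (vec 12 [:: 0; 0; 0; -2; 1]); piv 1 12 1 (vec 12 [::
    0; 0; -2; 2; -1]); piv 18 12 1 (vec 12 [:: 0; -2; 2; 0; 1])]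
  [:: fac 11 2 1 [:: -6; 0; 0; 0]; fac 13 2 1 [:: 0; -6; 0; 0]; fac 12 2 1 [:: 0; 0; -6; 0]; fac 15 (-1) 1 [::
    -6; 0; 0; -6]; fac 17 (-1) 1 [:: 0; -6; 0; -6]; fac 16 (-1) 1 [:: 0; 0; -6; -6]; fac 5 (-2) 1 [:: -6; -6;
    0; -6]; fac 8 4 1 [:: -3; -3; 0; -3]; fac 6 (-2) 1 [:: -6; 0; -6; -6]; fac 7 4 1 [:: -3; 0; -3; -3]; fac 4
    (-2) 1 [:: 0; -6; -6; -6]; fac 9 4 1 [:: 0; -3; -3; -3]; fac 3 6 1 [:: -2; -2; -2; -4]; fac 10 (-4) 1 [::
    -3; -3; -3; -6]; fac 14 2 1 [:: -3; -3; -3; -3]]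
  [:: (-1, 12); (-1, 6); (-1, 6); (-1, 6)] (1, 6) [:: (6, [::]); (6, [:: 0]); (6, [:: 0; 0]); (24, [:: 0; 0;
    0])]%N (-1);
Certificate [:: vec 1 [:: 1; -1; 1; -1]; vec 1 [:: 1; -1; 0]; vec 1 [:: 1; 0]; vec 1 [:: 1]]
  [:: piv 2 4 1 (vec 4 [:: 0; 0; 0; 0; -1]); piv 0 4 1 (vec 4 [:: 0; 0; 0; -2; 1]); piv 8 4 1 (vec 4 [:: 0; 0;
    -2; 2; -1]); piv 4 4 1 (vec 4 [:: 0; -2; 0; 0; 1])]
  [:: fac 18 4 1 [:: -1; -1; -1; 0]; fac 11 2 1 [:: -2; 0; 0; 0]; fac 13 2 1 [:: 0; -2; 0; 0]; fac 5 2 1 [::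
    0; 0; -2; 0]; fac 9 2 1 [:: 0; 0; 0; -2]; fac 17 1 1 [:: -2; 0; -2; 0]; fac 14 1 1 [:: -2; 0; 0; -2]; fac
    15 1 1 [:: 0; -2; -2; 0]; fac 7 2 1 [:: -2; 2; 0; -2]; fac 1 (-2) 1 [:: -2; 0; -2; -2]; fac 12 4 1 [:: -1;
    0; -1; -1]; fac 10 2 1 [:: 0; -2; -2; 2]; fac 3 (-4) 1 [:: 0; -1; -1]; fac 6 4 1 [:: 1; -1; 0]; fac 16 2 1
    [:: 0; -1; 0]]
  [:: (-1, 4); (-1, 2); (-1, 2); (-1, 2)] (1, 2) [:: (6, [::]); (6, [:: 0]); (4, [:: 0; 0]); (28, [:: 1; 1;
    1])]%N 984770902183611232881;
Certificate [:: vec 1 [:: 1; -1; 1; -1]; vec 1 [:: 1; -1; 0]; vec 1 [:: 1; 0]; vec 1 [:: 2]]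
  [:: piv 2 12 1 (vec 12 [:: 0; 0; 0; 0; -1]); piv 0 12 1 (vec 12 [:: 0; 0; 0; -2; 1]); piv 8 12 1 (vec 12 [::
    0; 0; -2; 2; -1]); piv 10 12 1 (vec 12 [:: 0; -2; 2; 0; 1])]
  [:: fac 18 4 1 [:: -3; -3; -3; 0]; fac 11 2 1 [:: -6; 0; 0; 0]; fac 13 2 1 [:: 0; -6; 0; 0]; fac 5 2 1 [::
    0; 0; -6; 0]; fac 3 2 1 [:: 0; 0; 0; -6]; fac 17 1 1 [:: -6; 0; -6; 0]; fac 15 1 1 [:: 0; -6; -6; 0]; fac
    16 (-1) 1 [:: 0; 0; -6; -6]; fac 6 (-2) 1 [:: -6; 0; -6; -6]; fac 7 4 1 [:: -3; 0; -3; -3]; fac 4 (-2) 1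
    [:: 0; -6; -6; -6]; fac 9 4 1 [:: 0; -3; -3; -3]; fac 1 (-4) 1 [:: -3; -3; -6; -3]; fac 12 6 1 [:: -2; -2;
    -4; -2]; fac 14 2 1 [:: -3; -3; -3; -3]]
  [:: (-1, 12); (-1, 6); (-1, 6); (-1, 6)] (1, 2) [:: (6, [::]); (6, [:: 0]); (4, [:: 0; 0]); (6, [:: 0; 0;
    0])]%N (-3486784401);
Certificate [:: vec 1 [:: 1; -1; 1; -1]; vec 1 [:: 1; 0; 0]; vec 1 [:: 1; 0]; vec 1 [:: 1]]
  [:: piv 2 4 1 (vec 4 [:: 0; 0; 0; 0; -1]); piv 7 4 1 (vec 4 [:: 0; 0; 0; -2; 1]); piv 1 4 1 (vec 4 [:: 0; 0;
    -2; 2; -1]); piv 4 4 1 (vec 4 [:: 0; -2; 0; 0; 1])]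
  [:: fac 18 4 1 [:: -1; -1; -1; 0]; fac 11 2 1 [:: -2; 0; 0; 0]; fac 6 2 1 [:: 0; -2; 0; 0]; fac 12 2 1 [::
    0; 0; -2; 0]; fac 9 2 1 [:: 0; 0; 0; -2]; fac 16 1 1 [:: -2; -2; 0; 0]; fac 14 1 1 [:: -2; 0; 0; -2]; fac
    15 1 1 [:: 0; -2; -2; 0]; fac 0 (-2) 1 [:: -2; -2; 0; -2]; fac 13 4 1 [:: -1; -1; 0; -1]; fac 8 2 1 [::
    -2; 0; 2; -2]; fac 10 2 1 [:: 0; -2; -2; 2]; fac 3 (-4) 1 [:: 0; -1; -1]; fac 5 4 1 [:: 1; 0; -1]; fac 17
    2 1 [:: 0; 0; -1]]
  [:: (-1, 4); (-1, 2); (-1, 2); (-1, 2)] (1, 2) [:: (6, [::]); (4, [:: 0]); (6, [:: 0; 0]); (28, [:: 1; 1;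
    1])]%N 984770902183611232881;
Certificate [:: vec 1 [:: 1; -1; 1; -1]; vec 1 [:: 1; 0; 0]; vec 1 [:: 1; 0]; vec 1 [:: 2]]
  [:: piv 2 12 1 (vec 12 [:: 0; 0; 0; 0; -1]); piv 7 12 1 (vec 12 [:: 0; 0; 0; -2; 1]); piv 1 12 1 (vec 12 [::
    0; 0; -2; 2; -1]); piv 10 12 1 (vec 12 [:: 0; -2; 2; 0; 1])]
  [:: fac 18 4 1 [:: -3; -3; -3; 0]; fac 11 2 1 [:: -6; 0; 0; 0]; fac 6 2 1 [:: 0; -6; 0; 0]; fac 12 2 1 [::
    0; 0; -6; 0]; fac 3 2 1 [:: 0; 0; 0; -6]; fac 16 1 1 [:: -6; -6; 0; 0]; fac 15 1 1 [:: 0; -6; -6; 0]; fac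
    17 (-1) 1 [:: 0; -6; 0; -6]; fac 5 (-2) 1 [:: -6; -6; 0; -6]; fac 8 4 1 [:: -3; -3; 0; -3]; fac 4 (-2) 1
    [:: 0; -6; -6; -6]; fac 9 4 1 [:: 0; -3; -3; -3]; fac 0 (-4) 1 [:: -3; -6; -3; -3]; fac 13 6 1 [:: -2; -4;
    -2; -2]; fac 14 2 1 [:: -3; -3; -3; -3]]
  [:: (-1, 12); (-1, 6); (-1, 6); (-1, 6)] (1, 2) [:: (6, [::]); (4, [:: 0]); (6, [:: 0; 0]); (6, [:: 0; 0;
    0])]%N (-3486784401);
Certificate [:: vec 1 [:: 1; -1; 1; -1]; vec 1 [:: 1; 0; 0]; vec 1 [:: 1; 1]; vec 1 [:: 1]]
  [:: piv 2 12 1 (vec 12 [:: 0; 0; 0; 0; -1]); piv 7 12 1 (vec 12 [:: 0; 0; 0; -2; 1]); piv 8 12 1 (vec 12 [::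
    0; 0; -2; 2; -1]); piv 4 12 1 (vec 12 [:: 0; -2; 0; 0; 1])]
  [:: fac 18 6 1 [:: -4; -2; -2; -2]; fac 11 2 1 [:: -6; 0; 0; 0]; fac 6 2 1 [:: 0; -6; 0; 0]; fac 5 2 1 [::
    0; 0; -6; 0]; fac 9 2 1 [:: 0; 0; 0; -6]; fac 16 1 1 [:: -6; -6; 0; 0]; fac 17 1 1 [:: -6; 0; -6; 0]; fac
    14 1 1 [:: -6; 0; 0; -6]; fac 3 (-2) 1 [:: -6; -6; -6; 0]; fac 10 4 1 [:: -3; -3; -3; 0]; fac 0 (-2) 1 [::
    -6; -6; 0; -6]; fac 13 4 1 [:: -3; -3; 0; -3]; fac 1 (-2) 1 [:: -6; 0; -6; -6]; fac 12 4 1 [:: -3; 0; -3;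
    -3]; fac 15 2 1 [:: -3; -3; -3; -3]]
  [:: (-1, 12); (-1, 6); (-1, 6); (-1, 6)] (1, 3) [:: (6, [::]); (4, [:: 0]); (4, [:: 0; 0]); (4, [:: 0; 0;
    0])]%N 12230590464;
Certificate [:: vec 1 [:: 1; 1; -1; -1]; vec 1 [:: 1; 0; -1]; vec 1 [:: 1; -1]; vec 2 [:: 1]]
  [:: piv 3 6 1 (vec 6 [:: 0; 0; 0; 0; -1]); piv 0 6 1 (vec 6 [:: 0; 0; 0; -2; 1]); piv 1 6 1 (vec 6 [:: 0; 0;
    -2; 2; -1]); piv 2 6 1 (vec 6 [:: 0; -4; 2; 0; -1])]
  [:: fac 18 3 1 [:: -1; -1; -1; -1]; fac 10 2 1 [:: -3; 0; 0; 0]; fac 13 2 1 [:: 0; -3; 0; 0]; fac 12 2 1 [::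
    0; 0; -3; 0]; fac 11 2 1 [:: 0; 0; 0; -3]; fac 4 1 1 [:: -3; 3; 3; -3]; fac 5 1 1 [:: -3; 3; -3; 3]; fac 6
    1 1 [:: -3; -3; 3; 3]; fac 7 1 1 [:: 3; 3; -3; -3]; fac 8 1 1 [:: 3; -3; 3; -3]; fac 9 1 1 [:: 3; -3; -3;
    3]; fac 14 1 2 [:: 3; -3; -3; -3]; fac 15 1 2 [:: -3; -3; -3; 3]; fac 16 1 2 [:: -3; -3; 3; -3]; fac 17 1
    2 [:: -3; 3; -3; -3]]
  [:: (-1, 6); (-1, 3); (-1, 3); (-2, 3)] (2, 3) [:: (6, [::]); (6, [:: 0]); (6, [:: 0; 0]); (6, [:: 0; 0;
    0])]%N 38685626227668133590597632;
Certificate [:: vec 1 [:: 1; 1; -1; -1]; vec 1 [:: 1; 0; -1]; vec 1 [:: 1; -1]; vec 1 [:: 1]]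
  [:: piv 3 4 1 (vec 4 [:: 0; 0; 0; 0; -1]); piv 0 4 1 (vec 4 [:: 0; 0; 0; -2; 1]); piv 1 4 1 (vec 4 [:: 0; 0;
    -2; 2; -1]); piv 5 4 1 (vec 4 [:: 0; -2; 2; -2; 1])]
  [:: fac 18 4 1 [:: -1; 0; -1; -1]; fac 10 2 1 [:: -2; 0; 0; 0]; fac 13 2 1 [:: 0; -2; 0; 0]; fac 12 2 1 [::
    0; 0; -2; 0]; fac 8 2 1 [:: 0; 0; 0; -2]; fac 16 1 1 [:: -2; 0; 0; -2]; fac 14 1 1 [:: 0; 0; -2; -2]; fac
    4 2 1 [:: -2; 2; 0; -2]; fac 7 2 1 [:: 0; 2; -2; -2]; fac 2 (-2) 1 [:: -2; 2; -2; -4]; fac 11 4 1 [:: -1;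
    1; -1; -2]; fac 17 1 1 [:: -2; 2; -2; -2]; fac 6 4 1 [:: 0; -1; 1]; fac 9 4 1 [:: 1; -1; 0]; fac 15 2 1
    [:: 0; -1; 0]]
  [:: (-1, 4); (-1, 2); (-1, 2); (-1, 2)] (1, 2) [:: (6, [::]); (6, [:: 0]); (6, [:: 0; 0]); (28, [:: 1; 1;
    1])]%N 984770902183611232881;
Certificate [:: vec 1 [:: 1; 1; -1; -1]; vec 1 [:: 1; 0; -1]; vec 1 [:: 1; 0]; vec 1 [:: 1]]
  [:: piv 3 4 1 (vec 4 [:: 0; 0; 0; 0; -1]); piv 0 4 1 (vec 4 [:: 0; 0; 0; -2; 1]); piv 4 4 1 (vec 4 [:: 0; 0;
    -2; 0; 1]); piv 6 4 1 (vec 4 [:: 0; -2; 0; 2; -1])]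
  [:: fac 18 4 1 [:: -1; -1; 0; -1]; fac 10 2 1 [:: -2; 0; 0; 0]; fac 13 2 1 [:: 0; -2; 0; 0]; fac 9 2 1 [::
    0; 0; -2; 0]; fac 7 2 1 [:: 0; 0; 0; -2]; fac 15 1 1 [:: -2; 0; -2; 0]; fac 17 1 1 [:: -2; 0; 0; -2]; fac
    14 1 1 [:: 0; -2; 0; -2]; fac 5 2 1 [:: -2; 2; -2; 0]; fac 1 (-2) 1 [:: -2; 0; -2; -2]; fac 12 4 1 [:: -1;
    0; -1; -1]; fac 11 2 1 [:: 0; -2; 2; -2]; fac 2 4 1 [:: 0; 1; -1]; fac 8 4 1 [:: 1; -1]; fac 16 2 1 [:: 0;
    -1]]
  [:: (-1, 4); (-1, 2); (-1, 2); (-1, 2)] (1, 2) [:: (6, [::]); (6, [:: 0]); (19, [:: 1; 1]); (28, [:: 1; 1;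
    1])]%N 984770902183611232881;
Certificate [:: vec 1 [:: 1; 1; -1; -1]; vec 1 [:: 1; 0; -1]; vec 1 [:: 1; 1]; vec 1 [:: 1]]
  [:: piv 3 12 1 (vec 12 [:: 0; 0; 0; 0; -1]); piv 0 12 1 (vec 12 [:: 0; 0; 0; -2; 1]); piv 11 12 1 (vec 12
    [:: 0; 0; -2; 0; 1]); piv 6 12 1 (vec 12 [:: 0; -2; 0; 2; -1])]
  [:: fac 18 4 1 [:: -3; -3; 0; -3]; fac 10 2 1 [:: -6; 0; 0; 0]; fac 13 2 1 [:: 0; -6; 0; 0]; fac 2 2 1 [::
    0; 0; -6; 0]; fac 7 2 1 [:: 0; 0; 0; -6]; fac 17 1 1 [:: -6; 0; 0; -6]; fac 14 1 1 [:: 0; -6; 0; -6]; fac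
    16 (-1) 1 [:: 0; 0; -6; -6]; fac 5 4 1 [:: -3; 0; -3; -3]; fac 8 (-2) 1 [:: -6; 0; -6; -6]; fac 4 (-2) 1
    [:: 0; -6; -6; -6]; fac 9 4 1 [:: 0; -3; -3; -3]; fac 1 (-4) 1 [:: -3; -3; -3; -6]; fac 12 6 1 [:: -2; -2;
    -2; -4]; fac 15 2 1 [:: -3; -3; -3; -3]]
  [:: (-1, 12); (-1, 6); (-1, 6); (-1, 6)] (1, 2) [:: (6, [::]); (6, [:: 0]); (6, [:: 0; 0]); (4, [:: 0; 0;
    0])]%N (-3486784401);
Certificate [:: vec 1 [:: 1; 1; -1; -1]; vec 1 [:: 1; 0; 0]; vec 1 [:: 1; 0]; vec 1 [:: 1]]
  [:: piv 3 4 1 (vec 4 [:: 0; 0; 0; 0; -1]); piv 5 4 1 (vec 4 [:: 0; 0; 0; -2; 1]); piv 4 4 1 (vec 4 [:: 0; 0;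
    -2; 0; 1]); piv 1 4 1 (vec 4 [:: 0; -2; 0; 2; -1])]
  [:: fac 18 4 1 [:: -1; -1; 0; -1]; fac 10 2 1 [:: -2; 0; 0; 0]; fac 8 2 1 [:: 0; -2; 0; 0]; fac 9 2 1 [:: 0;
    0; -2; 0]; fac 12 2 1 [:: 0; 0; 0; -2]; fac 16 1 1 [:: -2; -2; 0; 0]; fac 15 1 1 [:: -2; 0; -2; 0]; fac 14
    1 1 [:: 0; -2; 0; -2]; fac 0 (-2) 1 [:: -2; -2; -2; 0]; fac 13 4 1 [:: -1; -1; -1; 0]; fac 6 2 1 [:: -2;
    0; -2; 2]; fac 11 2 1 [:: 0; -2; 2; -2]; fac 2 4 1 [:: 0; 1; -1]; fac 7 (-4) 1 [:: -1; 0; -1]; fac 17 (-2)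
    1 [:: 0; 0; -1]]
  [:: (-1, 4); (-1, 2); (-1, 2); (-1, 2)] (1, 2) [:: (6, [::]); (4, [:: 0]); (4, [:: 0; 0]); (28, [:: 1; 1;
    1])]%N (-984770902183611232881);
Certificate [:: vec 1 [:: 1; 1; -1; -1]; vec 1 [:: 1; 0; 0]; vec 1 [:: 1; 0]; vec 1 [:: 2]]
  [:: piv 3 12 1 (vec 12 [:: 0; 0; 0; 0; -1]); piv 5 12 1 (vec 12 [:: 0; 0; 0; -2; 1]); piv 4 12 1 (vec 12 [::
    0; 0; -2; 0; 1]); piv 6 12 1 (vec 12 [:: 0; -2; 2; 2; -1])]
  [:: fac 18 6 1 [:: -4; -2; -2; -2]; fac 10 2 1 [:: -6; 0; 0; 0]; fac 8 2 1 [:: 0; -6; 0; 0]; fac 9 2 1 [::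
    0; 0; -6; 0]; fac 7 2 1 [:: 0; 0; 0; -6]; fac 16 1 1 [:: -6; -6; 0; 0]; fac 15 1 1 [:: -6; 0; -6; 0]; fac
    17 1 1 [:: -6; 0; 0; -6]; fac 0 (-2) 1 [:: -6; -6; -6; 0]; fac 13 4 1 [:: -3; -3; -3; 0]; fac 2 (-2) 1 [::
    -6; -6; 0; -6]; fac 11 4 1 [:: -3; -3; 0; -3]; fac 1 (-2) 1 [:: -6; 0; -6; -6]; fac 12 4 1 [:: -3; 0; -3;
    -3]; fac 14 2 1 [:: -3; -3; -3; -3]]
  [:: (-1, 12); (-1, 6); (-1, 6); (-1, 6)] (1, 3) [:: (6, [::]); (4, [:: 0]); (4, [:: 0; 0]); (4, [:: 0; 0;
    0])]%N 12230590464;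
Certificate [:: vec 1 [:: 1; 1; -1; -1]; vec 1 [:: 1; 0; 0]; vec 1 [:: 1; 1]; vec 1 [:: 1]]
  [:: piv 3 12 1 (vec 12 [:: 0; 0; 0; 0; -1]); piv 5 12 1 (vec 12 [:: 0; 0; 0; -2; 1]); piv 11 12 1 (vec 12
    [:: 0; 0; -2; 0; 1]); piv 1 12 1 (vec 12 [:: 0; -2; 0; 2; -1])]
  [:: fac 18 4 1 [:: -3; -3; 0; -3]; fac 10 2 1 [:: -6; 0; 0; 0]; fac 8 2 1 [:: 0; -6; 0; 0]; fac 2 2 1 [:: 0;
    0; -6; 0]; fac 12 2 1 [:: 0; 0; 0; -6]; fac 16 1 1 [:: -6; -6; 0; 0]; fac 17 (-1) 1 [:: 0; -6; -6; 0]; fac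
    14 1 1 [:: 0; -6; 0; -6]; fac 6 4 1 [:: -3; -3; -3; 0]; fac 7 (-2) 1 [:: -6; -6; -6; 0]; fac 4 (-2) 1 [::
    0; -6; -6; -6]; fac 9 4 1 [:: 0; -3; -3; -3]; fac 0 (-4) 1 [:: -3; -6; -3; -3]; fac 13 6 1 [:: -2; -4; -2;
    -2]; fac 15 2 1 [:: -3; -3; -3; -3]]
  [:: (-1, 12); (-1, 6); (-1, 6); (-1, 6)] (1, 2) [:: (6, [::]); (4, [:: 0]); (6, [:: 0; 0]); (6, [:: 0; 0;
    0])]%N (-3486784401);
Certificate [:: vec 1 [:: 1; 1; -1; -1]; vec 1 [:: 1; 1; -1]; vec 1 [:: 1; 0]; vec 1 [:: 1]]
  [:: piv 3 4 1 (vec 4 [:: 0; 0; 0; 0; -1]); piv 7 4 1 (vec 4 [:: 0; 0; 0; -2; 1]); piv 4 4 1 (vec 4 [:: 0; 0;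
    -2; 0; 1]); piv 2 4 1 (vec 4 [:: 0; -2; 2; 0; -1])]
  [:: fac 18 4 1 [:: -1; 0; -1; -1]; fac 10 2 1 [:: -2; 0; 0; 0]; fac 6 2 1 [:: 0; -2; 0; 0]; fac 9 2 1 [:: 0;
    0; -2; 0]; fac 11 2 1 [:: 0; 0; 0; -2]; fac 15 1 1 [:: -2; 0; -2; 0]; fac 16 1 1 [:: 0; -2; 0; -2]; fac 14
    1 1 [:: 0; 0; -2; -2]; fac 12 2 1 [:: -2; 2; -2; 0]; fac 8 2 1 [:: 2; -2; 0; -2]; fac 0 (-2) 1 [:: 0; -2;
    -2; -2]; fac 13 4 1 [:: 0; -1; -1; -1]; fac 5 4 1 [:: -1; 1; 0]; fac 1 4 1 [:: 1; -1]; fac 17 2 1 [:: -1]]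
  [:: (-1, 4); (-1, 2); (-1, 2); (-1, 2)] (1, 2) [:: (6, [::]); (10, [:: 1]); (19, [:: 1; 1]); (19, [:: 1; 1;
    0])]%N 984770902183611232881;
Certificate [:: vec 1 [:: 1; 1; -1; -1]; vec 1 [:: 1; 1; 0]; vec 1 [:: 1; 0]; vec 1 [:: 1]]
  [:: piv 3 12 1 (vec 12 [:: 0; 0; 0; 0; -1]); piv 12 12 1 (vec 12 [:: 0; 0; 0; -2; 1]); piv 4 12 1 (vec 12
    [:: 0; 0; -2; 0; 1]); piv 2 12 1 (vec 12 [:: 0; -2; 2; 0; -1])]
  [:: fac 18 4 1 [:: -3; 0; -3; -3]; fac 10 2 1 [:: -6; 0; 0; 0]; fac 1 2 1 [:: 0; -6; 0; 0]; fac 9 2 1 [:: 0;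
    0; -6; 0]; fac 11 2 1 [:: 0; 0; 0; -6]; fac 15 1 1 [:: -6; 0; -6; 0]; fac 17 (-1) 1 [:: 0; -6; -6; 0]; fac
    14 1 1 [:: 0; 0; -6; -6]; fac 6 4 1 [:: -3; -3; -3; 0]; fac 7 (-2) 1 [:: -6; -6; -6; 0]; fac 5 (-2) 1 [::
    0; -6; -6; -6]; fac 8 4 1 [:: 0; -3; -3; -3]; fac 0 (-4) 1 [:: -3; -3; -6; -3]; fac 13 6 1 [:: -2; -2; -4;
    -2]; fac 16 2 1 [:: -3; -3; -3; -3]]
  [:: (-1, 12); (-1, 6); (-1, 6); (-1, 6)] (1, 2) [:: (6, [::]); (6, [:: 0]); (4, [:: 0; 0]); (6, [:: 0; 0;
    0])]%N (-3486784401);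
Certificate [:: vec 1 [:: 1; 1; 1; -1]; vec 1 [:: 1; 0; 0]; vec 1 [:: 1; -1]; vec 1 [:: 1]]
  [:: piv 9 4 1 (vec 4 [:: 0; 0; 0; 0; -1]); piv 0 4 1 (vec 4 [:: 0; 0; 0; -2; 1]); piv 1 4 1 (vec 4 [:: 0; 0;
    -2; 2; -1]); piv 5 4 1 (vec 4 [:: 0; -2; 2; -2; 1])]
  [:: fac 18 4 1 [:: -1; -1; -1; 0]; fac 4 2 1 [:: -2; 0; 0; 0]; fac 13 2 1 [:: 0; -2; 0; 0]; fac 12 2 1 [::
    0; 0; -2; 0]; fac 8 2 1 [:: 0; 0; 0; -2]; fac 16 1 1 [:: -2; -2; 0; 0]; fac 17 1 1 [:: -2; 0; -2; 0]; fac
    14 1 1 [:: 0; 0; -2; -2]; fac 10 2 1 [:: -2; -2; 0; 2]; fac 2 (-2) 1 [:: -2; 0; -2; -2]; fac 11 4 1 [::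
    -1; 0; -1; -1]; fac 7 2 1 [:: 0; 2; -2; -2]; fac 3 (-4) 1 [:: -1; -1; 0]; fac 6 4 1 [:: 0; -1; 1]; fac 15
    2 1 [:: 0; -1; 0]]
  [:: (-1, 4); (-1, 2); (-1, 2); (-1, 2)] (1, 2) [:: (4, [::]); (6, [:: 0]); (6, [:: 0; 0]); (28, [:: 1; 1;
    1])]%N 984770902183611232881;
Certificate [:: vec 1 [:: 1; 1; 1; -1]; vec 1 [:: 1; 0; 0]; vec 1 [:: 1; -1]; vec 1 [:: 2]]
  [:: piv 9 12 1 (vec 12 [:: 0; 0; 0; 0; -1]); piv 0 12 1 (vec 12 [:: 0; 0; 0; -2; 1]); piv 1 12 1 (vec 12 [::
    0; 0; -2; 2; -1]); piv 10 12 1 (vec 12 [:: 0; -2; 2; 0; 1])]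
  [:: fac 18 4 1 [:: -3; -3; -3; 0]; fac 4 2 1 [:: -6; 0; 0; 0]; fac 13 2 1 [:: 0; -6; 0; 0]; fac 12 2 1 [::
    0; 0; -6; 0]; fac 3 2 1 [:: 0; 0; 0; -6]; fac 16 1 1 [:: -6; -6; 0; 0]; fac 17 1 1 [:: -6; 0; -6; 0]; fac
    15 (-1) 1 [:: -6; 0; 0; -6]; fac 5 (-2) 1 [:: -6; -6; 0; -6]; fac 8 4 1 [:: -3; -3; 0; -3]; fac 6 (-2) 1
    [:: -6; 0; -6; -6]; fac 7 4 1 [:: -3; 0; -3; -3]; fac 2 (-4) 1 [:: -6; -3; -3; -3]; fac 11 6 1 [:: -4; -2;
    -2; -2]; fac 14 2 1 [:: -3; -3; -3; -3]]
  [:: (-1, 12); (-1, 6); (-1, 6); (-1, 6)] (1, 2) [:: (4, [::]); (6, [:: 0]); (6, [:: 0; 0]); (6, [:: 0; 0;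
    0])]%N (-3486784401);
Certificate [:: vec 1 [:: 1; 1; 1; -1]; vec 1 [:: 1; 0; 0]; vec 1 [:: 1; 0]; vec 1 [:: 1]]
  [:: piv 9 12 1 (vec 12 [:: 0; 0; 0; 0; -1]); piv 0 12 1 (vec 12 [:: 0; 0; 0; -2; 1]); piv 8 12 1 (vec 12 [::
    0; 0; -2; 2; -1]); piv 6 12 1 (vec 12 [:: 0; -2; 0; 2; -1])]
  [:: fac 18 6 1 [:: -2; -4; -2; -2]; fac 4 2 1 [:: -6; 0; 0; 0]; fac 13 2 1 [:: 0; -6; 0; 0]; fac 5 2 1 [::
    0; 0; -6; 0]; fac 7 2 1 [:: 0; 0; 0; -6]; fac 16 1 1 [:: -6; -6; 0; 0]; fac 15 1 1 [:: 0; -6; -6; 0]; fac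
    14 1 1 [:: 0; -6; 0; -6]; fac 3 (-2) 1 [:: -6; -6; -6; 0]; fac 10 4 1 [:: -3; -3; -3; 0]; fac 2 (-2) 1 [::
    -6; -6; 0; -6]; fac 11 4 1 [:: -3; -3; 0; -3]; fac 1 (-2) 1 [:: 0; -6; -6; -6]; fac 12 4 1 [:: 0; -3; -3;
    -3]; fac 17 2 1 [:: -3; -3; -3; -3]]
  [:: (-1, 12); (-1, 6); (-1, 6); (-1, 6)] (1, 3) [:: (4, [::]); (6, [:: 0]); (4, [:: 0; 0]); (4, [:: 0; 0;
    0])]%N 12230590464;
Certificate [:: vec 1 [:: 1; 1; 1; -1]; vec 1 [:: 1; 1; 0]; vec 1 [:: 1; 0]; vec 1 [:: 1]]
  [:: piv 9 12 1 (vec 12 [:: 0; 0; 0; 0; -1]); piv 7 12 1 (vec 12 [:: 0; 0; 0; -2; 1]); piv 1 12 1 (vec 12 [::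
    0; 0; -2; 2; -1]); piv 5 12 1 (vec 12 [:: 0; -2; 2; -2; 1])]
  [:: fac 18 6 1 [:: -2; -2; -4; -2]; fac 4 2 1 [:: -6; 0; 0; 0]; fac 6 2 1 [:: 0; -6; 0; 0]; fac 12 2 1 [::
    0; 0; -6; 0]; fac 8 2 1 [:: 0; 0; 0; -6]; fac 17 1 1 [:: -6; 0; -6; 0]; fac 15 1 1 [:: 0; -6; -6; 0]; fac
    14 1 1 [:: 0; 0; -6; -6]; fac 3 (-2) 1 [:: -6; -6; -6; 0]; fac 10 4 1 [:: -3; -3; -3; 0]; fac 2 (-2) 1 [::
    -6; 0; -6; -6]; fac 11 4 1 [:: -3; 0; -3; -3]; fac 0 (-2) 1 [:: 0; -6; -6; -6]; fac 13 4 1 [:: 0; -3; -3;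
    -3]; fac 16 2 1 [:: -3; -3; -3; -3]]
  [:: (-1, 12); (-1, 6); (-1, 6); (-1, 6)] (1, 3) [:: (4, [::]); (4, [:: 0]); (6, [:: 0; 0]); (4, [:: 0; 0;
    0])]%N 12230590464].

Definition results0 : seq Z := [::
    47161156761589457116260012897403941990106837461250231992110051386781073408].

Definition results1 : seq Z := [::
    (-13314413394595694301271930863154966979021214892327735418174964159951667200)].

Definition results2 : seq Z := [:: 4096984161241717764371450231864607688764524725359165061358818042614644736].

Definition results3 : seq Z := [:: (-50553595694956113824819781842515095893460463772164393529774884289249280);
    19993620204064352233332897338848478668350935140359582445403941392875520;
    (-1203301737226983085056210209368340610546108016102186127877101841792856704)].

Definition results4 : seq Z := [::
    (-2755069258375291326352798082930834538287839536803468883197336116990574592);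
    3551567336129796544460776750656273636667334577700088180237113741855948800;
    (-572058992347620822461858484319487756819155337362231620485139108768);
    114953791626428378833774388928604643829093189209250476128365941152457520;
    (-86984840954700450903512539623720429977085569980764491090582736);
    114953791626428378833774388928604643829093189209250476128365941152457520;
    (-86984840954700450903512539623720429977085569980764491090582736);
    33023572520973729522573314371024213620921743841402015298093056;
    (-3551567336129796544460776750656273636667334577700088180237113741855948800);
    796497505695512870487156205866954778891738221741281934808157139726265440;
    911451297321941249320930594795559422720831410950532410936523080878722960;
    (-86984840954700450903512539623720429977085569980764491090582736);
    (-125297272206333554479113557301513766063942970599661496531349012480992);
    33023572520973729522573314371024213620921743841402015298093056;
    (-86984840954700450903512539623720429977085569980764491090582736);
    1026530386220575961709184097281465580315988543130382548561420371043661472;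
    (-86984840954700450903512539623720429977085569980764491090582736);
    114953791626428378833774388928604643829093189209250476128365941152457520;
    (-86984840954700450903512539623720429977085569980764491090582736);
    33023572520973729522573314371024213620921743841402015298093056;
    33023572520973729522573314371024213620921743841402015298093056].

Local Close Scope Z_scope.

(** Every flag is a separate evaluation, left to the virtual machine and checked when the proof is
    closed. *)
Ltac compute_results :=
  repeat match goal with
  | |- have_results _ _ _ => split
  | |- _ = ?r => vm_cast_no_check (@erefl _ r)
  end; exact: I.

Lemma have_results0 : have_results common_denominator certificates0 results0.
Proof. compute_results. Qed.

Lemma have_results1 : have_results common_denominator certificates1 results1.
Proof. compute_results. Qed.

Lemma have_results2 : have_results common_denominator certificates2 results2.
Proof. compute_results. Qed.

Lemma have_results3 : have_results common_denominator certificates3 results3.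
Proof. compute_results. Qed.

Lemma have_results4 : have_results common_denominator certificates4 results4.
Proof. compute_results. Qed.

(** * Assembling the five levels *)

Definition certificates j :=
  nth [::] [:: certificates0; certificates1; certificates2; certificates3; certificates4] j.

Definition results j := nth [::] [:: results0; results1; results2; results3; results4] j.

Lemma complete_certificates j : (j <= 4)%N -> complete_flags j (certificates j).
Proof. by move: j => [|[|[|[|[|//]]]]] _; vm_compute. Qed.

Lemma have_results_certificates j : (j <= 4)%N ->
  have_results common_denominator (certificates j) (results j).
Proof.
move: j => [|[|[|[|[|//]]]]] _.
- exact: have_results0.
- exact: have_results1.
- exact: have_results2.
- exact: have_results3.
- exact: have_results4.
Qed.

Definition level_value j J : rat :=
  (-1) ^+ j * \sum_(phi <- map flag (certificates j)) iterres (integrand phi (system j (with_below J))).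

(** The signs (-1)^j of the residue formula cancel those of inclusion-exclusion, so all weights 1,
    4, 6, 4, 2 are positive. *)
Definition condorcet_numerator : Z :=
  Eval vm_compute in let t j := sumZ (results j) in
    (t 0%N + 4 * t 1%N + 6 * t 2%N + 4 * t 3%N + 2 * t 4%N)%BZ.

Lemma sum_levels (A : comPzRingType) k (w a b c d e : 'I_k -> A) :
  \sum_i w i * (a i - 4%:R * b i + 6%:R * c i - 4%:R * d i + 2%:R * e i) =
  \sum_i w i * a i - 4%:R * \sum_i w i * b i + 6%:R * \sum_i w i * c i
  - 4%:R * \sum_i w i * d i + 2%:R * \sum_i w i * e i.
Proof.
elim: k w a b c d e => [|k IH] w a b c d e; first by rewrite !big_ord0; ring.
rewrite !big_ord_recl (IH (fun i => w (lift ord0 i)) (fun i => a (lift ord0 i))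
  (fun i => b (lift ord0 i)) (fun i => c (lift ord0 i)) (fun i => d (lift ord0 i))
  (fun i => e (lift ord0 i))); ring.
Qed.

Lemma sum_level_values j : (j <= 4)%N ->
  \sum_(i < 24) race_weight i * level_value j i.+1 =
  (-1) ^+ j * (ofZ rat (sumZ (results j)) / ofZ rat common_denominator).
Proof.
move=> j4; have /and3P[_ fl _] := complete_certificates j4.
rewrite -(sum_results fl (have_results_certificates j4)) [RHS]mulr_sumr.
by apply: eq_bigr => i _; rewrite /level_value [LHS]mulrCA.
Qed.

Lemma alternating_sum (x : rat) (t0 t1 t2 t3 t4 : Z) :
  (-1) ^+ 0 * (ofZ rat t0 * x) - 4%:R * ((-1) ^+ 1 * (ofZ rat t1 * x))
  + 6%:R * ((-1) ^+ 2 * (ofZ rat t2 * x)) - 4%:R * ((-1) ^+ 3 * (ofZ rat t3 * x))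
  + 2%:R * ((-1) ^+ 4 * (ofZ rat t4 * x)) =
  ofZ rat (t0 + 4 * t1 + 6 * t2 + 4 * t3 + 2 * t4)%BZ * x.
Proof.
rewrite !ofZD !ofZM (_ : ofZ rat 4%BZ = 4%:R) // (_ : ofZ rat 6%BZ = 6%:R) //.
rewrite (_ : ofZ rat 2%BZ = 2%:R) //.
move: (ofZ rat t0) (ofZ rat t1) (ofZ rat t2) (ofZ rat t3) (ofZ rat t4) => {}t0 {}t1 {}t2 {}t3 {}t4.
ring.
Qed.

Lemma has_value_condorcet4 (R : realType) :
  has_value R 4 (condorcet_steps 4) (ofZ rat condorcet_numerator / ofZ rat common_denominator).
Proof.
have H := has_value_condorcet (V := level_value) (fun j J lej _ => @has_value_complete R j J _ lej (complete_certificates lej)).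
suff <- : \sum_(i < 24) race_weight i * (level_value 0 i.+1 - 4%:R * level_value 1 i.+1
    + 6%:R * level_value 2 i.+1 - 4%:R * level_value 3 i.+1 + 2%:R * level_value 4 i.+1) =
  ofZ rat condorcet_numerator / ofZ rat common_denominator by exact: H.
rewrite (sum_levels (fun i : 'I_24 => race_weight i) (fun i : 'I_24 => level_value 0 i.+1)
  (fun i : 'I_24 => level_value 1 i.+1) (fun i : 'I_24 => level_value 2 i.+1)
  (fun i : 'I_24 => level_value 3 i.+1) (fun i : 'I_24 => level_value 4 i.+1)).
rewrite (sum_level_values (isT : (0 <= 4)%N)) (sum_level_values (isT : (1 <= 4)%N))
  (sum_level_values (isT : (2 <= 4)%N)) (sum_level_values (isT : (3 <= 4)%N))
  (sum_level_values (isT : (4 <= 4)%N)).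
apply: etrans (alternating_sum _ _ _ _ _ _) _; congr (ofZ rat _ * _).
Qed.

(** * Decimal numerals and the final fraction *)

Fixpoint uint_value (u : Decimal.uint) (acc : Z) : Z :=
  match u with
  | Decimal.Nil => acc
  | Decimal.D0 u => uint_value u (Z.add 0 (Z.mul 10 acc))
  | Decimal.D1 u => uint_value u (Z.add 1 (Z.mul 10 acc))
  | Decimal.D2 u => uint_value u (Z.add 2 (Z.mul 10 acc))
  | Decimal.D3 u => uint_value u (Z.add 3 (Z.mul 10 acc))
  | Decimal.D4 u => uint_value u (Z.add 4 (Z.mul 10 acc))
  | Decimal.D5 u => uint_value u (Z.add 5 (Z.mul 10 acc))
  | Decimal.D6 u => uint_value u (Z.add 6 (Z.mul 10 acc))
  | Decimal.D7 u => uint_value u (Z.add 7 (Z.mul 10 acc))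
  | Decimal.D8 u => uint_value u (Z.add 8 (Z.mul 10 acc))
  | Decimal.D9 u => uint_value u (Z.add 9 (Z.mul 10 acc))
  end.

(* Large numerals of type [nat] are kept in decimal form by the system.      *)
Lemma natr_numeral (L : pzRingType) u :
  (Nat.of_num_uint (Number.UIntDecimal u))%:R = ofZ L (uint_value u 0%BZ).
Proof.
rewrite /Nat.of_num_uint /Nat.of_uint.
have : 0%:R = ofZ L 0%BZ by [].
have digit d n z : n%:R = ofZ L z -> (d + Nat.tail_mul 10 n)%:R = ofZ L (Z.add (Z.of_nat d) (Z.mul 10 z)).
  move=> E; rewrite ofZD ofZM natrD; congr (_ + _).
    by rewrite /ofZ (_ : int_of_Z (Z.of_nat d) = d) //; lia.
  by rewrite PeanoNat.Nat.tail_mul_spec -[(_ * _)%coq_nat]/(10 * n)%N natrM E.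
elim: u (0%N) (0%BZ) => [//|u IH|u IH|u IH|u IH|u IH|u IH|u IH|u IH|u IH|u IH] n z E /=.
- exact: IH (digit 0%N _ _ E).
- exact: IH (digit 1%N _ _ E).
- exact: IH (digit 2%N _ _ E).
- exact: IH (digit 3%N _ _ E).
- exact: IH (digit 4%N _ _ E).
- exact: IH (digit 5%N _ _ E).
- exact: IH (digit 6%N _ _ E).
- exact: IH (digit 7%N _ _ E).
- exact: IH (digit 8%N _ _ E).
- exact: IH (digit 9%N _ _ E).
Qed.

Lemma ratr_ofZ (L : numFieldType) n x d a b : d != 0%BZ -> b != 0%BZ ->
  Z.mul (Z.mul (Z.of_nat n) x) b = Z.mul a d ->
  ratr (ofZ rat x / ofZ rat d *+ n) = ofZ L a / ofZ L b.
Proof.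
rewrite -(ofZ_eq0 L) -(ofZ_eq0 L) => d0 b0 /(congr1 (ofZ L)); rewrite !ofZM => E.
rewrite rmorphMn fmorph_div /= /ofZ !ratr_int -!/(ofZ L _).
apply/eqP; rewrite -mulrnAl eqr_div //; apply/eqP; rewrite -E; congr (_ * _).
rewrite -mulr_natl; congr (_ * _).
by rewrite /ofZ (_ : int_of_Z (Z.of_nat n) = n) //; lia.
Qed.

Lemma ofZ_pos (L : numDomainType) p : 0 <= ofZ L (Zpos p).
Proof. by rewrite /ofZ ler0z. Qed.

(** The numerals stay in decimal form, and the identification of the limit becomes one
    cross-multiplied equality of integers; the factor 5 counts the possible winners. *)
Lemma condorcet_limit_numerals (R : realType) u v : uint_value v 0%BZ != 0%BZ ->
  Z.mul (Z.mul 5 condorcet_numerator) (uint_value v 0%BZ) =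
    Z.mul (uint_value u 0%BZ) common_denominator ->
  iac_condorcet_probability R 5 k @[k --> \oo] -->
    ((Nat.of_num_uint (Number.UIntDecimal u))%:R / (Nat.of_num_uint (Number.UIntDecimal v))%:R : R).
Proof.
move=> v0 E; rewrite (natr_numeral R u) (natr_numeral R v).
have D0 : common_denominator != 0%BZ by vm_compute.
have p0 : 0 <= ofZ rat condorcet_numerator / ofZ rat common_denominator.
  by apply: divr_ge0; apply: ofZ_pos.
rewrite -(@ratr_ofZ R 5 condorcet_numerator common_denominator _ _ D0 v0 E).
exact: condorcet_limit p0 (@has_value_condorcet4 R).
Qed.


Unset Implicit Arguments.

Theorem mainTheorem2 (R : realType) :
  iac_condorcet_probability R 5 k @[k --> \oo] -->
    (760794547958864241496408591531018198021484884229346111658236615929935%:R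
     / 1010827262551214358630401511004028249102084136257935356483840264634368%:R
     : R).
Proof.
(* Two facts on integers remain: the denominator is nonzero, and the cross products agree. *)
by refine (@condorcet_limit_numerals R _ _ _ _); vm_compute.
Qed.
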